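(* Assume GRH. Let $\ell$ be an odd prime and $\chi$ a character of order $\ell$ and conductor $q$. Then, as $q\to\infty$, $$\frac{C_\ell}{\left(2e^\gamma\log_2q\right)^{\cos(\pi/\ell)}}(1+o(1))\le|L(1,\chi)|\le 2e^\gamma\log_2q\,(1+o(1)),$$ where $$C_\ell=\prod_p\left[\left(1-\frac1p\right)^{-\cos(\pi/\ell)}\left(1+\frac{2\cos(\pi/\ell)}{p}+\frac1{p^2}\right)^{-1/2}\right].$$
   Context: $\gamma$ is Euler's constant, $\log_2q=\log\log q$. *)

(* Defs.v *)
From Stdlib Require Import Reals ZArith Znumtheory Arith.
From Coquelicot Require Import Coquelicot.
Open Scope R_scope.

Definition cpow_neg (n : nat) (s : C) : C :=
  let r := exp (- Re s * ln (INR n)) in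
  (r * cos (Im s * ln (INR n)), - (r * sin (Im s * ln (INR n)))).

Fixpoint cpow (z : C) (k : nat) : C :=
  match k with O => RtoC 1 | S j => Cmult z (cpow z j) end.

Fixpoint dpartial (a : nat -> C) (s : C) (N : nat) : C :=
  match N with
  | O => RtoC 0
  | S m => Cplus (dpartial a s m) (Cmult (a (S m)) (cpow_neg (S m) s))
  end.

Definition dseries_conv (a : nat -> C) (s z : C) : Prop :=
  is_lim_seq (fun N => Re (dpartial a s N)) (Re z) /\
  is_lim_seq (fun N => Im (dpartial a s N)) (Im z).

Definition dseries_val (a : nat -> C) (s : C) : C :=
  (real (Lim_seq (fun N => Re (dpartial a s N))),
   real (Lim_seq (fun N => Im (dpartial a s N)))).

Definition is_dirichlet_char (q : nat) (chi : nat -> C) : Prop :=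
  (1 <= q)%nat /\
  (forall m n, chi (m * n)%nat = Cmult (chi m) (chi n)) /\
  (forall n, chi (n + q)%nat = chi n) /\
  chi 1%nat = RtoC 1 /\
  (forall n, chi n = RtoC 0 <-> Nat.gcd n q <> 1%nat).

Definition principal (q : nat) (chi : nat -> C) : Prop :=
  forall n, Nat.gcd n q = 1%nat -> chi n = RtoC 1.

Definition char_order (q : nat) (chi : nat -> C) (k : nat) : Prop :=
  (0 < k)%nat /\
  (forall n, Nat.gcd n q = 1%nat -> cpow (chi n) k = RtoC 1) /\
  (forall j, (0 < j < k)%nat ->
     exists n, Nat.gcd n q = 1%nat /\ cpow (chi n) j <> RtoC 1).

(** chi is primitive modulo q, i.e. has conductor q: for no proper divisor d
    of q is chi trivial on the residues n coprime to q with n = 1 mod d. *)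
Definition primitive_char (q : nat) (chi : nat -> C) : Prop :=
  forall d, Nat.divide d q -> (d < q)%nat ->
    exists n, Nat.gcd n q = 1%nat /\ Nat.modulo n d = Nat.modulo 1 d /\ chi n <> RtoC 1.

Definition L1 (chi : nat -> C) : C := dseries_val chi (RtoC 1).

Definition eta_coeff (n : nat) : C := RtoC ((-1) ^ (n - 1)).

(** Generalized Riemann Hypothesis: RH for zeta (via eta(s) = (1-2^(1-s)) zeta(s),
    whose series converges for Re s > 0) and, for every non-principal Dirichlet
    character, every zero in the critical strip 0 < Re s < 1 lies on Re s = 1/2
    (the Dirichlet series converges on Re s > 0 for non-principal chi). *)
Definition GRH : Prop :=
  (forall s : C, 0 < Re s < 1 -> dseries_conv eta_coeff s (RtoC 0) -> Re s = 1/2) /\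
  (forall (q : nat) (chi : nat -> C), is_dirichlet_char q chi -> ~ principal q chi ->
     forall s : C, 0 < Re s < 1 -> dseries_conv chi s (RtoC 0) -> Re s = 1/2).

Definition euler_gamma : R :=
  real (Lim_seq (fun n => sum_f_R0 (fun k => / INR (S k)) n - ln (INR (S n)))).

Fixpoint prod_primes (f : nat -> R) (N : nat) : R :=
  match N with
  | O => 1
  | S m => prod_primes f m * (if prime_dec (Z.of_nat (S m)) then f (S m) else 1)
  end.

Definition C_factor (l : nat) (p : nat) : R :=
  let c := cos (PI / INR l) in
  Rpower (1 - / INR p) (- c) * Rpower (1 + 2 * c / INR p + / (INR p ^ 2)) (- (1/2)).

Definition C_const (l : nat) : R := real (Lim_seq (fun N => prod_primes (C_factor l) N)).

(* Main.v *)
Require Import Defs.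
From Stdlib Require Import Reals ZArith Znumtheory Arith Lra Lia Classical List Permutation.
From Coquelicot Require Import Coquelicot.
Open Scope R_scope.

(** Let [A] be large, [B = A - 1], and [F(z) = L(A + z, chi) = sum f_k z^k]. Partial summation gives
    [|f_k| A^k <= 2 q], and GRH makes [F] zero-free in [|z| < A - 1/2] (with the Euler product for
    [Re s > 1] and the inequality [3 + 4 cos t + cos 2t >= 0] for [Re s = 1]). So [log F = sum g_k z^k]
    in this disc and the Borel-Caratheodory inequality yields [|g_k| R^k = O(log q)] for [R < A - 1/2].
    At [z = - B] the series may be truncated at [K] slightly larger than [log log q / log (R / B)]:
    [log L(1, chi) = sum_{k < K} g_k (- B)^k + o(1) = sum_{p, m} w_K(p^m) chi(p)^m / (m p^m) + o(1)],
    where [w_K(n)] is the probability that a Poisson variable of mean [B log n] is less than [K].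
    The same expansion of [(s - 1) zeta(s)], which has no zero in [|z| <= B], shows that
    [sum_{p, m} w_K(p^m) / (m p^m) = 1 + 1/2 + ... + 1/(K-1) - log B + o(1) = log (K / B) + gamma + o(1)],
    and [K / B] is asymptotically [2 log log q] when [A] is large. Both bounds follow by comparing
    termwise, using [|chi(p)| <= 1] and [Re chi(p) >= - cos (pi / l)].

    Cauchy's formula is only needed in a discrete form, for averages over roots of unity. *)

(** * Complex series *)

(** The factor [2] comes from the geometry: [F] is evaluated at distance [B] from the center, inside
    a zero-free disc of radius [B + 1/2]. The tail of [log F] thus decays like [(B / (B + theta))^K]
    with [theta] just below [1/2], and overcoming coefficients of size [log q] takes [K] about
    [log log q / log (1 + theta / B)]. As [B] grows, [B log (1 + theta / B)] tends to [theta], so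
    [K / B] approaches [log log q / theta]. The Poisson weights are a smooth form of the cut-off
    [n <= (log q)^2]: they pass from [1] to [0] around [B log n = K]. For the lower bound, with
    [c = cos (pi / l)], one adds [c] times the zeta sum to the sum for [log |L(1, chi)|]. The prime
    [p] then contributes [sum_m (Re chi(p)^m + c) / (m p^m)], apart from the weights. Over the
    admissible values of [chi(p)] this is least at the point [- c + i sin (pi / l)], where the term
    [m = 1] vanishes. Hence the minima have a convergent sum over the primes, and its exponential is
    the constant [C_l]; subtracting [c] times the zeta sum again produces the power of
    [2 e^gamma log log q]. *)

Fixpoint csum (f : nat -> C) (n : nat) : C :=
  match n with O => RtoC 0 | S m => Cplus (csum f m) (f m) end.

Fixpoint rsum (f : nat -> R) (n : nat) : R :=
  match n with O => 0 | S m => rsum f m + f m end.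

(** Componentwise, in the exact shape of [dseries_conv], so that a limit of [dpartial] established
    here can be handed to [GRH] as it stands. *)
Definition Clim (u : nat -> C) (l : C) : Prop :=
  is_lim_seq (fun n => Re (u n)) (Re l) /\ is_lim_seq (fun n => Im (u n)) (Im l).

Definition summ (a : nat -> C) : Prop := ex_series (fun k => Cmod (a k)).

(** A total function: its value is the sum only once convergence is known, which is why most lemmas
    about it carry a [summ] premise. *)
Definition CSer (a : nat -> C) : C :=
  (Series (fun k => Re (a k)), Series (fun k => Im (a k))).

Lemma C_eq (a b : C) : Re a = Re b -> Im a = Im b -> a = b.
Proof. destruct a, b; simpl; intros; subst; reflexivity. Qed.

Lemma RtoC_neq (a b : R) : a <> b -> RtoC a <> RtoC b.
Proof. intros H E; apply H, RtoC_inj, E. Qed.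

Lemma Re_mult (a b : C) : Re (a * b) = Re a * Re b - Im a * Im b.
Proof. reflexivity. Qed.

Lemma Im_mult (a b : C) : Im (a * b) = Re a * Im b + Im a * Re b.
Proof. reflexivity. Qed.

Lemma Re_scal (a : R) (z : C) : Re (RtoC a * z) = a * Re z.
Proof. rewrite Re_mult; simpl; ring. Qed.

Lemma csum_ext (f g : nat -> C) n :
  (forall i, (i < n)%nat -> f i = g i) -> csum f n = csum g n.
Proof.
  induction n; intros H; simpl; auto.
  rewrite IHn, H; auto.
Qed.

Lemma rsum_ext (f g : nat -> R) n :
  (forall i, (i < n)%nat -> f i = g i) -> rsum f n = rsum g n.
Proof.
  induction n; intros H; simpl; auto.
  rewrite IHn, H; auto.
Qed.

Lemma csum_plus (f g : nat -> C) n :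
  csum (fun i => Cplus (f i) (g i)) n = Cplus (csum f n) (csum g n).
Proof. induction n; simpl; [ring|rewrite IHn; ring]. Qed.

Lemma csum_scal (c : C) (f : nat -> C) n :
  csum (fun i => Cmult c (f i)) n = Cmult c (csum f n).
Proof. induction n; simpl; [ring|rewrite IHn; ring]. Qed.

Lemma rsum_plus (f g : nat -> R) n :
  rsum (fun i => f i + g i) n = rsum f n + rsum g n.
Proof. induction n; simpl; [ring|rewrite IHn; ring]. Qed.

Lemma rsum_scal (c : R) (f : nat -> R) n :
  rsum (fun i => c * f i) n = c * rsum f n.
Proof. induction n; simpl; [ring|rewrite IHn; ring]. Qed.

Lemma rsum_const (c : R) n : rsum (fun _ => c) n = INR n * c.
Proof. induction n; [simpl; ring|]. rewrite S_INR; simpl; rewrite IHn; ring. Qed.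

Lemma rsum_le (f g : nat -> R) n :
  (forall i, (i < n)%nat -> f i <= g i) -> rsum f n <= rsum g n.
Proof.
  induction n; intros H; simpl; [lra|].
  apply Rplus_le_compat; [apply IHn|]; auto.
Qed.

Lemma rsum_ge_0 (f : nat -> R) n :
  (forall i, 0 <= f i) -> 0 <= rsum f n.
Proof. intros H; induction n; simpl; [lra|]. specialize (H n); lra. Qed.

Lemma Cmod_csum (f : nat -> C) n : Cmod (csum f n) <= rsum (fun i => Cmod (f i)) n.
Proof.
  induction n; simpl; [rewrite Cmod_0; lra|].
  eapply Rle_trans; [apply Cmod_triangle|]; lra.
Qed.

Lemma Re_csum (f : nat -> C) n : Re (csum f n) = rsum (fun i => Re (f i)) n.
Proof. induction n; simpl; auto. rewrite <- IHn; reflexivity. Qed.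

Lemma Im_csum (f : nat -> C) n : Im (csum f n) = rsum (fun i => Im (f i)) n.
Proof. induction n; simpl; auto. rewrite <- IHn; reflexivity. Qed.

Lemma csum_app (f : nat -> C) n m :
  csum f (n + m) = Cplus (csum f n) (csum (fun i => f (n + i)%nat) m).
Proof.
  induction m; simpl.
  - rewrite Nat.add_0_r; ring.
  - rewrite Nat.add_succ_r; simpl; rewrite IHm; ring.
Qed.

Lemma rsum_app (f : nat -> R) n m :
  rsum f (n + m) = rsum f n + rsum (fun i => f (n + i)%nat) m.
Proof.
  induction m; simpl.
  - rewrite Nat.add_0_r; ring.
  - rewrite Nat.add_succ_r; simpl; rewrite IHm; ring.
Qed.

Lemma im_le_Cmod (c : C) : Rabs (Im c) <= Cmod c.
Proof. eapply Rle_trans; [|apply Rmax_Cmod]; apply Rmax_r. Qed.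

Lemma Cmod_le_ReIm (c : C) : Cmod c <= Rabs (Re c) + Rabs (Im c).
Proof.
  rewrite <- (Rabs_pos_eq (Rabs (Re c) + Rabs (Im c))).
  2: apply Rplus_le_le_0_compat; apply Rabs_pos.
  rewrite <- (Rabs_pos_eq (Cmod c)); [|apply Cmod_ge_0].
  apply Rsqr_le_abs_0. rewrite !Rsqr_pow2, Cmod2_alt.
  rewrite <- (pow2_abs (Re c)), <- (pow2_abs (Im c)).
  pose proof (Rabs_pos (Re c)); pose proof (Rabs_pos (Im c)); nra.
Qed.

Lemma Cmod_minus_sym (a b : C) : Cmod (a - b) = Cmod (b - a).
Proof. rewrite <- Cmod_opp; f_equal; ring. Qed.

Lemma Cmod_triangle' (a b : C) : Cmod a - Cmod b <= Cmod (a - b).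
Proof.
  pose proof (Cmod_triangle (a - b) b) as H.
  replace (a - b + b)%C with a in H by ring; lra.
Qed.

Lemma rsum_lim (f : nat -> R) l : is_series f l <-> is_lim_seq (rsum f) l.
Proof.
  assert (E : forall n, rsum f (S n) = sum_n f n).
  { induction n; [rewrite sum_O; simpl; ring|].
    rewrite sum_Sn, <- IHn; reflexivity. }
  split; intros H.
  - apply is_lim_seq_incr_1. eapply is_lim_seq_ext; [|exact H].
    intros; symmetry; apply E.
  - apply is_lim_seq_incr_1 in H. eapply is_lim_seq_ext in H; [exact H|]. exact E.
Qed.

Lemma ex_series_bounded (f : nat -> R) M :
  (forall n, 0 <= f n) -> (forall n, rsum f n <= M) -> ex_series f /\ Series f <= M.
Proof.
  intros Hp Hb.
  destruct (ex_finite_lim_seq_incr (rsum f) M) as [l Hl]; auto.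
  { intros n; simpl; specialize (Hp n); lra. }
  assert (Hs : is_series f l) by (apply rsum_lim; exact Hl).
  split; [exists l; exact Hs|].
  rewrite (is_series_unique _ _ Hs).
  apply (is_lim_seq_le (rsum f) (fun _ => M) l M); auto.
  apply is_lim_seq_const.
Qed.

Lemma rsum_lim_Series (f : nat -> R) : ex_series f -> is_lim_seq (rsum f) (Series f).
Proof. intros H; apply rsum_lim, Series_correct, H. Qed.

Lemma rsum_le_Series (f : nat -> R) n :
  (forall n, 0 <= f n) -> ex_series f -> rsum f n <= Series f.
Proof.
  intros Hp He.
  assert (H := rsum_lim_Series f He).
  apply (is_lim_seq_le_loc (fun _ => rsum f n) (rsum f) (rsum f n) (Series f)); auto.
  - exists n; intros m Hm. replace m with (n + (m - n))%nat by lia.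
    rewrite rsum_app. pose proof (rsum_ge_0 (fun i => f (n + i)%nat) (m - n) (fun i => Hp _)). lra.
  - apply is_lim_seq_const.
Qed.

Lemma Series_ge_0 (f : nat -> R) : (forall n, 0 <= f n) -> ex_series f -> 0 <= Series f.
Proof. intros Hp He; exact (rsum_le_Series f 0 Hp He). Qed.

Lemma Series_tail_lim (f : nat -> R) : (forall n, 0 <= f n) -> ex_series f ->
  forall eps, 0 < eps -> exists N, forall n m, (N <= n)%nat ->
    rsum (fun i => f (n + i)%nat) m <= eps.
Proof.
  intros Hp He eps Heps.
  assert (H := rsum_lim_Series f He).
  apply is_lim_seq_spec in H. destruct (H (mkposreal eps Heps)) as [N HN].
  exists N; intros n m Hn. specialize (HN n Hn); simpl in HN.
  pose proof (rsum_le_Series f (n + m) Hp He) as H1. rewrite rsum_app in H1.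
  apply Rabs_def2 in HN. lra.
Qed.

(** * Limits of complex sequences *)

Lemma Clim_Cmod (u : nat -> C) l :
  Clim u l <-> is_lim_seq (fun n => Cmod (u n - l)) 0.
Proof.
  split.
  - intros [H1 H2].
    apply (is_lim_seq_le_le (fun _ => 0) _
      (fun n => Rabs (Re (u n) - Re l) + Rabs (Im (u n) - Im l))).
    + intros n; split; [apply Cmod_ge_0|]. apply (Cmod_le_ReIm (u n - l)).
    + apply is_lim_seq_const.
    + replace (Finite 0) with (Finite (Rabs (Re l - Re l) + Rabs (Im l - Im l)))
        by (f_equal; rewrite !Rminus_diag, Rabs_R0; ring).
      apply is_lim_seq_plus'.
      * apply (is_lim_seq_abs _ (Finite (Re l - Re l))), is_lim_seq_minus'; auto. apply is_lim_seq_const.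
      * apply (is_lim_seq_abs _ (Finite (Im l - Im l))), is_lim_seq_minus'; auto. apply is_lim_seq_const.
  - intros H; split; apply is_lim_seq_spec; apply is_lim_seq_spec in H;
      intros eps; destruct (H eps) as [N HN]; exists N; intros n Hn;
      specialize (HN n Hn); rewrite Rminus_0_r, Rabs_pos_eq in HN by apply Cmod_ge_0.
    + eapply Rle_lt_trans; [|exact HN]. apply (re_le_Cmod (u n - l)).
    + eapply Rle_lt_trans; [|exact HN]. apply (im_le_Cmod (u n - l)).
Qed.

Lemma Clim_eps (u : nat -> C) l :
  (forall eps, 0 < eps -> exists N, forall n, (N <= n)%nat -> Cmod (u n - l) <= eps) ->
  Clim u l.
Proof.
  intros H; apply Clim_Cmod, is_lim_seq_spec; intros eps.
  destruct (H (eps / 2)) as [N HN]; [pose proof (cond_pos eps); lra|].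
  exists N; intros n Hn. rewrite Rminus_0_r, Rabs_pos_eq by apply Cmod_ge_0.
  specialize (HN n Hn); pose proof (cond_pos eps); lra.
Qed.

Lemma Clim_elim (u : nat -> C) l : Clim u l ->
  forall eps, 0 < eps -> exists N, forall n, (N <= n)%nat -> Cmod (u n - l) < eps.
Proof.
  intros H eps Heps; apply Clim_Cmod, is_lim_seq_spec in H.
  destruct (H (mkposreal eps Heps)) as [N HN]; exists N; intros n Hn.
  specialize (HN n Hn); simpl in HN.
  rewrite Rminus_0_r, Rabs_pos_eq in HN by apply Cmod_ge_0. exact HN.
Qed.

Lemma Clim_ext (u v : nat -> C) l : (forall n, u n = v n) -> Clim u l -> Clim v l.
Proof.
  intros E [H1 H2]; split; eapply is_lim_seq_ext; eauto; intros; simpl; rewrite E; auto.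
Qed.

Lemma Clim_const (c : C) : Clim (fun _ => c) c.
Proof. split; apply is_lim_seq_const. Qed.

Lemma Clim_unique (u : nat -> C) l l' : Clim u l -> Clim u l' -> l = l'.
Proof.
  intros [H1 H2] [H3 H4]. apply C_eq.
  - apply is_lim_seq_unique in H1; apply is_lim_seq_unique in H3; congruence.
  - apply is_lim_seq_unique in H2; apply is_lim_seq_unique in H4; congruence.
Qed.

Lemma Clim_plus (u v : nat -> C) l m :
  Clim u l -> Clim v m -> Clim (fun n => Cplus (u n) (v n)) (l + m).
Proof. intros [H1 H2] [H3 H4]; split; simpl; apply is_lim_seq_plus'; auto. Qed.

Lemma Clim_mult (u v : nat -> C) l m :
  Clim u l -> Clim v m -> Clim (fun n => Cmult (u n) (v n)) (l * m).
Proof.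
  intros [H1 H2] [H3 H4]; split; simpl.
  - apply is_lim_seq_minus'; apply is_lim_seq_mult'; auto.
  - apply is_lim_seq_plus'; apply is_lim_seq_mult'; auto.
Qed.

Lemma Clim_opp (u : nat -> C) l : Clim u l -> Clim (fun n => Copp (u n)) (- l).
Proof.
  intros H; apply (Clim_ext (fun n => Cmult (-1) (u n))); [intros; ring|].
  replace (- l)%C with (-1 * l)%C by ring. apply Clim_mult; auto. apply Clim_const.
Qed.

Lemma Clim_minus (u v : nat -> C) l m :
  Clim u l -> Clim v m -> Clim (fun n => Cminus (u n) (v n)) (l - m).
Proof. intros H1 H2; apply (Clim_plus u (fun n => Copp (v n))); auto; apply Clim_opp; auto. Qed.

Lemma Clim_conj (u : nat -> C) l : Clim u l -> Clim (fun n => Cconj (u n)) (Cconj l).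
Proof. intros [H1 H2]; split; simpl; auto. apply (is_lim_seq_opp _ (Im l)) in H2; exact H2. Qed.

Lemma Clim_norm (u : nat -> C) l : Clim u l -> is_lim_seq (fun n => Cmod (u n)) (Cmod l).
Proof.
  intros H; apply is_lim_seq_spec; intros eps.
  destruct (Clim_elim u l H eps (cond_pos eps)) as [N HN].
  exists N; intros n Hn. specialize (HN n Hn).
  eapply Rle_lt_trans; [|exact HN].
  apply Rabs_le; split; [|apply Cmod_triangle'].
  rewrite Cmod_minus_sym. pose proof (Cmod_triangle' l (u n)); lra.
Qed.

Lemma Clim_bound (u : nat -> C) l M : (forall n, Cmod (u n) <= M) -> Clim u l -> Cmod l <= M.
Proof.
  intros Hb H; apply Clim_norm in H.
  apply (is_lim_seq_le (fun n => Cmod (u n)) (fun _ => M) (Cmod l) M); auto.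
  apply is_lim_seq_const.
Qed.

Lemma Clim_subseq (u : nat -> C) l (phi : nat -> nat) :
  (forall n, (n <= phi n)%nat) -> Clim u l -> Clim (fun n => u (phi n)) l.
Proof.
  intros Hp H; apply Clim_eps; intros eps Heps.
  destruct (Clim_elim u l H eps Heps) as [N HN]; exists N; intros n Hn.
  apply Rlt_le, HN. specialize (Hp n); lia.
Qed.

(** * Absolutely convergent complex series and interchange of limits *)

Lemma summ_Re a : summ a -> ex_series (fun k => Re (a k)).
Proof. intros H; eapply (@ex_series_le R_AbsRing R_CompleteNormedModule); [|exact H]. intros n; apply re_le_Cmod. Qed.

Lemma summ_Im a : summ a -> ex_series (fun k => Im (a k)).
Proof. intros H; eapply (@ex_series_le R_AbsRing R_CompleteNormedModule); [|exact H]. intros n; apply im_le_Cmod. Qed.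

Lemma CSer_lim a : summ a -> Clim (csum a) (CSer a).
Proof.
  intros H; split; simpl.
  - eapply is_lim_seq_ext; [intros; symmetry; apply Re_csum|].
    apply rsum_lim_Series, summ_Re, H.
  - eapply is_lim_seq_ext; [intros; symmetry; apply Im_csum|].
    apply rsum_lim_Series, summ_Im, H.
Qed.

Lemma ex_series_le_pos (f g : nat -> R) :
  (forall n, 0 <= f n <= g n) -> ex_series g -> ex_series f.
Proof.
  intros H He; eapply (@ex_series_le R_AbsRing R_CompleteNormedModule); [|exact He].
  intros n; unfold norm; simpl; unfold abs; simpl.
  rewrite Rabs_pos_eq; apply H.
Qed.

Lemma summ_le a (b : nat -> R) : (forall k, Cmod (a k) <= b k) -> ex_series b -> summ a.
Proof.
  intros H He; eapply ex_series_le_pos; [|exact He].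
  intros n; split; [apply Cmod_ge_0|apply H].
Qed.

Lemma summ_ext a b : (forall k, a k = b k) -> summ a -> summ b.
Proof. intros E H; eapply ex_series_ext; [|exact H]; intros; simpl; rewrite E; auto. Qed.

Lemma summ_plus a b : summ a -> summ b -> summ (fun k => Cplus (a k) (b k)).
Proof.
  intros Ha Hb. apply (summ_le _ (fun k => Cmod (a k) + Cmod (b k))).
  - intros; apply Cmod_triangle.
  - apply (ex_series_plus (V := R_NormedModule)); auto.
Qed.

Lemma summ_scal c a : summ a -> summ (fun k => Cmult c (a k)).
Proof.
  intros Ha. apply (summ_le _ (fun k => Cmod c * Cmod (a k))).
  - intros; rewrite Cmod_mult; lra.
  - apply (ex_series_scal_l (V := R_NormedModule) (Cmod c) (fun k => Cmod (a k))); auto.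
Qed.

Lemma summ_conj a : summ a -> summ (fun k => Cconj (a k)).
Proof. intros; eapply ex_series_ext; [|exact H]; intros; simpl; rewrite Cmod_conj; auto. Qed.

Lemma summ_incr a n : summ a -> summ (fun k => a (n + k)%nat).
Proof. intros H; apply (ex_series_incr_n (fun k => Cmod (a k))); auto. Qed.

Lemma CSer_ext a b : (forall k, a k = b k) -> CSer a = CSer b.
Proof. intros E; unfold CSer; f_equal; apply Series_ext; intros; rewrite E; auto. Qed.

Lemma CSer_plus a b : summ a -> summ b ->
  CSer (fun k => Cplus (a k) (b k)) = Cplus (CSer a) (CSer b).
Proof.
  intros Ha Hb. eapply Clim_unique; [apply CSer_lim, summ_plus; auto|].
  eapply Clim_ext; [intros; symmetry; apply csum_plus|].
  apply Clim_plus; apply CSer_lim; auto.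
Qed.

Lemma CSer_scal c a : summ a -> CSer (fun k => Cmult c (a k)) = Cmult c (CSer a).
Proof.
  intros Ha. eapply Clim_unique; [apply CSer_lim, summ_scal; auto|].
  eapply Clim_ext; [intros; symmetry; apply csum_scal|].
  apply Clim_mult; [apply Clim_const|apply CSer_lim; auto].
Qed.

Lemma CSer_minus a b : summ a -> summ b ->
  CSer (fun k => Cminus (a k) (b k)) = Cminus (CSer a) (CSer b).
Proof.
  intros Ha Hb. rewrite (CSer_ext _ (fun k => Cplus (a k) (Cmult (-1) (b k)))) by (intros; ring).
  rewrite CSer_plus, CSer_scal; auto; [ring|apply summ_scal; auto].
Qed.

Lemma CSer_conj a : CSer (fun k => Cconj (a k)) = Cconj (CSer a).
Proof.
  apply C_eq; simpl; auto.
  rewrite <- Series_opp. apply Series_ext; intros; reflexivity.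
Qed.

Lemma Cmod_CSer a : summ a -> Cmod (CSer a) <= Series (fun k => Cmod (a k)).
Proof.
  intros H; apply (Clim_bound (csum a)); [|apply CSer_lim; auto].
  intros n; eapply Rle_trans; [apply Cmod_csum|].
  apply rsum_le_Series; auto. intros; apply Cmod_ge_0.
Qed.

Lemma CSer_0 : CSer (fun _ => RtoC 0) = RtoC 0.
Proof.
  assert (H : Series (fun _ : nat => 0) = 0).
  { apply is_series_unique, rsum_lim.
    eapply is_lim_seq_ext; [|apply is_lim_seq_const].
    induction n; simpl; auto. rewrite <- IHn; ring. }
  apply C_eq; simpl; exact H.
Qed.

Lemma summ_0 : summ (fun _ => RtoC 0).
Proof.
  exists 0. apply rsum_lim. eapply is_lim_seq_ext; [|apply is_lim_seq_const].
  induction n; simpl; auto. rewrite <- IHn, Cmod_0; ring.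
Qed.

Lemma CSer_csum (a : nat -> nat -> C) n : (forall i, (i < n)%nat -> summ (a i)) ->
  summ (fun k => csum (fun i => a i k) n) /\
  CSer (fun k => csum (fun i => a i k) n) = csum (fun i => CSer (a i)) n.
Proof.
  induction n; intros H; simpl.
  - split; [apply summ_0|apply CSer_0].
  - destruct IHn as [I1 I2]; [intros; apply H; lia|].
    split; [apply summ_plus; auto|]. rewrite CSer_plus, I2; auto.
Qed.

Lemma CSer_split a n : summ a ->
  CSer a = Cplus (csum a n) (CSer (fun k => a (n + k)%nat)).
Proof.
  intros H. eapply Clim_unique; [apply (Clim_subseq (csum a) _ (fun m => (n + m)%nat)), CSer_lim; auto; intros; lia|].
  eapply Clim_ext; [intros; symmetry; apply csum_app|].
  apply Clim_plus; [apply Clim_const|apply CSer_lim, summ_incr; auto].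
Qed.

(** Dominated convergence: beyond a rank depending only on the majorant [b] the tails are small
    uniformly in [n], and the finitely many terms before it converge one by one. It is the tool
    behind the interchange of sums, the coefficient averages and the continuation of Dirichlet
    series. *)
Lemma Tannery (a : nat -> nat -> C) (l : nat -> C) (b : nat -> R) :
  (forall n k, Cmod (a n k) <= b k) -> ex_series b ->
  (forall k, Clim (fun n => a n k) (l k)) ->
  summ l /\ Clim (fun n => CSer (a n)) (CSer l).
Proof.
  intros Hb He Hl.
  assert (Hlb : forall k, Cmod (l k) <= b k).
  { intros k; apply (Clim_bound (fun n => a n k)); auto. }
  assert (Hsl : summ l) by (eapply summ_le; eauto).
  assert (Hsa : forall n, summ (a n)) by (intros n; eapply summ_le; eauto).
  assert (Hb0 : forall k, 0 <= b k).
  { intros k; eapply Rle_trans; [apply Cmod_ge_0|apply (Hb 0%nat k)]. }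
  split; auto. apply Clim_eps; intros eps Heps.
  destruct (Series_tail_lim b Hb0 He (eps / 4) ltac:(lra)) as [K HK].
  assert (Htail : forall c, (forall k, Cmod (c k) <= b k) ->
    Cmod (CSer (fun k => c (K + k)%nat)) <= eps / 4).
  { intros c Hc.
    assert (Hs : summ (fun k => c (K + k)%nat)) by (apply summ_incr; eapply summ_le; eauto).
    apply (Clim_bound (csum (fun k => c (K + k)%nat))); [|apply CSer_lim; auto].
    intros m; eapply Rle_trans; [apply Cmod_csum|].
    eapply Rle_trans; [|apply (HK K m); lia]. apply rsum_le; intros; apply Hc. }
  assert (Hfin : forall K', Clim (fun n => csum (a n) K') (csum l K')).
  { induction K'; simpl; [apply Clim_const|]. apply Clim_plus; auto. }
  destruct (Clim_elim _ _ (Hfin K) (eps / 4) ltac:(lra)) as [N HN].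
  exists N; intros n Hn.
  rewrite (CSer_split (a n) K), (CSer_split l K); auto.
  replace (csum (a n) K + CSer (fun k => a n (K + k)%nat) -
     (csum l K + CSer (fun k => l (K + k)%nat)))%C
    with ((csum (a n) K - csum l K) + (CSer (fun k => a n (K + k)%nat) +
       - CSer (fun k => l (K + k)%nat)))%C by ring.
  eapply Rle_trans; [apply Cmod_triangle|].
  eapply Rle_trans; [apply Rplus_le_compat_l, Cmod_triangle|].
  rewrite Cmod_opp. specialize (HN n Hn).
  pose proof (Htail _ (Hb n)); pose proof (Htail _ Hlb); lra.
Qed.

Lemma Re_lim_of_Clim (u : nat -> C) l : Clim u l -> is_lim_seq (fun n => Re (u n)) (Re l).
Proof. intros [H _]; exact H. Qed.

Lemma Tannery_R (a : nat -> nat -> R) (l : nat -> R) (b : nat -> R) :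
  (forall n k, Rabs (a n k) <= b k) -> ex_series b ->
  (forall k, is_lim_seq (fun n => a n k) (l k)) ->
  ex_series l /\ is_lim_seq (fun n => Series (a n)) (Series l).
Proof.
  intros Hb He Hl.
  destruct (Tannery (fun n k => RtoC (a n k)) (fun k => RtoC (l k)) b) as [H1 H2]; auto.
  - intros; rewrite Cmod_R; auto.
  - intros k; split; simpl; auto. apply is_lim_seq_const.
  - split; [exact (summ_Re _ H1)|]. exact (Re_lim_of_Clim _ _ H2).
Qed.

Lemma Series_rsum (a : nat -> nat -> R) n : (forall i, (i < n)%nat -> ex_series (a i)) ->
  ex_series (fun k => rsum (fun i => a i k) n) /\
  Series (fun k => rsum (fun i => a i k) n) = rsum (fun i => Series (a i)) n.
Proof.
  induction n; intros H; simpl.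
  - assert (Hz : is_series (fun _ : nat => 0) 0).
    { apply rsum_lim. eapply is_lim_seq_ext; [|apply is_lim_seq_const].
      intros m; rewrite rsum_const; ring. }
    split; [exists 0; auto|apply is_series_unique; auto].
  - destruct IHn as [I1 I2]; [intros; apply H; lia|].
    split; [apply (ex_series_plus (V := R_NormedModule)); auto|].
    rewrite Series_plus, I2; auto.
Qed.

(** [Tannery] applied to partial sums over the rows: in column [k] they are dominated by the
    absolute column sum, and the column sums are summable because finitely many of them never exceed
    the total mass. *)
Lemma Fubini (a : nat -> nat -> C) :
  (forall n, summ (a n)) -> ex_series (fun n => Series (fun k => Cmod (a n k))) ->
  (forall k, summ (fun n => a n k)) /\ summ (fun n => CSer (a n)) /\
  ex_series (fun k => Series (fun n => Cmod (a n k))) /\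
  summ (fun k => CSer (fun n => a n k)) /\
  CSer (fun n => CSer (a n)) = CSer (fun k => CSer (fun n => a n k)).
Proof.
  intros Hr Ht.
  assert (Hpos : forall n, 0 <= Series (fun k => Cmod (a n k))).
  { intros n; apply Series_ge_0; [intros; apply Cmod_ge_0|apply Hr]. }
  assert (Hle : forall n k, Cmod (a n k) <= Series (fun k => Cmod (a n k))).
  { intros n k.
    eapply Rle_trans; [|apply (rsum_le_Series (fun k => Cmod (a n k)) (S k)); [intros; apply Cmod_ge_0|apply Hr]].
    simpl. pose proof (rsum_ge_0 (fun k => Cmod (a n k)) k ltac:(intros; apply Cmod_ge_0)); simpl in *; lra. }
  assert (Hc : forall k, summ (fun n => a n k)).
  { intros k; eapply summ_le; [|exact Ht]; intros; simpl; auto. }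
  assert (Hn : summ (fun n => CSer (a n))).
  { eapply summ_le; [|exact Ht]; intros; apply Cmod_CSer; auto. }
  assert (Hb : ex_series (fun k => Series (fun n => Cmod (a n k)))).
  { apply (ex_series_bounded _ (Series (fun n => Series (fun k => Cmod (a n k))))).
    - intros k; apply Series_ge_0; [intros; apply Cmod_ge_0|apply Hc].
    - intros K.
      destruct (Series_rsum (fun k n => Cmod (a n k)) K) as [E1 E2]; [intros; apply Hc|].
      rewrite <- E2. apply Series_le; auto.
      intros n; split; [apply rsum_ge_0; intros; apply Cmod_ge_0|].
      apply (rsum_le_Series (fun k => Cmod (a n k))); [intros; apply Cmod_ge_0|apply Hr]. }
  do 3 (split; auto).
  destruct (Tannery (fun N k => csum (fun n => a n k) N) (fun k => CSer (fun n => a n k))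
    (fun k => Series (fun n => Cmod (a n k)))) as [T1 T2]; auto.
  - intros N k; eapply Rle_trans; [apply Cmod_csum|].
    apply (rsum_le_Series (fun n => Cmod (a n k))); [intros; apply Cmod_ge_0|apply Hc].
  - intros k; apply CSer_lim; auto.
  - split; auto. eapply Clim_unique; [|exact T2].
    eapply Clim_ext; [|apply CSer_lim; exact Hn].
    intros N; symmetry; apply CSer_csum; auto.
Qed.

Lemma sum_f_R0_rsum f n : sum_f_R0 f n = rsum f (S n).
Proof. induction n; simpl; [ring|]. simpl in IHn; rewrite IHn; reflexivity. Qed.

(** Split into real and imaginary parts, this is four real Cauchy products. *)
Lemma CSer_mult a b : summ a -> summ b ->
  CSer (fun n => csum (fun k => Cmult (a k) (b (n - k)%nat)) (S n)) = Cmult (CSer a) (CSer b).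
Proof.
  intros Ha Hb.
  assert (aR : ex_series (fun k => Rabs (Re (a k)))).
  { eapply ex_series_le_pos; [|exact Ha]; intros; split; [apply Rabs_pos|apply re_le_Cmod]. }
  assert (aI : ex_series (fun k => Rabs (Im (a k)))).
  { eapply ex_series_le_pos; [|exact Ha]; intros; split; [apply Rabs_pos|apply im_le_Cmod]. }
  assert (bR : ex_series (fun k => Rabs (Re (b k)))).
  { eapply ex_series_le_pos; [|exact Hb]; intros; split; [apply Rabs_pos|apply re_le_Cmod]. }
  assert (bI : ex_series (fun k => Rabs (Im (b k)))).
  { eapply ex_series_le_pos; [|exact Hb]; intros; split; [apply Rabs_pos|apply im_le_Cmod]. }
  pose proof (Series_correct _ (summ_Re _ Ha)) as sR.
  pose proof (Series_correct _ (summ_Im _ Ha)) as sI.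
  pose proof (Series_correct _ (summ_Re _ Hb)) as tR.
  pose proof (Series_correct _ (summ_Im _ Hb)) as tI.
  pose proof (is_series_mult _ _ _ _ sR tR aR bR) as RR.
  pose proof (is_series_mult _ _ _ _ sI tI aI bI) as II.
  pose proof (is_series_mult _ _ _ _ sR tI aR bI) as RI.
  pose proof (is_series_mult _ _ _ _ sI tR aI bR) as IR.
  assert (E1 : forall n, rsum (fun k => Re (a k) * Re (b (n - k)%nat)) (S n) -
      rsum (fun k => Im (a k) * Im (b (n - k)%nat)) (S n) =
      Re (csum (fun k => Cmult (a k) (b (n - k)%nat)) (S n))).
  { intros n; rewrite Re_csum.
    replace (rsum (fun i => Re (a i * b (n - i)%nat)%C) (S n)) with
      (rsum (fun k => Re (a k) * Re (b (n - k)%nat) + (-1) * (Im (a k) * Im (b (n - k)%nat))) (S n))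
      by (apply rsum_ext; intros; rewrite Re_mult; ring).
    rewrite rsum_plus, rsum_scal; ring. }
  assert (E2 : forall n, rsum (fun k => Re (a k) * Im (b (n - k)%nat)) (S n) +
      rsum (fun k => Im (a k) * Re (b (n - k)%nat)) (S n) =
      Im (csum (fun k => Cmult (a k) (b (n - k)%nat)) (S n))).
  { intros n; rewrite Im_csum, <- rsum_plus. apply rsum_ext; intros; rewrite Im_mult; ring. }
  apply C_eq; apply is_series_unique.
  - eapply is_series_ext; [|apply (is_series_minus _ _ _ _ RR II)].
    intros n; rewrite <- E1, <- !sum_f_R0_rsum; reflexivity.
  - eapply is_series_ext; [|apply (is_series_plus _ _ _ _ RI IR)].
    intros n; rewrite <- E2, <- !sum_f_R0_rsum; reflexivity.
Qed.

(** * Power series and second order Taylor estimates *)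

Definition PS (a : nat -> C) (z : C) : C := CSer (fun k => Cmult (a k) (Cpow z k)).

(** A Cauchy estimate with explicit constant, used in place of a radius of convergence; it gives
    absolute convergence strictly inside radius [r]. *)
Definition pbd (a : nat -> C) (r B : R) : Prop := forall k, Cmod (a k) * r ^ k <= B.

Definition dco (a : nat -> C) (k : nat) : C := Cmult (INR (S k)) (a (S k)).

(** Bernoulli's inequality [1 + k d <= (1 + d)^k] with [1 + d = y / x]. Each factor [k] produced by
    a derivative is paid for by a small increase of the radius. *)
Lemma mul_pow_bound x y : 0 <= x < y -> exists K, 0 < K /\ forall k, INR k * x ^ k <= K * y ^ k.
Proof.
  intros [[Hx| <-] Hxy].
  - set (d := y / x - 1).
    assert (Hd : 0 < d).
    { unfold d. apply Rlt_Rminus. apply Rmult_lt_reg_r with x; auto. field_simplify; lra. }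
    exists (/ d). split; [apply Rinv_0_lt_compat; auto|].
    intros k.
    assert (H : 1 + INR k * d <= (1 + d) ^ k) by (apply poly; auto).
    replace (1 + d) with (y / x) in H by (unfold d; ring).
    unfold Rdiv in H; rewrite Rpow_mult_distr, pow_inv in H.
    assert (Hp : 0 < x ^ k) by (apply pow_lt; auto).
    assert (H2 : INR k * d * x ^ k <= y ^ k).
    { replace (y ^ k) with (y ^ k * / x ^ k * x ^ k) by (field; lra).
      apply Rmult_le_compat_r; lra. }
    apply Rmult_le_reg_l with d; auto.
    replace (d * (/ d * y ^ k)) with (y ^ k) by (field; lra). lra.
  - exists 1; split; [lra|]. intros [|k]; [simpl; lra|].
    rewrite pow_i by lia. rewrite Rmult_0_r, Rmult_1_l. apply pow_le; lra.
Qed.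

Lemma pbd_series a r B y : pbd a r B -> 0 <= y < r -> ex_series (fun k => Cmod (a k) * y ^ k).
Proof.
  intros Hb Hy.
  assert (Hr : 0 < r) by lra.
  apply (ex_series_le_pos _ (fun k => B * (y / r) ^ k)).
  - intros k; split.
    + apply Rmult_le_pos; [apply Cmod_ge_0|apply pow_le; lra].
    + unfold Rdiv; rewrite Rpow_mult_distr, pow_inv.
      replace (Cmod (a k) * y ^ k) with (Cmod (a k) * r ^ k * (y ^ k * / r ^ k))
        by (field; apply pow_nonzero; lra).
      apply Rmult_le_compat_r; auto.
      apply Rmult_le_pos; [apply pow_le; lra|].
      apply Rlt_le, Rinv_0_lt_compat, pow_lt; auto.
  - apply (ex_series_scal_l (V := R_NormedModule)), ex_series_geom.
    rewrite Rabs_pos_eq.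
    + apply Rmult_lt_reg_r with r; auto. unfold Rdiv; rewrite Rmult_assoc, Rinv_l; lra.
    + apply Rle_mult_inv_pos; lra.
Qed.

Lemma pbd_dco a r B r' : pbd a r B -> 0 < r' < r -> exists B', pbd (dco a) r' B'.
Proof.
  intros Hb [Hr' Hr].
  destruct (mul_pow_bound r' r ltac:(lra)) as [K [HK HKb]].
  exists (K * B / r'). intros k. unfold dco.
  rewrite Cmod_mult, Cmod_R, Rabs_pos_eq by apply pos_INR.
  specialize (HKb (S k)); specialize (Hb (S k)).
  apply Rmult_le_reg_r with r'; auto.
  replace (K * B / r' * r') with (K * B) by (field; lra).
  replace (INR (S k) * Cmod (a (S k)) * r' ^ k * r') with (Cmod (a (S k)) * (INR (S k) * r' ^ (S k)))
    by (simpl (r' ^ S k); ring).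
  eapply Rle_trans; [apply Rmult_le_compat_l; [apply Cmod_ge_0|exact HKb]|].
  replace (Cmod (a (S k)) * (K * r ^ S k)) with (K * (Cmod (a (S k)) * r ^ S k)) by ring.
  apply Rmult_le_compat_l; lra.
Qed.

Lemma pbd_mono a r B r' : pbd a r B -> 0 <= r' <= r -> pbd a r' B.
Proof.
  intros H Hr k; eapply Rle_trans; [|apply (H k)].
  apply Rmult_le_compat_l; [apply Cmod_ge_0|apply pow_incr; lra].
Qed.

Lemma PS_summ a r B z : pbd a r B -> Cmod z < r -> summ (fun k => Cmult (a k) (Cpow z k)).
Proof.
  intros H Hz. eapply ex_series_ext; [|apply (pbd_series a r B (Cmod z) H)].
  - intros; simpl; rewrite Cmod_mult, Cmod_pow; auto.
  - split; auto; apply Cmod_ge_0.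
Qed.

Lemma PS_0 a : PS a 0 = a 0%nat.
Proof.
  unfold PS.
  assert (E : forall k, Cmult (a (1 + k)%nat) (Cpow 0 (1 + k)) = RtoC 0).
  { intros; simpl; ring. }
  assert (S0 : summ (fun k => Cmult (a k) (Cpow 0 k))).
  { apply (ex_series_incr_n (fun k => Cmod (a k * 0 ^ k)) 1).
    eapply ex_series_ext; [|exact summ_0]. intros k; cbv beta. rewrite (E k); reflexivity. }
  rewrite (CSer_split (fun k => Cmult (a k) (Cpow 0 k)) 1 S0).
  rewrite (CSer_ext _ (fun _ => RtoC 0) E), CSer_0. simpl; ring.
Qed.

Lemma PS_ext a b z : (forall k, a k = b k) -> PS a z = PS b z.
Proof. intros H; apply CSer_ext; intros; rewrite H; auto. Qed.

Lemma PS_conv a b r B B' z : pbd a r B -> pbd b r B' -> Cmod z < r ->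
  PS (fun n => csum (fun k => Cmult (a k) (b (n - k)%nat)) (S n)) z = Cmult (PS a z) (PS b z).
Proof.
  intros Ha Hb Hz. unfold PS.
  rewrite <- CSer_mult by (eapply PS_summ; eauto).
  apply CSer_ext; intros n. rewrite Cmult_comm, <- csum_scal.
  apply csum_ext; intros i Hi.
  replace n with (i + (n - i))%nat at 1 by lia. rewrite Cpow_add_r; ring.
Qed.

(* Differentiability with a Taylor remainder bounded uniformly by [B * |w - z|^2] on [D]. *)
Definition Udiff (D : C -> Prop) (f f' : C -> C) : Prop :=
  exists B, 0 <= B /\ (forall z, D z -> Cmod (f z) <= B /\ Cmod (f' z) <= B) /\
    forall z w, D z -> D w -> Cmod (f w - f z - f' z * (w - z)) <= B * Cmod (w - z) ^ 2.

(** The remainders satisfy [e (k+1) = w * e k + k * z^(k-1) * (w - z)^2], which gives the bound by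
    induction; the factor [R ^ 2] on the left avoids the exponent [k - 2]. *)
Lemma Cpow_taylor R z w k : 0 < R -> Cmod z <= R -> Cmod w <= R ->
  Cmod (Cpow w k - Cpow z k - INR k * Cpow z (pred k) * (w - z)) * R ^ 2
    <= INR k ^ 2 * R ^ k * Cmod (w - z) ^ 2.
Proof.
  intros HR Hz Hw. induction k.
  - simpl. replace (1 - 1 - 0 * 1 * (w - z))%C with (RtoC 0) by ring. rewrite Cmod_0. lra.
  - assert (E : (Cpow w (S k) - Cpow z (S k) - INR (S k) * Cpow z (pred (S k)) * (w - z) =
      w * (Cpow w k - Cpow z k - INR k * Cpow z (pred k) * (w - z)) +
      INR k * Cpow z (pred k) * ((w - z) * (w - z)))%C).
    { rewrite S_INR, RtoC_plus, !Cpow_S. destruct k as [|k].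
      - simpl. ring.
      - rewrite !Nat.pred_succ, !Cpow_S. ring. }
    rewrite E.
    set (e := (Cpow w k - Cpow z k - INR k * Cpow z (pred k) * (w - z))%C) in *.
    assert (H1 : Cmod (w * e + INR k * Cpow z (pred k) * ((w - z) * (w - z))) <=
      R * Cmod e + INR k * Cmod z ^ pred k * Cmod (w - z) ^ 2).
    { eapply Rle_trans; [apply Cmod_triangle|]. rewrite !Cmod_mult, Cmod_pow, Cmod_R.
      rewrite (Rabs_pos_eq (INR k)) by apply pos_INR.
      replace (Cmod (w - z) * Cmod (w - z)) with (Cmod (w - z) ^ 2) by ring.
      apply Rplus_le_compat_r. apply Rmult_le_compat_r; auto; apply Cmod_ge_0. }
    assert (H2 : INR k * Cmod z ^ pred k * R <= INR k * R ^ k).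
    { destruct k; [simpl; lra|]. rewrite Nat.pred_succ, Rmult_assoc.
      apply Rmult_le_compat_l; [apply pos_INR|]. simpl. rewrite Rmult_comm.
      apply Rmult_le_compat_l; [lra|]. apply pow_incr; split; auto; apply Cmod_ge_0. }
    assert (HX : 0 <= Cmod (w - z) ^ 2) by (apply pow_le, Cmod_ge_0).
    set (X := Cmod (w - z) ^ 2) in *.
    assert (HR2 : 0 <= R ^ 2) by (apply pow_le; lra).
    eapply Rle_trans; [apply Rmult_le_compat_r; [auto|exact H1]|].
    rewrite S_INR. simpl (R ^ S k).
    assert (Hk := pos_INR k). assert (HRk : 0 < R ^ k) by (apply pow_lt; auto).
    assert (H3 : R * (Cmod e * R ^ 2) <= R * (INR k ^ 2 * R ^ k * X)) by (apply Rmult_le_compat_l; lra).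
    assert (H4 : INR k * Cmod z ^ pred k * R * (R * X) <= INR k * R ^ k * (R * X)).
    { apply Rmult_le_compat_r; auto. apply Rmult_le_pos; lra. }
    assert (H5 : 0 <= (INR k + 1) * (R * R ^ k * X)).
    { apply Rmult_le_pos; [lra|]. apply Rmult_le_pos; auto. apply Rmult_le_pos; lra. }
    replace ((R * Cmod e + INR k * Cmod z ^ pred k * X) * R ^ 2) with
      (R * (Cmod e * R ^ 2) + INR k * Cmod z ^ pred k * R * (R * X)) by ring.
    replace ((INR k + 1) ^ 2 * (R * R ^ k) * X) with
      (R * (INR k ^ 2 * R ^ k * X) + INR k * R ^ k * (R * X) + (INR k + 1) * (R * R ^ k * X)) by ring.
    lra.
Qed.

Lemma PS_dco a r B z : pbd a r B -> 0 < r -> Cmod z < r ->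
  summ (fun k => Cmult (a k) (INR k * Cpow z (pred k))) /\
  CSer (fun k => Cmult (a k) (INR k * Cpow z (pred k))) = PS (dco a) z.
Proof.
  intros H Hr Hz.
  assert (Hm : Cmod z < (Cmod z + r) / 2 < r) by lra.
  destruct (pbd_dco a r B ((Cmod z + r) / 2) H) as [B' HB']; [pose proof (Cmod_ge_0 z); lra|].
  assert (S1 : summ (fun k => Cmult (dco a k) (Cpow z k))) by (eapply PS_summ; [exact HB'|lra]).
  assert (E : forall k, Cmult (dco a k) (Cpow z k) = Cmult (a (1 + k)%nat) (INR (1 + k) * Cpow z (pred (1 + k)))).
  { intros k; unfold dco; simpl pred. change (1 + k)%nat with (S k). ring. }
  assert (S2 : summ (fun k => Cmult (a k) (INR k * Cpow z (pred k)))).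
  { apply (ex_series_incr_n (fun k => Cmod (a k * (INR k * Cpow z (pred k)))) 1).
    eapply ex_series_ext; [|exact S1]. intros; simpl; rewrite E; auto. }
  split; auto. rewrite (CSer_split _ 1); auto.
  unfold PS. rewrite (CSer_ext _ _ E). simpl. ring.
Qed.

Lemma PS_Udiff a r B R : pbd a r B -> 0 < R < r ->
  Udiff (fun z => Cmod z <= R) (PS a) (PS (dco a)).
Proof.
  intros H [HR HRr].
  (* Two intermediate radii, one for each factor of [k^2]: [k^2 R^k] is bounded by a multiple of
     [R2^k], still inside radius [r]. *)
  set (R1 := (R + r) / 2). set (R2 := (R1 + r) / 2).
  assert (Hs : ex_series (fun k => Cmod (a k) * R2 ^ k)) by (eapply pbd_series; eauto; unfold R2, R1; lra).
  assert (H12 : 0 < R < R1 /\ R1 < R2 < r) by (unfold R2, R1; lra).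
  destruct (mul_pow_bound R R1 ltac:(lra)) as [K1 [HK1 HKb1]].
  destruct (mul_pow_bound R1 R2 ltac:(lra)) as [K2 [HK2 HKb2]].
  set (K := K1 * K2).
  assert (HK : 0 < K) by (apply Rmult_lt_0_compat; auto).
  assert (Hq : forall k, INR k ^ 2 * R ^ k <= K * R2 ^ k).
  { intros k; specialize (HKb1 k); specialize (HKb2 k); unfold K.
    replace (INR k ^ 2 * R ^ k) with (INR k * (INR k * R ^ k)) by ring.
    eapply Rle_trans; [apply Rmult_le_compat_l; [apply pos_INR|exact HKb1]|].
    replace (INR k * (K1 * R1 ^ k)) with (K1 * (INR k * R1 ^ k)) by ring.
    rewrite Rmult_assoc. apply Rmult_le_compat_l; lra. }
  destruct (pbd_dco a r B R1 H ltac:(lra)) as [B' HB'].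
  assert (Hs1 : ex_series (fun k => Cmod (dco a k) * R ^ k)) by (eapply pbd_series; eauto; lra).
  assert (Hs0 : ex_series (fun k => Cmod (a k) * R ^ k)) by (eapply pbd_series; eauto; lra).
  set (M0 := Series (fun k => Cmod (a k) * R ^ k)).
  set (M1 := Series (fun k => Cmod (dco a k) * R ^ k)).
  set (M2 := Series (fun k => Cmod (a k) * R2 ^ k)).
  assert (P : forall (c : nat -> C) x, 0 <= x -> forall k, 0 <= Cmod (c k) * x ^ k).
  { intros; apply Rmult_le_pos; [apply Cmod_ge_0|apply pow_le; auto]. }
  assert (HM0 : 0 <= M0) by (apply Series_ge_0; auto; apply P; lra).
  assert (HM1 : 0 <= M1) by (apply Series_ge_0; auto; apply P; lra).
  assert (HM2 : 0 <= M2) by (apply Series_ge_0; auto; apply P; lra).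
  set (M3 := K * M2 / R ^ 2).
  assert (HR2 : 0 < R ^ 2) by (apply pow_lt; auto).
  assert (HM3 : 0 <= M3).
  { unfold M3; apply Rle_mult_inv_pos; auto. apply Rmult_le_pos; lra. }
  assert (Hbd : forall c, ex_series (fun k => Cmod (c k) * R ^ k) -> forall z, Cmod z <= R ->
     Cmod (PS c z) <= Series (fun k => Cmod (c k) * R ^ k)).
  { intros c Hc z Hz.
    assert (Hle : forall k, 0 <= Cmod (c k * Cpow z k) <= Cmod (c k) * R ^ k).
    { intros k; split; [apply Cmod_ge_0|]. rewrite Cmod_mult, Cmod_pow.
      apply Rmult_le_compat_l; [apply Cmod_ge_0|]. apply pow_incr; split; auto; apply Cmod_ge_0. }
    eapply Rle_trans; [apply Cmod_CSer|apply Series_le; auto].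
    eapply ex_series_le_pos; [exact Hle|auto]. }
  exists (M0 + M1 + M3). split; [lra|]. split.
  - intros z Hz. pose proof (Hbd a Hs0 z Hz). pose proof (Hbd _ Hs1 z Hz).
    fold M0 in H0. fold M1 in H1. lra.
  - intros z w Hz Hw.
    destruct (PS_dco a r B z H ltac:(lra) ltac:(lra)) as [Sd Ed].
    assert (Sz : summ (fun k => Cmult (a k) (Cpow z k))) by (eapply PS_summ; eauto; lra).
    assert (Sw : summ (fun k => Cmult (a k) (Cpow w k))) by (eapply PS_summ; eauto; lra).
    assert (E : (PS a w - PS a z - PS (dco a) z * (w - z))%C =
      CSer (fun k => Cmult (a k) (Cpow w k - Cpow z k - INR k * Cpow z (pred k) * (w - z)))).
    { rewrite <- Ed. unfold PS.
      rewrite (Cmult_comm _ (w - z)), <- CSer_scal; auto.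
      rewrite <- CSer_minus; auto. rewrite <- CSer_minus.
      - apply CSer_ext; intros; ring.
      - apply (summ_ext (fun k => Cplus (Cmult (a k) (Cpow w k)) (Cmult (-1) (Cmult (a k) (Cpow z k))))); [intros; ring|].
        apply summ_plus; auto. apply summ_scal; auto.
      - apply summ_scal; auto. }
    rewrite E.
    set (X := Cmod (w - z) ^ 2).
    assert (HX : 0 <= X) by (apply pow_le, Cmod_ge_0).
    assert (Hk : forall k, 0 <= Cmod (a k * (Cpow w k - Cpow z k - INR k * Cpow z (pred k) * (w - z)))
       <= K * X / R ^ 2 * (Cmod (a k) * R2 ^ k)).
    { intros k; split; [apply Cmod_ge_0|].
      rewrite Cmod_mult. pose proof (Cpow_taylor R z w k HR Hz Hw) as HT. fold X in HT.
      set (e := Cmod (Cpow w k - Cpow z k - INR k * Cpow z (pred k) * (w - z))) in *.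
      apply Rmult_le_reg_r with (R ^ 2); auto.
      replace (K * X / R ^ 2 * (Cmod (a k) * R2 ^ k) * R ^ 2) with (Cmod (a k) * (K * R2 ^ k * X))
        by (field; lra).
      rewrite Rmult_assoc. apply Rmult_le_compat_l; [apply Cmod_ge_0|].
      eapply Rle_trans; [exact HT|]. apply Rmult_le_compat_r; auto. }
    assert (Hes : ex_series (fun k => K * X / R ^ 2 * (Cmod (a k) * R2 ^ k))).
    { apply (ex_series_scal_l (V := R_NormedModule) (K * X / R ^ 2) (fun k => Cmod (a k) * R2 ^ k)); auto. }
    eapply Rle_trans; [apply Cmod_CSer; eapply ex_series_le_pos; [exact Hk|auto]|].
    eapply Rle_trans; [apply Series_le; [exact Hk|auto]|].
    rewrite Series_scal_l. fold M2.
    replace (K * X / R ^ 2 * M2) with (M3 * X) by (unfold M3; field; lra).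
    apply Rmult_le_compat_r; lra.
Qed.

Lemma Udiff_sub (D D' : C -> Prop) f f' : (forall z, D' z -> D z) -> Udiff D f f' -> Udiff D' f f'.
Proof.
  intros H [B [H1 [H2 H3]]]; exists B; repeat split; auto; try apply H2; auto.
Qed.

Lemma Udiff_lip D f f' d : Udiff D f f' -> (forall z w, D z -> D w -> Cmod (w - z) <= d) ->
  exists B, 0 <= B /\ forall z w, D z -> D w -> Cmod (f w - f z) <= B * Cmod (w - z).
Proof.
  intros [B [H1 [H2 H3]]] Hd. exists (B * (1 + Rabs d)). split.
  { apply Rmult_le_pos; auto. pose proof (Rabs_pos d); lra. }
  intros z w Hz Hw.
  replace (f w - f z)%C with ((f w - f z - f' z * (w - z)) + f' z * (w - z))%C by ring.
  eapply Rle_trans; [apply Cmod_triangle|]. rewrite Cmod_mult.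
  specialize (H3 z w Hz Hw). destruct (H2 z Hz) as [_ H4]. specialize (Hd z w Hz Hw).
  pose proof (Cmod_ge_0 (w - z)) as Hp. pose proof (Rle_abs d).
  set (x := Cmod (w - z)) in *.
  assert (Cmod (f' z) * x <= B * x) by (apply Rmult_le_compat_r; auto).
  assert (B * x ^ 2 <= B * (Rabs d * x)).
  { apply Rmult_le_compat_l; auto. simpl. rewrite Rmult_1_r. apply Rmult_le_compat_r; lra. }
  lra.
Qed.

(** The remainder consists of the two remainders and the cross term [(f w - f z) * (g w - g z)]. The
    diameter bound [d] yields Lipschitz constants, which make the cross term quadratic. *)
Lemma Udiff_mult D f f' g g' d : (forall z w, D z -> D w -> Cmod (w - z) <= d) ->
  Udiff D f f' -> Udiff D g g' ->
  Udiff D (fun z => Cmult (f z) (g z)) (fun z => Cplus (Cmult (f' z) (g z)) (Cmult (f z) (g' z))).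
Proof.
  intros Hd Hf Hg.
  destruct (Udiff_lip D f f' d Hf Hd) as [Lf [HLf Lf2]].
  destruct (Udiff_lip D g g' d Hg Hd) as [Lg [HLg Lg2]].
  destruct Hf as [B [H1 [H2 H3]]]. destruct Hg as [B' [H1' [H2' H3']]].
  assert (P : 0 <= B * B') by (apply Rmult_le_pos; auto).
  assert (P2 : 0 <= Lf * Lg) by (apply Rmult_le_pos; auto).
  exists (B * B' + B * B' + Lf * Lg). split; [lra|]. split.
  - intros z Hz. destruct (H2 z Hz), (H2' z Hz).
    pose proof (Cmod_ge_0 (f z)); pose proof (Cmod_ge_0 (g z)).
    pose proof (Cmod_ge_0 (f' z)); pose proof (Cmod_ge_0 (g' z)). split.
    + rewrite Cmod_mult.
      assert (Cmod (f z) * Cmod (g z) <= B * B') by (apply Rmult_le_compat; auto). lra.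
    + eapply Rle_trans; [apply Cmod_triangle|]. rewrite !Cmod_mult.
      assert (Cmod (f' z) * Cmod (g z) <= B * B') by (apply Rmult_le_compat; auto).
      assert (Cmod (f z) * Cmod (g' z) <= B * B') by (apply Rmult_le_compat; auto). lra.
  - intros z w Hz Hw.
    destruct (H2 z Hz) as [a1 a2], (H2' z Hz) as [a3 a4].
    specialize (H3 z w Hz Hw); specialize (H3' z w Hz Hw).
    specialize (Lf2 z w Hz Hw); specialize (Lg2 z w Hz Hw).
    replace (f w * g w - f z * g z - (f' z * g z + f z * g' z) * (w - z))%C with
      (((f w - f z - f' z * (w - z)) * g z + f z * (g w - g z - g' z * (w - z))) +
       (f w - f z) * (g w - g z))%C by ring.
    eapply Rle_trans; [apply Cmod_triangle|].
    eapply Rle_trans; [apply Rplus_le_compat_r, Cmod_triangle|]. rewrite !Cmod_mult.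
    pose proof (Cmod_ge_0 (f z)); pose proof (Cmod_ge_0 (g z)).
    pose proof (Cmod_ge_0 (w - z)) as Hp.
    assert (HX : 0 <= Cmod (w - z) ^ 2) by (apply pow_le; auto).
    assert (Cmod (f w - f z - f' z * (w - z)) * Cmod (g z) <= B * Cmod (w - z) ^ 2 * B')
      by (apply Rmult_le_compat; auto; apply Cmod_ge_0).
    assert (Cmod (f z) * Cmod (g w - g z - g' z * (w - z)) <= B * (B' * Cmod (w - z) ^ 2))
      by (apply Rmult_le_compat; auto; apply Cmod_ge_0).
    assert (Cmod (f w - f z) * Cmod (g w - g z) <= (Lf * Cmod (w - z)) * (Lg * Cmod (w - z)))
      by (apply Rmult_le_compat; auto; apply Cmod_ge_0).
    lra.
Qed.

(** If [e] is the remainder of [f], that of [1 / f] is [- e / (f z)^2 + (f w - f z)^2 / ((f z)^2 f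
    w)]; both terms are quadratic as long as [|f|] stays above [m]. *)
Lemma Udiff_inv D f f' m d : 0 < m -> (forall z w, D z -> D w -> Cmod (w - z) <= d) ->
  Udiff D f f' -> (forall z, D z -> m <= Cmod (f z)) ->
  Udiff D (fun z => Cinv (f z)) (fun z => Copp (Cdiv (f' z) (f z * f z))).
Proof.
  intros Hm Hd Hf Hl.
  destruct (Udiff_lip D f f' d Hf Hd) as [Lf [HLf Lf2]].
  destruct Hf as [B [H1 [H2 H3]]].
  assert (Hnz : forall z, D z -> f z <> 0).
  { intros z Hz; apply Cmod_gt_0; specialize (Hl z Hz); lra. }
  assert (Hi : forall z, D z -> / Cmod (f z) <= / m).
  { intros z Hz; apply Rinv_le_contravar; auto. }
  assert (Him : 0 < / m) by (apply Rinv_0_lt_compat; auto).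
  assert (Hip : forall z, D z -> 0 < / Cmod (f z)).
  { intros z Hz; apply Rinv_0_lt_compat; specialize (Hl z Hz); lra. }
  assert (Hii : forall z w, D z -> D w -> / Cmod (f z) * / Cmod (f w) <= / m * / m).
  { intros; apply Rmult_le_compat; auto; apply Rlt_le, Hip; auto. }
  assert (P0 : 0 < / m * / m) by (apply Rmult_lt_0_compat; auto).
  assert (P1 : 0 <= B * (/ m * / m)) by (apply Rmult_le_pos; lra).
  assert (P2 : 0 <= Lf * Lf * (/ m * / m * / m)).
  { apply Rmult_le_pos; apply Rmult_le_pos; lra. }
  exists (/ m + B * (/ m * / m) + Lf * Lf * (/ m * / m * / m)).
  split; [lra|]. split.
  - intros z Hz. destruct (H2 z Hz) as [a1 a2]. split.
    + rewrite Cmod_inv; auto. specialize (Hi z Hz); lra.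
    + rewrite Cmod_opp, Cmod_div; [|apply Cmult_neq_0; auto].
      rewrite Cmod_mult. unfold Rdiv; rewrite Rinv_mult.
      assert (Cmod (f' z) * (/ Cmod (f z) * / Cmod (f z)) <= B * (/ m * / m)).
      { apply Rmult_le_compat; auto; [apply Cmod_ge_0|]. apply Rmult_le_pos; apply Rlt_le, Hip; auto. }
      lra.
  - intros z w Hz Hw. specialize (H3 z w Hz Hw); specialize (Lf2 z w Hz Hw).
    assert (Nz := Hnz z Hz). assert (Nw := Hnz w Hw).
    replace (/ f w - / f z - - (f' z / (f z * f z)) * (w - z))%C with
      (- ((f w - f z - f' z * (w - z)) * (/ f z * / f z)) +
       (f w - f z) * (f w - f z) * (/ f z * / f z * / f w))%C by (field; auto).
    eapply Rle_trans; [apply Cmod_triangle|].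
    rewrite Cmod_opp, !Cmod_mult, !Cmod_inv by auto.
    pose proof (Cmod_ge_0 (w - z)) as Hp.
    assert (HX : 0 <= Cmod (w - z) ^ 2) by (apply pow_le; auto).
    assert (Cmod (f w - f z - f' z * (w - z)) * (/ Cmod (f z) * / Cmod (f z)) <=
      B * Cmod (w - z) ^ 2 * (/ m * / m)).
    { apply Rmult_le_compat; auto; [apply Cmod_ge_0|]. apply Rmult_le_pos; apply Rlt_le, Hip; auto. }
    assert (Cmod (f w - f z) * Cmod (f w - f z) * (/ Cmod (f z) * / Cmod (f z) * / Cmod (f w)) <=
      (Lf * Cmod (w - z)) * (Lf * Cmod (w - z)) * (/ m * / m * / m)).
    { apply Rmult_le_compat.
      - apply Rmult_le_pos; apply Cmod_ge_0.
      - repeat apply Rmult_le_pos; apply Rlt_le, Hip; auto.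
      - apply Rmult_le_compat; auto; apply Cmod_ge_0.
      - apply Rmult_le_compat; auto.
        + apply Rmult_le_pos; apply Rlt_le, Hip; auto.
        + apply Rlt_le, Hip; auto. }
    assert (0 <= / m * Cmod (w - z) ^ 2) by (apply Rmult_le_pos; lra).
    lra.
Qed.

Lemma is_derive_quad (f : R -> R) x l K d : 0 < d ->
  (forall h, Rabs h < d -> Rabs (f (x + h) - f x - l * h) <= K * h ^ 2) -> is_derive f x l.
Proof.
  intros Hd H. apply is_derive_Reals. intros eps Heps.
  set (K' := Rabs K + 1).
  assert (HK' : 0 < K') by (unfold K'; pose proof (Rabs_pos K); lra).
  assert (Hm : 0 < Rmin d (eps / K')).
  { apply Rmin_glb_lt; auto. apply Rdiv_lt_0_compat; auto. }
  exists (mkposreal _ Hm). simpl. intros h Hh Hlt.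
  assert (H1 : Rabs h < d) by (eapply Rlt_le_trans; [exact Hlt|apply Rmin_l]).
  assert (H2 : Rabs h < eps / K') by (eapply Rlt_le_trans; [exact Hlt|apply Rmin_r]).
  specialize (H h H1).
  replace ((f (x + h) - f x) / h - l) with ((f (x + h) - f x - l * h) / h) by (field; auto).
  unfold Rdiv; rewrite Rabs_mult, Rabs_inv.
  assert (Hp : 0 < Rabs h) by (apply Rabs_pos_lt; auto).
  apply Rmult_lt_reg_r with (Rabs h); auto.
  rewrite Rmult_assoc, Rinv_l, Rmult_1_r by lra.
  eapply Rle_lt_trans; [exact H|]. rewrite <- (pow2_abs h).
  assert (K * Rabs h ^ 2 <= K' * Rabs h * Rabs h).
  { replace (K * Rabs h ^ 2) with (K * (Rabs h * Rabs h)) by ring. rewrite Rmult_assoc.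
    apply Rmult_le_compat_r; [apply Rmult_le_pos; lra|]. unfold K'; pose proof (Rle_abs K); lra. }
  assert (K' * Rabs h < eps).
  { apply Rmult_lt_reg_r with (/ K'); [apply Rinv_0_lt_compat; auto|].
    replace (K' * Rabs h * / K') with (Rabs h) by (field; lra). exact H2. }
  assert (K' * Rabs h * Rabs h < eps * Rabs h) by (apply Rmult_lt_compat_r; auto).
  lra.
Qed.

(** Restriction to the line through [z0] in direction [e], so that the mean value theorem for real
    functions becomes available. *)
Lemma Udiff_path D f f' z0 e t d : Udiff D f f' -> 0 < d ->
  (forall s, Rabs (s - t) < d -> D (z0 + RtoC s * e)%C) ->
  is_derive (fun s => Re (f (z0 + RtoC s * e)%C)) t (Re (f' (z0 + RtoC t * e)%C * e)%C) /\
  is_derive (fun s => Im (f (z0 + RtoC s * e)%C)) t (Im (f' (z0 + RtoC t * e)%C * e)%C).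
Proof.
  intros [B [H1 [H2 H3]]] Hd HD.
  assert (Ht : D (z0 + RtoC t * e)%C) by (apply HD; rewrite Rminus_diag, Rabs_R0; auto).
  assert (Q : forall h, Rabs h < d ->
    Cmod (f (z0 + RtoC (t + h) * e)%C - f (z0 + RtoC t * e)%C - f' (z0 + RtoC t * e)%C * e * RtoC h) <=
    B * Cmod e ^ 2 * h ^ 2).
  { intros h Hh. specialize (H3 (z0 + RtoC t * e)%C (z0 + RtoC (t + h) * e)%C Ht).
    replace (z0 + RtoC (t + h) * e - (z0 + RtoC t * e))%C with (e * RtoC h)%C in H3
      by (rewrite RtoC_plus; ring).
    rewrite Cmult_assoc, Cmod_mult, Cmod_R in H3.
    rewrite Rpow_mult_distr, pow2_abs, <- Rmult_assoc in H3.
    apply H3, HD. replace (t + h - t) with h by ring; auto. }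
  split; eapply (is_derive_quad _ _ _ (B * Cmod e ^ 2) d Hd); intros h Hh;
    (eapply Rle_trans; [|apply (Q h Hh)]).
  - eapply Rle_trans; [|apply re_le_Cmod]. right; f_equal.
    generalize (f' (z0 + RtoC t * e)%C * e)%C (f (z0 + RtoC t * e)%C) (f (z0 + RtoC (t + h) * e)%C).
    intros [v1 v2] [a1 a2] [b1 b2]; simpl; ring.
  - eapply Rle_trans; [|apply im_le_Cmod]. right; f_equal.
    generalize (f' (z0 + RtoC t * e)%C * e)%C (f (z0 + RtoC t * e)%C) (f (z0 + RtoC (t + h) * e)%C).
    intros [v1 v2] [a1 a2] [b1 b2]; simpl; ring.
Qed.

Lemma is_derive_ln_norm (fr fi : R -> R) t a b : is_derive fr t a -> is_derive fi t b ->
  0 < fr t ^ 2 + fi t ^ 2 ->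
  is_derive (fun s => ln (sqrt (fr s ^ 2 + fi s ^ 2))) t
    ((fr t * a + fi t * b) / (fr t ^ 2 + fi t ^ 2)).
Proof.
  intros HR HI Hs.
  assert (Hsq : 0 < sqrt (fr t ^ 2 + fi t ^ 2)) by (apply sqrt_lt_R0; auto).
  assert (D1 : ex_derive fr t) by (eexists; exact HR).
  assert (D2 : ex_derive fi t) by (eexists; exact HI).
  auto_derive.
  - repeat split; auto; simpl in *; lra.
  - replace (Derive (fun x => fr x) t) with a by (symmetry; apply is_derive_unique; exact HR).
    replace (Derive (fun x => fi x) t) with b by (symmetry; apply is_derive_unique; exact HI).
    simpl in *. rewrite !Rmult_1_r in *.
    assert (E := sqrt_sqrt (fr t * fr t + fi t * fi t) ltac:(lra)).
    set (q := sqrt (fr t * fr t + fi t * fi t)) in *.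
    rewrite <- E. field. lra.
Qed.

(** Logarithms enter only through [ln |f|], which is single valued; its derivative in direction [e]
    is the real part of [f' e / f]. *)
Lemma Udiff_ln_path D f f' z0 e t d : Udiff D f f' -> 0 < d ->
  (forall s, Rabs (s - t) < d -> D (z0 + RtoC s * e)%C) -> f (z0 + RtoC t * e)%C <> 0 ->
  is_derive (fun s => ln (Cmod (f (z0 + RtoC s * e)%C))) t
    (Re (f' (z0 + RtoC t * e)%C * e / f (z0 + RtoC t * e)%C)%C).
Proof.
  intros Hf Hd HD Hnz.
  destruct (Udiff_path D f f' z0 e t d Hf Hd HD) as [HR HI].
  set (w := f (z0 + RtoC t * e)%C) in *.
  set (v := (f' (z0 + RtoC t * e)%C * e)%C) in *.
  assert (Hm : 0 < Cmod w) by (apply Cmod_gt_0; auto).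
  assert (Hs : 0 < Re w ^ 2 + Im w ^ 2) by (rewrite <- Cmod2_alt; apply pow_lt; auto).
  apply (is_derive_ext (fun s => ln (sqrt (Re (f (z0 + RtoC s * e)%C) ^ 2 + Im (f (z0 + RtoC s * e)%C) ^ 2)))).
  { intros s. rewrite <- Cmod2_alt, sqrt_pow2; auto. apply Cmod_ge_0. }
  set (fr := fun s => Re (f (z0 + RtoC s * e)%C)) in *.
  set (fi := fun s => Im (f (z0 + RtoC s * e)%C)) in *.
  change (is_derive (fun s => ln (sqrt (fr s ^ 2 + fi s ^ 2))) t (Re (v / w)%C)).
  change (Re w) with (fr t) in Hs. change (Im w) with (fi t) in Hs.
  replace (Re (v / w)%C) with ((fr t * Re v + fi t * Im v) / (fr t ^ 2 + fi t ^ 2)).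
  2: { change (fr t) with (Re w). change (fi t) with (Im w).
       unfold Cdiv, Cinv. rewrite Re_mult. simpl Re. simpl Im.
       change (fst w) with (Re w). change (snd w) with (Im w).
       change (fst v) with (Re v). change (snd v) with (Im v).
       change (fr t) with (Re w) in Hs. change (fi t) with (Im w) in Hs.
       field. simpl in Hs. lra. }
  apply is_derive_ln_norm; auto.
Qed.

(** Along the segment from [0] to [z], the derivative of [ln |F| - Re G] is
    [Re ((F' / F - G') z) = 0]. *)
Lemma ln_const (F F' G G' : C -> C) R z :
  Udiff (fun z => Cmod z <= R) F F' -> Udiff (fun z => Cmod z <= R) G G' ->
  Cmod z < R -> (forall w, Cmod w <= R -> F w <> 0) ->
  (forall w, Cmod w <= R -> F' w = Cmult (F w) (G' w)) ->
  ln (Cmod (F z)) - Re (G z) = ln (Cmod (F 0)) - Re (G 0).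
Proof.
  intros HF HG Hz Hnz Heq.
  assert (Hp := Cmod_ge_0 z).
  (* Solves [d * (Cmod z + 1) = R - Cmod z], so that the segment prolonged by the parameter [d] at
     both ends stays in the disc and two-sided derivatives exist at the endpoints. *)
  set (d := (R - Cmod z) / (Cmod z + 1)).
  assert (Hd : 0 < d) by (unfold d; apply Rdiv_lt_0_compat; lra).
  assert (HD : forall t, 0 <= t <= 1 -> forall s, Rabs (s - t) < d -> Cmod (0 + RtoC s * z) <= R).
  { intros t Ht s Hs. rewrite Cplus_0_l, Cmod_mult, Cmod_R.
    assert (Rabs s <= 1 + d).
    { replace s with (t + (s - t)) by ring. eapply Rle_trans; [apply Rabs_triang|].
      rewrite (Rabs_pos_eq t); lra. }
    eapply Rle_trans; [apply Rmult_le_compat_r; [auto|exact H]|].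
    assert (d * Cmod z <= d * (Cmod z + 1)) by (apply Rmult_le_compat_l; lra).
    assert (d * (Cmod z + 1) = R - Cmod z) by (unfold d; field; lra). lra. }
  set (u := fun s => ln (Cmod (F (0 + RtoC s * z)%C)) - Re (G (0 + RtoC s * z)%C)).
  assert (Hu : forall t, 0 <= t <= 1 -> is_derive u t 0).
  { intros t Ht.
    assert (Hin : Cmod (0 + RtoC t * z) <= R) by (apply (HD t Ht); rewrite Rminus_diag, Rabs_R0; auto).
    pose proof (Udiff_ln_path _ F F' 0 z t d HF Hd (HD t Ht) (Hnz _ Hin)) as H1.
    destruct (Udiff_path _ G G' 0 z t d HG Hd (HD t Ht)) as [H2 _].
    evar_last; [exact (is_derive_minus _ _ _ _ _ H1 H2)|]. rewrite Heq by auto.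
    replace (F (0 + RtoC t * z)%C * G' (0 + RtoC t * z)%C * z / F (0 + RtoC t * z)%C)%C with
      (G' (0 + RtoC t * z)%C * z)%C by (field; apply Hnz; auto).
    apply Rplus_opp_r. }
  assert (E : u 1 = u 0).
  { destruct (MVT_gen u 0 1 (fun _ => 0)) as [c [_ Hc]].
    - intros x Hx; rewrite Rmin_left, Rmax_right in Hx by lra. apply Hu; lra.
    - intros x Hx; rewrite Rmin_left, Rmax_right in Hx by lra.
      apply continuity_pt_filterlim. apply (ex_derive_continuous u). exists 0. apply Hu; lra.
    - lra. }
  unfold u in E.
  replace (0 + RtoC 1 * z)%C with z in E by ring.
  replace (0 + RtoC 0 * z)%C with (RtoC 0) in E by ring. exact E.
Qed.

(** Derivatives of both sides in the directions [1] and [Ci] give the real parts of [F' / F] and of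
    [Ci * F' / F], hence [F' / F] itself. *)
Lemma log_deriv_eq (F F' G G' : C -> C) R z :
  Udiff (fun z => Cmod z <= R) F F' -> Udiff (fun z => Cmod z <= R) G G' ->
  Cmod z < R -> (forall w, Cmod w <= R -> F w <> 0) ->
  (forall w, Cmod w <= R -> ln (Cmod (F w)) = Re (G w)) ->
  F' z = Cmult (F z) (G' z).
Proof.
  intros HF HG Hz Hnz Heq.
  assert (K : forall e, Cmod e = 1 -> Re (F' z * e / F z)%C = Re (G' z * e)%C).
  { intros e He.
    assert (Hd : 0 < R - Cmod z) by lra.
    assert (HD : forall s, Rabs (s - 0) < R - Cmod z -> Cmod (z + RtoC s * e) <= R).
    { intros s Hs. eapply Rle_trans; [apply Cmod_triangle|]. rewrite Cmod_mult, Cmod_R, He.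
      rewrite Rminus_0_r in Hs. lra. }
    assert (E0 : (z + RtoC 0 * e)%C = z) by ring.
    assert (Nz : F (z + RtoC 0 * e)%C <> 0) by (rewrite E0; apply Hnz; lra).
    pose proof (Udiff_ln_path _ F F' z e 0 _ HF Hd HD Nz) as H1.
    destruct (Udiff_path _ G G' z e 0 _ HG Hd HD) as [H2 _].
    assert (H3 : is_derive (fun s => Re (G (z + RtoC s * e)%C)) 0
       (Re (F' (z + RtoC 0 * e)%C * e / F (z + RtoC 0 * e)%C)%C)).
    { eapply is_derive_ext_loc; [|exact H1].
      exists (mkposreal _ Hd). intros s Hs. apply Heq, HD. exact Hs. }
    rewrite E0 in *.
    apply is_derive_unique in H2. apply is_derive_unique in H3. congruence. }
  assert (Nz : F z <> 0) by (apply Hnz; lra).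
  assert (K1 := K 1 Cmod_1). assert (K2 := K Ci Cmod_Ci).
  rewrite Cmult_1_r, Cmult_1_r in K1.
  replace (F' z * Ci / F z)%C with (F' z / F z * Ci)%C in K2 by (field; auto).
  rewrite !Re_mult in K2. simpl (Re Ci) in K2. simpl (Im Ci) in K2.
  assert (E : (F' z / F z)%C = G' z) by (apply C_eq; lra).
  rewrite <- E. field; auto.
Qed.

(** * Averages over roots of unity *)

Definition cis (t : R) : C := (cos t, sin t).

Lemma cis_add a b : cis (a + b) = Cmult (cis a) (cis b).
Proof. apply C_eq; simpl; [apply cos_plus|rewrite sin_plus; ring]. Qed.

Lemma cis_0 : cis 0 = RtoC 1.
Proof. apply C_eq; simpl; [apply cos_0|apply sin_0]. Qed.

Lemma Cmod_cis t : Cmod (cis t) = 1.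
Proof.
  assert (H : Cmod (cis t) ^ 2 = 1).
  { rewrite Cmod2_alt; simpl. pose proof (sin2_cos2 t); unfold Rsqr in *; lra. }
  pose proof (Cmod_ge_0 (cis t)); nra.
Qed.

Lemma cis_pow t k : Cpow (cis t) k = cis (INR k * t).
Proof.
  induction k; [simpl; rewrite Rmult_0_l, cis_0; auto|].
  rewrite Cpow_S, IHk, <- cis_add, S_INR. f_equal; ring.
Qed.

Lemma cis_2PI j : cis (2 * PI * INR j) = RtoC 1.
Proof.
  rewrite Rmult_comm, <- cis_pow.
  replace (cis (2 * PI)) with (RtoC 1); [apply Cpow_1_l|].
  apply C_eq; simpl; [rewrite cos_2PI|rewrite sin_2PI]; auto.
Qed.

Lemma cos_neq_1 x : 0 < x < 2 * PI -> cos x <> 1.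
Proof.
  intros Hx E. replace x with (2 * (x / 2)) in E by field.
  rewrite cos_2a_sin in E. assert (0 < sin (x / 2)) by (apply sin_gt_0; lra). nra.
Qed.

Lemma sin_bounds x : 0 <= x -> -x <= sin x <= x.
Proof.
  intros [H| <-]; [|rewrite sin_0; lra].
  split; [|apply Rlt_le, sin_lt_x; auto].
  destruct (Rle_dec x PI).
  - pose proof (sin_ge_0 x ltac:(lra) r); lra.
  - pose proof (SIN_bound x). pose proof PI2_1. lra.
Qed.

Lemma one_minus_cos x : 0 <= x -> 0 <= 1 - cos x <= x /\ 1 - cos x <= x ^ 2.
Proof.
  intros Hx. replace x with (2 * (x / 2)) by field. rewrite cos_2a_sin.
  pose proof (sin_bounds (x / 2) ltac:(lra)). pose proof (SIN_bound (x / 2)).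
  repeat split; nra.
Qed.

Lemma x_minus_sin x : 0 <= x -> 0 <= x - sin x <= x ^ 2.
Proof.
  intros [Hx| <-]; [|rewrite sin_0; lra].
  pose proof (sin_bounds x ltac:(lra)). split; [lra|].
  destruct (MVT_cor2 sin cos 0 x Hx) as [c [E Hc]]; [intros; apply derivable_pt_lim_sin|].
  rewrite sin_0, !Rminus_0_r in E. rewrite E.
  destruct (one_minus_cos c ltac:(lra)) as [H1 _]. nra.
Qed.

Lemma cis_taylor x : 0 <= x ->
  Cmod (cis x - 1) <= 2 * x /\ Cmod (cis x - 1 - Ci * x) <= 2 * x ^ 2.
Proof.
  intros Hx. destruct (one_minus_cos x Hx) as [H1 H2]. pose proof (x_minus_sin x Hx).
  pose proof (sin_bounds x Hx).
  split; (eapply Rle_trans; [apply Cmod_le_ReIm|]).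
  - replace (Re (cis x - 1)) with (cos x - 1) by (simpl; ring).
    replace (Im (cis x - 1)) with (sin x) by (simpl; ring).
    assert (Rabs (cos x - 1) <= x) by (apply Rabs_le; lra).
    assert (Rabs (sin x) <= x) by (apply Rabs_le; lra). lra.
  - replace (Re (cis x - 1 - Ci * x)) with (cos x - 1) by (simpl; ring).
    replace (Im (cis x - 1 - Ci * x)) with (sin x - x) by (simpl; ring).
    assert (Rabs (cos x - 1) <= x ^ 2) by (apply Rabs_le; lra).
    assert (Rabs (sin x - x) <= x ^ 2) by (apply Rabs_le; lra). lra.
Qed.

Definition rt (N j : nat) : C := cis (2 * PI * INR j / INR N).

Definition avg (N : nat) (phi : C -> C) : C :=
  Cmult (RtoC (/ INR N)) (csum (fun j => phi (rt N j)) N).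

Lemma Cmod_rt N j : Cmod (rt N j) = 1.
Proof. apply Cmod_cis. Qed.

Lemma rt_conj N j : Cmult (rt N j) (Cconj (rt N j)) = RtoC 1.
Proof. rewrite <- Cmod2_conj, Cmod_rt. f_equal; ring. Qed.

Lemma rt_S N j : rt N (S j) = Cmult (rt N j) (cis (2 * PI / INR N)).
Proof. unfold rt. rewrite <- cis_add, S_INR. f_equal. unfold Rdiv; ring. Qed.

Lemma avg_ext N phi psi : (forall j, phi (rt N j) = psi (rt N j)) -> avg N phi = avg N psi.
Proof. intros H; unfold avg; f_equal; apply csum_ext; intros; apply H. Qed.

Lemma avg_plus N phi psi : avg N (fun w => Cplus (phi w) (psi w)) = Cplus (avg N phi) (avg N psi).
Proof. unfold avg; rewrite csum_plus; ring. Qed.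

Lemma avg_scal N c phi : avg N (fun w => Cmult c (phi w)) = Cmult c (avg N phi).
Proof. unfold avg; rewrite csum_scal; ring. Qed.

Lemma avg_bound N phi M : 0 <= M -> (forall j, Cmod (phi (rt N j)) <= M) -> Cmod (avg N phi) <= M.
Proof.
  intros HM H; unfold avg; rewrite Cmod_mult, Cmod_R.
  destruct N as [|N]; [simpl; rewrite Cmod_0; lra|].
  assert (HN : 0 < INR (S N)) by (apply lt_0_INR; lia).
  rewrite Rabs_pos_eq by (apply Rlt_le, Rinv_0_lt_compat; auto).
  apply Rmult_le_reg_l with (INR (S N)); auto.
  rewrite <- Rmult_assoc, Rinv_r, Rmult_1_l by lra.
  eapply Rle_trans; [apply Cmod_csum|]. rewrite <- rsum_const. apply rsum_le; auto.
Qed.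

Lemma avg_Re_ge_0 N phi : (forall j, 0 <= Re (phi (rt N j))) -> 0 <= Re (avg N phi).
Proof.
  intros H; unfold avg. rewrite Re_mult, Re_csum. simpl (Im (RtoC _)). simpl (Re (RtoC _)).
  rewrite Rmult_0_l, Rminus_0_r. apply Rmult_le_pos.
  - destruct N; [simpl; rewrite Rinv_0; lra|].
    apply Rlt_le, Rinv_0_lt_compat, lt_0_INR; lia.
  - apply rsum_ge_0; auto.
Qed.

Lemma csum_conj f n : csum (fun i => Cconj (f i)) n = Cconj (csum f n).
Proof. induction n; simpl; [apply C_eq; simpl; ring|]. rewrite IHn, Cplus_conj; auto. Qed.

Lemma avg_conj N phi : avg N (fun w => Cconj (phi w)) = Cconj (avg N phi).
Proof.
  unfold avg; rewrite csum_conj, Cmult_conj. f_equal. apply C_eq; simpl; ring.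
Qed.

Lemma geom_zero x N : Cpow x N = RtoC 1 -> x <> 1 -> csum (fun j => Cpow x j) N = RtoC 0.
Proof.
  intros H1 H2.
  assert (E : forall n, Cmult (x - 1) (csum (fun j => Cpow x j) n) = Cminus (Cpow x n) 1).
  { induction n; simpl; [ring|]. rewrite Cmult_plus_distr_l, IHn. ring. }
  specialize (E N). rewrite H1 in E.
  assert (Hx : (x - 1)%C <> 0) by (apply Cminus_eq_contra; auto).
  destruct (Ceq_dec (csum (fun j => Cpow x j) N) 0) as [?|Hn]; auto.
  exfalso. apply (Cmult_neq_0 _ _ Hx Hn). rewrite E; ring.
Qed.

Lemma avg_pow_0 N m : (0 < m < N)%nat -> avg N (fun w => Cpow w m) = RtoC 0.
Proof.
  intros [H1 H2]. unfold avg.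
  assert (HN : 0 < INR N) by (apply lt_0_INR; lia).
  assert (Hm : 0 < INR m) by (apply lt_0_INR; lia).
  assert (HmN : INR m < INR N) by (apply lt_INR; lia).
  rewrite (csum_ext _ (fun j => Cpow (rt N m) j)).
  - rewrite geom_zero; [ring| |].
    + unfold rt. rewrite cis_pow.
      replace (INR N * (2 * PI * INR m / INR N)) with (2 * PI * INR m) by (field; lra).
      apply cis_2PI.
    + intros E. apply (cos_neq_1 (2 * PI * INR m / INR N)).
      * pose proof PI_RGT_0. split.
        -- apply Rdiv_lt_0_compat; auto. apply Rmult_lt_0_compat; lra.
        -- apply Rmult_lt_reg_r with (INR N); auto. field_simplify; [|lra]. nra.
      * apply (f_equal Re) in E. exact E.
  - intros j _. unfold rt. rewrite !cis_pow. f_equal. field; lra.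
Qed.

Lemma avg_pow_conj_0 N m : (0 < m < N)%nat -> avg N (fun w => Cpow (Cconj w) m) = RtoC 0.
Proof.
  intros H. rewrite (avg_ext _ _ (fun w => Cconj (Cpow w m))) by (intros; symmetry; apply Cpow_conj).
  rewrite avg_conj, avg_pow_0; auto. apply C_eq; simpl; ring.
Qed.

Lemma avg_1 N : (0 < N)%nat -> avg N (fun _ => RtoC 1) = RtoC 1.
Proof.
  intros H. unfold avg.
  assert (E : forall n, csum (fun _ => RtoC 1) n = RtoC (INR n)).
  { induction n; [auto|]. rewrite S_INR, RtoC_plus, <- IHn; auto. }
  rewrite E, <- RtoC_mult, Rinv_l; auto. apply not_0_INR; lia.
Qed.

Definition orth N n k := avg N (fun w => Cmult (Cpow w n) (Cpow (Cconj w) k)).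

Lemma orth_val N n k : (n < N)%nat -> (k < N)%nat ->
  orth N n k = if Nat.eq_dec n k then RtoC 1 else RtoC 0.
Proof.
  intros Hn Hk. unfold orth. destruct (Nat.eq_dec n k) as [->|Hne].
  - rewrite (avg_ext _ _ (fun _ => RtoC 1)); [apply avg_1; lia|].
    intros j. rewrite <- Cpow_mult_l, rt_conj. apply Cpow_1_l.
  - destruct (Nat.lt_ge_cases n k).
    + rewrite (avg_ext _ _ (fun w => Cpow (Cconj w) (k - n))); [apply avg_pow_conj_0; lia|].
      intros j. replace k with (n + (k - n))%nat at 1 by lia.
      rewrite Cpow_add_r, Cmult_assoc, <- Cpow_mult_l, rt_conj, Cpow_1_l; ring.
    + rewrite (avg_ext _ _ (fun w => Cpow w (n - k))); [apply avg_pow_0; lia|].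
      intros j. replace n with (k + (n - k))%nat at 1 by lia.
      replace (rt N j ^ (k + (n - k)) * Cconj (rt N j) ^ k)%C with
        ((rt N j ^ k * Cconj (rt N j) ^ k) * rt N j ^ (n - k))%C by (rewrite Cpow_add_r; ring).
      rewrite <- Cpow_mult_l, rt_conj, Cpow_1_l; ring.
Qed.

Lemma orth_bound N n k : Cmod (orth N n k) <= 1.
Proof.
  apply avg_bound; [lra|]. intros j.
  rewrite Cmod_mult, !Cmod_pow, Cmod_conj, Cmod_rt, !pow1; lra.
Qed.

Lemma Clim_eventually (u : nat -> C) l N : (forall n, (N <= n)%nat -> u n = l) -> Clim u l.
Proof.
  intros H; apply Clim_eps; intros eps He; exists N; intros n Hn.
  rewrite (H n Hn). replace (l - l)%C with (RtoC 0) by ring. rewrite Cmod_0; lra.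
Qed.

Lemma CSer_single (a : nat -> C) k : (forall n, n <> k -> a n = 0) -> summ a /\ CSer a = a k.
Proof.
  intros H.
  assert (S1 : summ a).
  { apply (ex_series_incr_n (fun k => Cmod (a k)) (S k)).
    eapply ex_series_ext; [|exact summ_0]. intros n; cbv beta.
    rewrite (H (S k + n)%nat) by lia; auto. }
  split; auto.
  eapply Clim_unique; [apply CSer_lim; auto|].
  apply (Clim_eventually _ _ (S k)). intros n Hn.
  assert (Z : forall m, (m <= k)%nat -> csum a m = 0).
  { induction m; intros Hm; simpl; auto. rewrite IHm, H by lia. ring. }
  replace n with (S k + (n - S k))%nat by lia. rewrite csum_app. simpl csum at 1.
  rewrite Z by lia.
  rewrite (csum_ext _ (fun _ => Cmult 0 0)) by (intros; rewrite H by lia; ring).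
  rewrite (csum_scal 0 (fun _ => RtoC 0)). ring.
Qed.

Lemma avg_CSer N (phi : C -> nat -> C) : (forall j, summ (phi (rt N j))) ->
  avg N (fun w => CSer (phi w)) = CSer (fun n => avg N (fun w => phi w n)).
Proof.
  intros H. unfold avg.
  destruct (CSer_csum (fun j => phi (rt N j)) N) as [H1 H2]; [intros; apply H|].
  rewrite <- H2, <- CSer_scal; auto.
Qed.

(** For fixed [N] the average also collects every coefficient whose index agrees with [k] modulo
    [N]; these indices escape to infinity with [N], and [Tannery] removes them. *)
Lemma coef_avg a R k : 0 <= R -> summ (fun n => Cmult (a n) (Cpow R n)) ->
  Clim (fun N => avg N (fun w => Cmult (PS a (Cmult R w)) (Cpow (Cconj w) k)))
    (Cmult (a k) (Cpow R k)).
Proof.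
  intros HR Hs.
  assert (Hsw : forall w, Cmod w = 1 -> summ (fun n => Cmult (a n) (Cpow (Cmult R w) n))).
  { intros w Hw. eapply ex_series_ext; [|exact Hs]. intros n; simpl.
    rewrite !Cmod_mult, !Cmod_pow, Cmod_mult, Hw, Rmult_1_r; auto. }
  assert (E : forall N, CSer (fun n => Cmult (Cmult (a n) (Cpow R n)) (orth N n k)) =
     avg N (fun w => Cmult (PS a (Cmult R w)) (Cpow (Cconj w) k))).
  { intros N.
    rewrite (avg_ext _ _ (fun w => CSer (fun n => Cmult (Cpow (Cconj w) k) (Cmult (a n) (Cpow (Cmult R w) n))))).
    - rewrite avg_CSer.
      + apply CSer_ext; intros n. unfold orth. rewrite <- avg_scal. apply avg_ext; intros j.
        rewrite Cpow_mult_l; ring.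
      + intros j. apply summ_scal, Hsw, Cmod_rt.
    - intros j. rewrite CSer_scal by apply Hsw, Cmod_rt. unfold PS; ring. }
  eapply Clim_ext; [exact E|].
  destruct (Tannery (fun N n => Cmult (Cmult (a n) (Cpow R n)) (orth N n k))
    (fun n => if Nat.eq_dec n k then Cmult (a n) (Cpow R n) else 0)
    (fun n => Cmod (Cmult (a n) (Cpow R n)))) as [_ T]; auto.
  - intros N n. rewrite (Cmod_mult (_ * _)). rewrite <- (Rmult_1_r (Cmod (a n * R ^ n))) at 2.
    apply Rmult_le_compat_l; [apply Cmod_ge_0|apply orth_bound].
  - intros n. apply (Clim_eventually _ _ (S (max n k))). intros N HN.
    rewrite orth_val by lia. destruct (Nat.eq_dec n k); ring.
  - destruct (CSer_single (fun n => if Nat.eq_dec n k then Cmult (a n) (Cpow R n) else 0) k) as [_ E2].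
    + intros n Hn. destruct (Nat.eq_dec n k); [contradiction|auto].
    + rewrite E2 in T. destruct (Nat.eq_dec k k); [exact T|contradiction].
Qed.

(** The conjugated terms carry [Cconj w] to the power [n + k], which is positive because [k] is, so
    each average vanishes once [N] exceeds [n + k]. *)
Lemma coef_avg_conj a R k : 0 <= R -> (0 < k)%nat -> summ (fun n => Cmult (a n) (Cpow R n)) ->
  Clim (fun N => avg N (fun w => Cmult (Cconj (PS a (Cmult R w))) (Cpow (Cconj w) k))) 0.
Proof.
  intros HR Hk Hs.
  assert (Hsw : forall w, Cmod w = 1 -> summ (fun n => Cmult (a n) (Cpow (Cmult R w) n))).
  { intros w Hw. eapply ex_series_ext; [|exact Hs]. intros n; simpl.
    rewrite !Cmod_mult, !Cmod_pow, Cmod_mult, Hw, Rmult_1_r; auto. }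
  assert (E : forall N, CSer (fun n => Cmult (Cconj (Cmult (a n) (Cpow R n))) (avg N (fun w => Cpow (Cconj w) (n + k)))) =
     avg N (fun w => Cmult (Cconj (PS a (Cmult R w))) (Cpow (Cconj w) k))).
  { intros N.
    rewrite (avg_ext _ _ (fun w => CSer (fun n => Cmult (Cpow (Cconj w) k) (Cconj (Cmult (a n) (Cpow (Cmult R w) n)))))).
    - rewrite avg_CSer.
      + apply CSer_ext; intros n. rewrite <- avg_scal. apply avg_ext; intros j.
        rewrite Cpow_mult_l, Cpow_add_r, !Cmult_conj, <- (Cpow_conj (rt N j)). ring.
      + intros j. apply summ_scal, summ_conj, Hsw, Cmod_rt.
    - intros j. rewrite CSer_scal by apply summ_conj, Hsw, Cmod_rt.
      rewrite CSer_conj. unfold PS; ring. }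
  eapply Clim_ext; [exact E|].
  destruct (Tannery (fun N n => Cmult (Cconj (Cmult (a n) (Cpow R n))) (avg N (fun w => Cpow (Cconj w) (n + k))))
    (fun n => RtoC 0)
    (fun n => Cmod (Cmult (a n) (Cpow R n)))) as [_ T]; auto.
  - intros N n. rewrite Cmod_mult, Cmod_conj. rewrite <- (Rmult_1_r (Cmod (a n * R ^ n))) at 2.
    apply Rmult_le_compat_l; [apply Cmod_ge_0|]. apply avg_bound; [lra|].
    intros j. rewrite Cmod_pow, Cmod_conj, Cmod_rt, pow1; lra.
  - intros n. apply (Clim_eventually _ _ (S (n + k))). intros N HN.
    rewrite avg_pow_conj_0 by lia. ring.
  - rewrite CSer_0 in T. exact T.
Qed.

Lemma PS_unique a b R : 0 < R -> summ (fun n => Cmult (a n) (Cpow R n)) ->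
  summ (fun n => Cmult (b n) (Cpow R n)) ->
  (forall z, Cmod z = R -> PS a z = PS b z) -> forall k, a k = b k.
Proof.
  intros HR Ha Hb H k.
  pose proof (coef_avg a R k ltac:(lra) Ha) as La.
  pose proof (coef_avg b R k ltac:(lra) Hb) as Lb.
  assert (E : (a k * Cpow R k)%C = (b k * Cpow R k)%C).
  { eapply Clim_unique; [exact La|]. eapply Clim_ext; [|exact Lb].
    intros N; apply avg_ext; intros j. cbv beta. rewrite H; auto.
    rewrite Cmod_mult, Cmod_rt, Cmod_R, Rabs_pos_eq; lra. }
  assert (N0 : Cpow R k <> 0) by (apply Cpow_nz, RtoC_neq; lra).
  replace (a k) with (a k * Cpow R k / Cpow R k)%C by (field; auto).
  rewrite E. field; auto.
Qed.

Lemma unit_rotation (c : C) : exists u, Cmod u = 1 /\ Cmult u c = RtoC (Cmod c).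
Proof.
  destruct (Ceq_dec c 0) as [->|H].
  - exists (RtoC 1). rewrite Cmod_1, Cmod_0. split; [auto|ring].
  - assert (Hp := proj1 (Cmod_gt_0 c) H).
    exists (Cmult (RtoC (/ Cmod c)) (Cconj c)). split.
    + rewrite Cmod_mult, Cmod_conj, Cmod_R, Rabs_pos_eq; [field; lra|].
      apply Rlt_le, Rinv_0_lt_compat; auto.
    + rewrite <- Cmult_assoc, (Cmult_comm (Cconj c)), <- Cmod2_conj, <- RtoC_mult.
      f_equal. field; lra.
Qed.

(** Average the nonnegative function [(M - Re g) * (1 + Re (c w^-k))] over the circle. The constant
    part tends to [M - Re (g 0)]; the rotation [c], chosen with [c * g k = |g k|], makes the other
    part tend to [- |g k| R^k / 2]. *)
Lemma Borel_Caratheodory g R M k : 0 <= R -> (0 < k)%nat ->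
  summ (fun n => Cmult (g n) (Cpow R n)) ->
  (forall z, Cmod z = R -> Re (PS g z) <= M) ->
  Cmod (g k) * R ^ k <= 2 * (M - Re (g 0%nat)).
Proof.
  intros HR Hk Hs HM.
  destruct (unit_rotation (g k)) as [c [Hc1 Hc2]].
  pose proof (coef_avg g R k HR Hs) as LX.
  pose proof (coef_avg_conj g R k HR Hk Hs) as LY.
  pose proof (coef_avg g R 0 HR Hs) as LZ.
  (* [Re g] is written with [Cconj] so that the average splits into the pieces of [coef_avg] and
     [coef_avg_conj]. The first factor being real, [Re (U w)] is a product of two nonnegative
     numbers. *)
  set (U := fun w : C => ((M - (PS g (R * w) + Cconj (PS g (R * w))) / 2) * (1 + c * Cpow (Cconj w) k))%C).
  assert (HU : forall w, Cmod w = 1 -> 0 <= Re (U w)).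
  { intros w Hw. unfold U.
    replace (M - (PS g (R * w) + Cconj (PS g (R * w))) / 2)%C with (RtoC (M - Re (PS g (R * w)))).
    2: { rewrite RtoC_minus, <- re_alt; auto. }
    rewrite Re_scal. apply Rmult_le_pos.
    - specialize (HM (R * w)%C). rewrite Cmod_mult, Hw, Cmod_R, Rabs_pos_eq in HM by auto.
      specialize (HM ltac:(ring)). lra.
    - assert (H : Rabs (Re (c * Cpow (Cconj w) k)) <= 1).
      { eapply Rle_trans; [apply re_le_Cmod|].
        rewrite Cmod_mult, Hc1, Cmod_pow, Cmod_conj, Hw, pow1. lra. }
      apply Rabs_le_between in H.
      change (Re (1 + c * Cpow (Cconj w) k)%C) with (1 + Re (c * Cpow (Cconj w) k)%C). lra. }
  set (X := fun N => avg N (fun w => Cmult (PS g (Cmult R w)) (Cpow (Cconj w) k))) in *.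
  set (Y := fun N => avg N (fun w => Cmult (Cconj (PS g (Cmult R w))) (Cpow (Cconj w) k))) in *.
  set (Z := fun N => avg N (fun w => Cmult (PS g (Cmult R w)) (Cpow (Cconj w) 0))) in *.
  assert (LU : Clim (fun N => avg N U)
     (M + M * c * 0 - (g 0%nat * Cpow R 0 + Cconj (g 0%nat * Cpow R 0) + c * (g k * Cpow R k) + c * 0) / 2)%C).
  { apply (Clim_ext (fun N => (M * avg N (fun _ => RtoC 1) + M * c * avg N (fun w => Cpow (Cconj w) k) -
       (Z N + Cconj (Z N) + c * X N + c * Y N) / 2)%C)).
    - intros N. unfold X, Y, Z, U. rewrite <- avg_conj. cbv beta.
      match goal with |- Cminus ?a (Cdiv ?S ?t) = _ =>
        replace (Cminus a (Cdiv S t)) with (a + (- / t) * S)%C by (unfold Cdiv; ring) end.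
      rewrite <- !avg_scal, <- !avg_plus, <- avg_scal, <- avg_plus.
      apply avg_ext; intros j. cbv beta. simpl (Cpow _ 0). rewrite !Cmult_1_r.
      field.
    - unfold Cdiv. apply Clim_minus.
      + apply Clim_plus.
        * rewrite <- (Cmult_1_r M) at 1. apply Clim_mult; [apply Clim_const|].
          apply (Clim_eventually _ _ 1). intros; apply avg_1; lia.
        * apply Clim_mult; [apply Clim_const|].
          apply (Clim_eventually _ _ (S k)). intros; apply avg_pow_conj_0; lia.
      + apply Clim_mult; [|apply Clim_const].
        apply Clim_plus; [apply Clim_plus; [apply Clim_plus|]|].
        * exact LZ.
        * apply Clim_conj; exact LZ.
        * apply Clim_mult; [apply Clim_const|exact LX].
        * apply Clim_mult; [apply Clim_const|exact LY]. }
  apply Re_lim_of_Clim in LU.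
  assert (HL : 0 <= Re (M + M * c * 0 - (g 0%nat * Cpow R 0 + Cconj (g 0%nat * Cpow R 0) + c * (g k * Cpow R k) + c * 0) / 2)%C).
  { apply (is_lim_seq_le (fun _ => 0) (fun N => Re (avg N U)) 0 (Finite (Re (M + M * c * 0 - (g 0%nat * Cpow R 0 + Cconj (g 0%nat * Cpow R 0) + c * (g k * Cpow R k) + c * 0) / 2)%C))); auto.
    - intros N; apply avg_Re_ge_0. intros j; apply HU, Cmod_rt.
    - apply is_lim_seq_const. }
  replace (M + M * c * 0 - (g 0%nat * Cpow R 0 + Cconj (g 0%nat * Cpow R 0) + c * (g k * Cpow R k) + c * 0) / 2)%C
    with (RtoC (M - Re (g 0%nat) - Cmod (g k) * R ^ k / 2)) in HL.
  2: { simpl (Cpow R 0). rewrite !Cmult_1_r.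
       replace (c * (g k * Cpow R k))%C with (RtoC (Cmod (g k) * R ^ k))
         by (rewrite RtoC_mult, <- Hc2, RtoC_pow; ring).
       unfold Rdiv. rewrite !RtoC_minus, RtoC_mult, RtoC_inv, re_alt by lra. field. }
  simpl in HL. change (fst (g 0%nat)) with (Re (g 0%nat)) in HL. lra.
Qed.

(** * Logarithms of zero-free power series *)

(** Compactness of the surrounding square with a gauge. At a point of the disc the gauge is a small
    multiple of [|F|], so that [|F|] keeps half its value nearby; at a point outside it is too small
    to reach the disc. The uniform [d] below the gauge values is then itself a lower bound for
    [|F|]. *)
Lemma disc_min_modulus (F : C -> C) R L : 0 <= L ->
  (forall z w, Cmod z <= R -> Cmod w <= R -> Cmod (F w - F z) <= L * Cmod (w - z)) ->
  (forall z, Cmod z <= R -> F z <> 0) ->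
  exists m, 0 < m /\ forall z, Cmod z <= R -> m <= Cmod (F z).
Proof.
  intros HL Hlip Hnz.
  assert (P1 : forall u v, Cmod (u, v) <= R -> 0 < Cmod (F (u, v)) / (4 * (L + 1))).
  { intros u v H. apply Rdiv_lt_0_compat; [apply Cmod_gt_0, Hnz; auto|lra]. }
  assert (P2 : forall u v, ~ Cmod (u, v) <= R -> 0 < (Cmod (u, v) - R) / 2).
  { intros u v H. lra. }
  set (delta := fun u v => match Rle_dec (Cmod (u, v)) R with
    | left H => mkposreal _ (P1 u v H) | right H => mkposreal _ (P2 u v H) end).
  destruct (compactness_value_2d (-R) R (-R) R delta) as [d Hd].
  exists d. split; [apply cond_pos|]. intros [x y] Hz.
  apply NNPP; intros Hn.
  assert (Hx : -R <= x <= R).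
  { apply Rabs_le_between. eapply Rle_trans; [apply (re_le_Cmod (x, y))|auto]. }
  assert (Hy : -R <= y <= R).
  { apply Rabs_le_between. eapply Rle_trans; [apply (im_le_Cmod (x, y))|auto]. }
  apply (Hd x y Hx Hy). intros [u [v [Hu [Hv [H1 [H2 H3]]]]]].
  assert (Hc : Cmod ((x, y) - (u, v)) < 2 * delta u v).
  { eapply Rle_lt_trans; [apply Cmod_le_ReIm|]. simpl. unfold Rminus in *. lra. }
  unfold delta in *. destruct (Rle_dec (Cmod (u, v)) R) as [H|H]; simpl in *.
  - apply Hn. specialize (Hlip (u, v) (x, y) H Hz).
    set (f := Cmod (F (u, v))) in *.
    assert (Hf : 0 < f) by (apply Cmod_gt_0, Hnz; auto).
    assert (L * Cmod ((x, y) - (u, v)) <= L * (2 * (f / (4 * (L + 1))))) by (apply Rmult_le_compat_l; lra).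
    assert (E : 2 * (L + 1) * (f / (4 * (L + 1))) = f / 2) by (field; lra).
    pose proof (P1 u v H) as Hp. fold f in Hp.
    pose proof (Cmod_triangle' (F (u, v)) (F (x, y))) as Ht.
    rewrite Cmod_minus_sym in Ht. fold f in Ht.
    set (q := f / (4 * (L + 1))) in *. nra.
  - pose proof (Cmod_triangle' (u, v) (x, y)) as Ht. rewrite Cmod_minus_sym in Ht. lra.
Qed.

Lemma csum_minus f g n : csum (fun i => Cminus (f i) (g i)) n = Cminus (csum f n) (csum g n).
Proof. induction n; simpl; [ring|rewrite IHn; ring]. Qed.

Lemma avg_minus N phi psi : avg N (fun w => Cminus (phi w) (psi w)) = Cminus (avg N phi) (avg N psi).
Proof. unfold avg; rewrite csum_minus; ring. Qed.

Lemma avg_rot N phi : (0 < N)%nat ->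
  avg N (fun w => phi (Cmult w (cis (2 * PI / INR N)))) = avg N phi.
Proof.
  intros HN. unfold avg. f_equal.
  rewrite (csum_ext _ (fun j => phi (rt N (S j)))) by (intros; rewrite rt_S; auto).
  assert (E : forall f n, csum (fun j => f (S j)) n = (csum f n + f n - f 0%nat)%C).
  { intros f n; induction n; simpl; [ring|rewrite IHn; ring]. }
  rewrite (E (fun j => phi (rt N j))).
  replace (rt N N) with (rt N 0); [ring|].
  unfold rt. replace (2 * PI * INR N / INR N) with (2 * PI * INR 1).
  - rewrite cis_2PI. simpl (INR 0). replace (2 * PI * 0 / INR N) with 0 by (unfold Rdiv; ring). apply cis_0.
  - simpl INR. field. apply not_0_INR; lia.
Qed.

(* The rotation by one root of unity leaves the average unchanged, and the second order
   Taylor formula compares it with a radial displacement. *)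
Lemma discrete_Cauchy phi phi' r0 R : 0 < r0 <= R ->
  Udiff (fun z => r0 <= Cmod z <= R) phi phi' ->
  exists K, forall N, (0 < N)%nat ->
    Cmod (avg N (fun w => phi (Cmult R w)) - avg N (fun w => phi (Cmult r0 w))) <= K / INR N.
Proof.
  intros [Hr0 HR] [B [HB [H2 H3]]].
  set (K1 := B * (R - r0) ^ 2 + (R - r0) / r0 * ((4 * B * R ^ 2 + 2 * B * R) * (2 * PI))).
  exists K1. intros N HN.
  assert (HNp : 0 < INR N) by (apply lt_0_INR; auto).
  set (h := (R - r0) / INR N). set (eta := 2 * PI / INR N).
  assert (Hh : 0 <= h) by (unfold h; apply Rle_mult_inv_pos; lra).
  assert (HPI := PI_RGT_0).
  assert (Heta : 0 < eta) by (unfold eta; apply Rdiv_lt_0_compat; lra).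
  assert (HhN : INR N * h = R - r0) by (unfold h; field; lra).
  set (A := fun rho => avg N (fun w => phi (Cmult (RtoC rho) w))).
  assert (Step : forall rho, r0 <= rho -> rho + h <= R ->
    Cmod (A (rho + h)%R - A rho) <= B * h ^ 2 + h / r0 * ((4 * B * R ^ 2 + 2 * B * R) * eta)).
  { intros rho Hrho Hrho'.
    set (psi := fun w => (phi (rho * (w * cis eta)) - phi (rho * w))%C).
    assert (Hpsi : avg N psi = RtoC 0).
    { unfold psi. rewrite avg_minus.
      pose proof (avg_rot N (fun w => phi (Cmult rho w)) HN) as E. fold eta in E. cbv beta in E.
      rewrite E. ring. }
    (* [c] scales the rotation displacement, [Ci * rho * eta * w] to first order, to the radial one
       [h * w]. As the average of [psi] vanishes, subtracting [c * psi] costs nothing and cancels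
       the first order terms. *)
    set (c := (RtoC h / (Ci * rho * eta))%C).
    replace (A (rho + h)%R - A rho)%C with
      (avg N (fun w => (phi (RtoC (rho + h)%R * w) - phi (rho * w)) - c * psi w)%C).
    2: { rewrite avg_minus, avg_minus, avg_scal, Hpsi. unfold A. ring. }
    apply avg_bound.
    { apply Rplus_le_le_0_compat; [apply Rmult_le_pos; auto; apply pow_le; auto|].
      apply Rmult_le_pos; [apply Rle_mult_inv_pos; lra|].
      apply Rmult_le_pos; [|lra]. pose proof (pow_le R 2 ltac:(lra)).
      assert (0 <= B * R ^ 2) by (apply Rmult_le_pos; auto).
      assert (0 <= B * R) by (apply Rmult_le_pos; lra). lra. }
    intros j. pose proof (Cmod_rt N j) as Hw. set (w := rt N j) in *. clearbody w.
    assert (D0 : r0 <= Cmod (rho * w) <= R) by (rewrite Cmod_mult, Hw, Cmod_R, Rabs_pos_eq; lra).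
    assert (D1 : r0 <= Cmod (RtoC (rho + h)%R * w) <= R) by (rewrite Cmod_mult, Hw, Cmod_R, Rabs_pos_eq; lra).
    assert (D2 : r0 <= Cmod (rho * (w * cis eta)) <= R).
    { rewrite !Cmod_mult, Hw, Cmod_cis, Cmod_R, Rabs_pos_eq; lra. }
    pose proof (H3 _ _ D0 D1) as T1. pose proof (H3 _ _ D0 D2) as T2.
    destruct (H2 _ D0) as [_ Bp].
    set (v := phi' (rho * w)%C) in *.
    destruct (cis_taylor eta ltac:(lra)) as [C1 C2].
    replace (RtoC (rho + h)%R * w - rho * w)%C with (RtoC h * w)%C in T1 by (rewrite RtoC_plus; ring).
    replace (rho * (w * cis eta) - rho * w)%C with (rho * w * (cis eta - 1))%C in T2 by ring.
    rewrite !Cmod_mult, Hw, Cmod_R, Rabs_pos_eq, Rmult_1_r in T1 by lra.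
    rewrite !Cmod_mult, Hw, Cmod_R, Rabs_pos_eq, Rmult_1_r in T2 by lra.
    assert (Nz1 : RtoC rho <> 0) by (apply RtoC_neq; lra).
    assert (Nz2 : RtoC eta <> 0) by (apply RtoC_neq; lra).
    assert (NzI : Ci <> 0) by exact Ci_nz.
    replace (phi (RtoC (rho + h)%R * w) - phi (rho * w) - c * psi w)%C with
      ((phi (RtoC (rho + h)%R * w) - phi (rho * w) - v * (RtoC h * w)) -
       c * ((phi (rho * (w * cis eta)) - phi (rho * w) - v * (rho * w * (cis eta - 1))) +
            v * (rho * w) * (cis eta - 1 - Ci * eta)))%C.
    2: { unfold c, psi. field. repeat split; auto. }
    eapply Rle_trans; [apply (Cmod_triangle _ (- _))|]. rewrite Cmod_opp, Cmod_mult.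
    apply Rplus_le_compat; [exact T1|].
    assert (Hcm : Cmod c = h / (rho * eta)).
    { unfold c. rewrite Cmod_div by (repeat apply Cmult_neq_0; auto).
      rewrite !Cmod_mult, Cmod_Ci, !Cmod_R, !Rabs_pos_eq by lra. field; lra. }
    rewrite Hcm.
    assert (Hb : Cmod ((phi (rho * (w * cis eta)) - phi (rho * w) - v * (rho * w * (cis eta - 1))) +
            v * (rho * w) * (cis eta - 1 - Ci * eta))%C <= (4 * B * R ^ 2 + 2 * B * R) * eta ^ 2).
    { eapply Rle_trans; [apply Cmod_triangle|]. rewrite !Cmod_mult, Hw, Cmod_R, Rabs_pos_eq by lra.
      assert (q1 : Cmod (phi (rho * (w * cis eta)) - phi (rho * w) - v * (rho * w * (cis eta - 1)))%C <= B * (R * (2 * eta)) ^ 2).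
      { eapply Rle_trans; [exact T2|]. apply Rmult_le_compat_l; auto.
        apply pow_incr; split; [apply Rmult_le_pos; [lra|apply Cmod_ge_0]|].
        apply Rmult_le_compat; auto; [lra|apply Cmod_ge_0|lra]. }
      assert (q2 : Cmod v * (rho * 1) * Cmod (cis eta - 1 - Ci * eta) <= B * R * (2 * eta ^ 2)).
      { apply Rmult_le_compat; auto.
        - apply Rmult_le_pos; [apply Cmod_ge_0|lra].
        - apply Cmod_ge_0.
        - apply Rmult_le_compat; auto; [apply Cmod_ge_0|lra|lra]. }
      replace ((4 * B * R ^ 2 + 2 * B * R) * eta ^ 2) with (B * (R * (2 * eta)) ^ 2 + B * R * (2 * eta ^ 2)) by ring.
      lra. }
    assert (Hcc : 0 <= h / (rho * eta)) by (apply Rle_mult_inv_pos; auto; apply Rmult_lt_0_compat; lra).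
    eapply Rle_trans; [apply Rmult_le_compat_l; [exact Hcc|exact Hb]|].
    replace (h / (rho * eta) * ((4 * B * R ^ 2 + 2 * B * R) * eta ^ 2)) with
      (h / rho * ((4 * B * R ^ 2 + 2 * B * R) * eta)) by (field; lra).
    apply Rmult_le_compat_r.
    { apply Rmult_le_pos; [|lra]. pose proof (pow_le R 2 ltac:(lra)).
      assert (0 <= B * R ^ 2) by (apply Rmult_le_pos; auto).
      assert (0 <= B * R) by (apply Rmult_le_pos; lra). lra. }
    apply Rmult_le_compat_l; auto. apply Rinv_le_contravar; lra. }
  (* [N] steps of length [h = (R - r0) / N], each with an error of order [1 / N^2], leave a total
     error of order [1 / N]. *)
  assert (Iter : forall n, (n <= N)%nat -> Cmod (A (r0 + INR n * h)%R - A r0) <=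
    INR n * (B * h ^ 2 + h / r0 * ((4 * B * R ^ 2 + 2 * B * R) * eta))).
  { induction n; intros Hn.
    - simpl (INR 0). rewrite !Rmult_0_l, Rplus_0_r.
      replace (A r0 - A r0)%C with (RtoC 0) by ring. rewrite Cmod_0; lra.
    - specialize (IHn ltac:(lia)). rewrite S_INR.
      replace (r0 + (INR n + 1) * h) with (r0 + INR n * h + h) by ring.
      assert (Hn1 : 0 <= INR n * h) by (apply Rmult_le_pos; [apply pos_INR|auto]).
      assert (Hn2 : (INR n + 1) * h <= INR N * h).
      { apply Rmult_le_compat_r; auto. rewrite <- S_INR. apply le_INR; lia. }
      specialize (Step (r0 + INR n * h) ltac:(lra) ltac:(lra)).
      replace (A (r0 + INR n * h + h)%R - A r0)%C with
        ((A (r0 + INR n * h + h)%R - A (r0 + INR n * h)%R) + (A (r0 + INR n * h)%R - A r0))%C by ring.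
      eapply Rle_trans; [apply Cmod_triangle|]. lra. }
  specialize (Iter N ltac:(lia)). rewrite HhN in Iter.
  replace (r0 + (R - r0)) with R in Iter by ring.
  eapply Rle_trans; [exact Iter|]. right. unfold K1, h, eta. field. lra.
Qed.

Lemma summ_mult a b : summ a -> summ b ->
  summ (fun n => csum (fun k => Cmult (a k) (b (n - k)%nat)) (S n)).
Proof.
  intros Ha Hb.
  pose proof (is_series_mult_pos _ _ _ _ (Series_correct _ Ha) (Series_correct _ Hb)
    (fun n => Cmod_ge_0 (a n)) (fun n => Cmod_ge_0 (b n))) as H.
  eapply summ_le; [|eexists; exact H].
  intros n; cbv beta. rewrite sum_f_R0_rsum.
  eapply Rle_trans; [apply Cmod_csum|]. right; apply rsum_ext; intros; apply Cmod_mult.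
Qed.

Lemma Udiff_id R : 0 <= R -> Udiff (fun z => Cmod z <= R) (fun z => z) (fun _ => RtoC 1).
Proof.
  intros HR. exists (R + 1). split; [lra|]. split.
  - intros z Hz. rewrite Cmod_1. lra.
  - intros z w _ _. replace (w - z - 1 * (w - z))%C with (RtoC 0) by ring. rewrite Cmod_0.
    apply Rmult_le_pos; [lra|apply pow_le, Cmod_ge_0].
Qed.

Lemma Udiff_const D c : Udiff D (fun _ => c) (fun _ => RtoC 0).
Proof.
  exists (Cmod c). split; [apply Cmod_ge_0|]. split.
  - intros z _. rewrite Cmod_0. split; [lra|apply Cmod_ge_0].
  - intros z w _ _. replace (c - c - 0 * (w - z))%C with (RtoC 0) by ring. rewrite Cmod_0.
    apply Rmult_le_pos; [apply Cmod_ge_0|apply pow_le, Cmod_ge_0].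
Qed.

Lemma Udiff_pow D f f' d k : (forall z w, D z -> D w -> Cmod (w - z) <= d) -> Udiff D f f' ->
  exists g', Udiff D (fun z => Cpow (f z) k) g'.
Proof.
  intros Hd Hf. induction k.
  - exists (fun _ => RtoC 0). apply (Udiff_const D 1).
  - destruct IHk as [g' Hg']. eexists. simpl.
    apply (Udiff_mult D f f' (fun z => Cpow (f z) k) g' d); auto.
Qed.

Lemma disc_diam R : forall z w, Cmod z <= R -> Cmod w <= R -> Cmod (w - z) <= 2 * R.
Proof.
  intros z w Hz Hw. eapply Rle_trans; [apply (Cmod_triangle w (- z))|]. rewrite Cmod_opp. lra.
Qed.

(* If [PS f] has no zero in [|z| < R] and [Re (PS g) = ln |PS f|] near [0], then this remains true
   in [|z| < R]: the coefficients of [g'] are the averages of [z^-k f'/f] over any circle. *)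
Section LogExtension.

Variables (f g : nat -> C) (r B rho B0 R : R).
Hypothesis Hf : pbd f r B.
Hypothesis HR : 0 < R <= r.
Hypothesis Hg : pbd g rho B0.
Hypothesis Hrho : 0 < rho.
Hypothesis Hnz : forall z, Cmod z < R -> PS f z <> 0.
Hypothesis Heq : forall z, Cmod z < rho -> ln (Cmod (PS f z)) = Re (PS g z).

Let r2 := Rmin rho R / 2.
Let r1 := Rmin rho R / 4.

Local Lemma r12 : 0 < r1 < r2 /\ r2 < rho /\ r2 < R.
Proof.
  unfold r1, r2. pose proof (Rmin_l rho R). pose proof (Rmin_r rho R).
  assert (0 < Rmin rho R) by (apply Rmin_glb_lt; lra). lra.
Qed.

Local Lemma small_deriv z : Cmod z < r2 -> PS (dco f) z = Cmult (PS f z) (PS (dco g) z).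
Proof.
  intros Hz. destruct r12 as [? [? ?]].
  apply (log_deriv_eq (PS f) (PS (dco f)) (PS g) (PS (dco g)) r2); auto.
  - eapply PS_Udiff; eauto; lra.
  - eapply PS_Udiff; eauto; lra.
  - intros; apply Hnz; lra.
  - intros; apply Heq; lra.
Qed.

Local Lemma min_mod R' : 0 < R' < R -> exists m, 0 < m /\ forall z, Cmod z <= R' -> m <= Cmod (PS f z).
Proof.
  intros HR'.
  assert (U : Udiff (fun z => Cmod z <= R') (PS f) (PS (dco f))) by (eapply PS_Udiff; eauto; lra).
  destruct (Udiff_lip _ _ _ (2 * R') U) as [L [HL HL2]]; [apply disc_diam|].
  apply (disc_min_modulus (PS f) R' L); auto. intros; apply Hnz; lra.
Qed.

(** The error in [discrete_Cauchy] depends on [k] but disappears when [N] grows with [k] fixed. What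
    survives is the bound [(b / m) R'^-k], from [|f'| <= b] and [|f| >= m] on the outer circle, with
    [b / m] independent of [k]. *)
Local Lemma log_radius_aux R' : r1 < R' < R -> exists B', pbd (dco g) R' B'.
Proof.
  intros HR'. destruct r12 as [? [? ?]].
  destruct (min_mod R' ltac:(lra)) as [m [Hm Hm2]].
  set (R2 := (R' + R) / 2).
  destruct (pbd_dco f r B R2 Hf ltac:(unfold R2; lra)) as [B1 HB1].
  assert (Uf : Udiff (fun z => Cmod z <= R') (PS f) (PS (dco f))) by (eapply PS_Udiff; eauto; lra).
  assert (Uf' : Udiff (fun z => Cmod z <= R') (PS (dco f)) (PS (dco (dco f)))).
  { eapply PS_Udiff; eauto; unfold R2; lra. }
  assert (Bf' : exists b, 0 <= b /\ forall z, Cmod z <= R' -> Cmod (PS (dco f) z) <= b).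
  { destruct Uf' as [b [Hb [Hb2 _]]]. exists b. split; auto. intros w Hw; exact (proj1 (Hb2 w Hw)). }
  destruct Bf' as [b [Hb Hb2]].
  exists (b / m). intros k.
  (* The annulus keeps away from [0], where [z^-k] is unbounded. *)
  set (Ann := fun z => r1 <= Cmod z <= R').
  assert (Hdiam : forall z w, Ann z -> Ann w -> Cmod (w - z) <= 2 * R').
  { intros z w [_ Hz] [_ Hw]; apply disc_diam; auto. }
  assert (HAnn : forall z, Ann z -> Cmod z <= R') by (intros z [_ Hz]; auto).
  assert (Uinv : exists g', Udiff Ann (fun z => Cpow (Cinv z) k) g').
  { eapply Udiff_pow; [exact Hdiam|].
    apply (Udiff_inv Ann (fun z => z) (fun _ => RtoC 1) r1 (2 * R')); auto; [lra| |].
    - apply (Udiff_sub (fun z => Cmod z <= R')); auto. apply Udiff_id; lra.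
    - intros z [Hz _]; auto. }
  destruct Uinv as [g' Uinv].
  assert (Uq : exists q', Udiff Ann (fun z => Cmult (Cmult (PS (dco f) z) (Cinv (PS f z))) (Cpow (Cinv z) k)) q').
  { eexists. eapply Udiff_mult; [exact Hdiam| |exact Uinv].
    eapply Udiff_mult; [exact Hdiam| |].
    - eapply Udiff_sub; [|exact Uf']; auto.
    - apply (Udiff_inv Ann (PS f) (PS (dco f)) m (2 * R')); auto.
      eapply Udiff_sub; [|exact Uf]; auto. }
  destruct Uq as [q' Uq].
  destruct (discrete_Cauchy _ _ r1 R' ltac:(lra) Uq) as [K HK].
  set (phi := fun z => Cmult (Cmult (PS (dco f) z) (Cinv (PS f z))) (Cpow (Cinv z) k)) in *.
  assert (Hinv : forall s N j, 0 < s -> Cinv (Cmult (RtoC s) (rt N j)) = Cmult (RtoC (/ s)) (Cconj (rt N j))).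
  { intros s N j Hs. rewrite RtoC_inv by lra.
    assert (N1 : RtoC s <> 0) by (apply RtoC_neq; lra).
    assert (N2 : rt N j <> 0) by (apply Cmod_gt_0; rewrite Cmod_rt; lra).
    replace (Cconj (rt N j)) with (Cmult (/ rt N j) (rt N j * Cconj (rt N j))) by (field; auto).
    rewrite rt_conj. field; auto. }
  destruct (pbd_dco g rho B0 r2 Hg ltac:(lra)) as [B2 HB2].
  assert (Sg : summ (fun n => Cmult (dco g n) (Cpow r1 n))).
  { eapply PS_summ; [exact HB2|]. rewrite Cmod_R, Rabs_pos_eq; lra. }
  (* On the inner circle [f' = f * g'] is already known, so the function averaged is [g' z^-k]. *)
  assert (L1 : Clim (fun N => avg N (fun w => phi (Cmult r1 w))) (dco g k)).
  { pose proof (coef_avg (dco g) r1 k ltac:(lra) Sg) as L.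
    apply (Clim_mult _ _ _ _ (Clim_const (Cpow (RtoC (/ r1)) k))) in L.
    replace (Cpow (RtoC (/ r1)%R) k * (dco g k * Cpow r1 k))%C with (dco g k) in L.
    2: { rewrite RtoC_inv by lra.
         rewrite (Cmult_comm (dco g k)), Cmult_assoc, <- Cpow_mult_l, Cinv_l, Cpow_1_l; [ring|].
         apply RtoC_neq; lra. }
    eapply Clim_ext; [|exact L]. intros N. cbv beta. rewrite <- avg_scal.
    apply avg_ext; intros j. unfold phi.
    assert (Hc : Cmod (r1 * rt N j) = r1) by (rewrite Cmod_mult, Cmod_rt, Cmod_R, Rabs_pos_eq; lra).
    rewrite small_deriv by lra. rewrite Hinv by lra. rewrite Cpow_mult_l.
    assert (Nz : PS f (r1 * rt N j) <> 0) by (apply Hnz; lra).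
    field; auto. }
  assert (L2 : Clim (fun N => avg N (fun w => phi (Cmult R' w))) (dco g k)).
  { replace (dco g k) with (dco g k + 0)%C by ring.
    apply (Clim_ext (fun N => Cplus (avg N (fun w => phi (Cmult r1 w)))
       (avg N (fun w => phi (Cmult R' w)) - avg N (fun w => phi (Cmult r1 w))))); [intros; ring|].
    apply Clim_plus; auto. apply Clim_Cmod.
    apply (is_lim_seq_le_le_loc (fun _ => 0) _ (fun N => K * / INR N)).
    - exists 1%nat. intros N HN. split; [apply Cmod_ge_0|].
      replace (avg N (fun w : C => phi (R' * w)%C) - avg N (fun w : C => phi (r1 * w)%C) - 0)%C
        with (avg N (fun w : C => phi (R' * w)%C) - avg N (fun w : C => phi (r1 * w)%C))%C by ring.
      apply HK; lia.
    - apply is_lim_seq_const.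
    - replace (Finite 0) with (Rbar_mult (Finite K) (Finite 0)) by (simpl; f_equal; ring).
      apply is_lim_seq_scal_l.
      apply (is_lim_seq_inv INR p_infty); [apply is_lim_seq_INR|discriminate]. }
  assert (Hfin : Cmod (dco g k) <= b / m * (/ R') ^ k).
  { apply (Clim_bound (fun N => avg N (fun w => phi (Cmult R' w)))); auto.
    assert (Hp1 : 0 <= / m) by (apply Rlt_le, Rinv_0_lt_compat; auto).
    assert (Hp2 : 0 <= (/ R') ^ k) by (apply pow_le, Rlt_le, Rinv_0_lt_compat; lra).
    intros N; apply avg_bound.
    - apply Rmult_le_pos; auto. apply Rmult_le_pos; auto.
    - intros j. unfold phi.
      assert (Hc : Cmod (R' * rt N j) = R') by (rewrite Cmod_mult, Cmod_rt, Cmod_R, Rabs_pos_eq; lra).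
      rewrite Hinv by lra. rewrite !Cmod_mult, Cmod_pow, Cmod_mult, Cmod_conj, Cmod_rt, Rmult_1_r.
      rewrite Cmod_R, (Rabs_pos_eq (/ R')) by (apply Rlt_le, Rinv_0_lt_compat; lra).
      rewrite Cmod_inv by (apply Hnz; lra).
      apply Rmult_le_compat_r; auto. apply Rmult_le_compat; auto.
      + apply Cmod_ge_0.
      + apply Rlt_le, Rinv_0_lt_compat, Cmod_gt_0, Hnz; lra.
      + apply Hb2; lra.
      + apply Rinv_le_contravar; auto. apply Hm2; lra. }
  assert (HRk : 0 < R' ^ k) by (apply pow_lt; lra).
  apply Rmult_le_reg_r with (/ R' ^ k); [apply Rinv_0_lt_compat; auto|].
  rewrite Rmult_assoc, Rinv_r, Rmult_1_r by lra. rewrite <- pow_inv. exact Hfin.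
Qed.

Lemma log_radius R' : 0 < R' < R -> exists B', pbd g R' B'.
Proof.
  intros HR'. destruct r12 as [? [? ?]].
  set (R1 := Rmax R' r2).
  assert (H12 : R' <= R1 /\ r2 <= R1 /\ R1 < R).
  { unfold R1; repeat split; [apply Rmax_l|apply Rmax_r|apply Rmax_lub_lt; lra]. }
  destruct (log_radius_aux R1 ltac:(lra)) as [B' HB'].
  exists (Rmax (Cmod (g 0%nat)) (B' * R1)).
  apply (pbd_mono g R1); [|lra].
  intros [|k].
  - simpl. rewrite Rmult_1_r. apply Rmax_l.
  - eapply Rle_trans; [|apply Rmax_r].
    specialize (HB' k). unfold dco in HB'. rewrite Cmod_mult, Cmod_R, Rabs_pos_eq in HB' by apply pos_INR.
    simpl (R1 ^ S k). replace (Cmod (g (S k)) * (R1 * R1 ^ k)) with (Cmod (g (S k)) * R1 ^ k * R1) by ring.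
    apply Rmult_le_compat_r; [lra|]. eapply Rle_trans; [|exact HB'].
    rewrite Rmult_assoc.
    assert (0 <= Cmod (g (S k)) * R1 ^ k) by (apply Rmult_le_pos; [apply Cmod_ge_0|apply pow_le; lra]).
    rewrite S_INR. pose proof (pos_INR k). nra.
Qed.

(** Near [0], [f' = f * g'] is an identity between coefficients, so it persists wherever the series
    converge; [ln_const] then carries the equality of logarithms from [0] to [z]. *)
Lemma log_extend z : Cmod z < R -> ln (Cmod (PS f z)) = Re (PS g z).
Proof.
  intros Hz. destruct r12 as [? [? ?]].
  set (R0 := Rmax (Cmod z) r2).
  assert (HR0 : Cmod z <= R0 /\ r2 <= R0 /\ R0 < R).
  { unfold R0; repeat split; [apply Rmax_l|apply Rmax_r|apply Rmax_lub_lt; lra]. }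
  set (R1 := (2 * R0 + R) / 3). set (R2 := (R0 + 2 * R) / 3).
  assert (H12 : R0 < R1 /\ R1 < R2 /\ R2 < R) by (unfold R1, R2; lra).
  set (R3 := (R2 + R) / 2).
  assert (HR3 : R2 < R3 < R) by (unfold R3; lra).
  destruct (log_radius R3 ltac:(lra)) as [B3 HB3].
  destruct (pbd_dco g R3 B3 R2 HB3 ltac:(lra)) as [B4 HB4].
  destruct (pbd_dco f r B R2 Hf ltac:(lra)) as [B5 HB5].
  assert (Hf2 : pbd f R2 B) by (eapply pbd_mono; eauto; lra).
  assert (Conv : forall k, csum (fun i => Cmult (f i) (dco g (k - i)%nat)) (S k) = dco f k).
  { apply (PS_unique _ _ r1); [lra| | |].
    - assert (Ha : summ (fun n => Cmult (f n) (Cpow r1 n))).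
      { eapply PS_summ; [exact Hf|]. rewrite Cmod_R, Rabs_pos_eq; lra. }
      assert (Hb : summ (fun n => Cmult (dco g n) (Cpow r1 n))).
      { eapply PS_summ; [exact HB4|]. rewrite Cmod_R, Rabs_pos_eq; lra. }
      eapply summ_ext; [|exact (summ_mult _ _ Ha Hb)].
      intros n. cbv beta. rewrite (Cmult_comm (csum _ _)), <- csum_scal. apply csum_ext; intros i Hi.
      replace n with (i + (n - i))%nat at 3 by lia. rewrite Cpow_add_r. ring.
    - eapply PS_summ; [exact HB5|]. rewrite Cmod_R, Rabs_pos_eq; lra.
    - intros w Hw. rewrite (PS_conv f (dco g) R2 B B4); auto; [|lra].
      symmetry; apply small_deriv; lra. }
  assert (E : ln (Cmod (PS f z)) - Re (PS g z) = ln (Cmod (PS f 0)) - Re (PS g 0)).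
  { apply (ln_const (PS f) (PS (dco f)) (PS g) (PS (dco g)) R1).
    - eapply PS_Udiff; eauto; pose proof (Cmod_ge_0 z); lra.
    - eapply PS_Udiff; [exact HB3|]. pose proof (Cmod_ge_0 z); lra.
    - lra.
    - intros; apply Hnz; lra.
    - intros w Hw. rewrite <- (PS_conv f (dco g) R2 B B4); auto; [|lra].
      apply PS_ext; intros; symmetry; apply Conv. }
  rewrite (Heq 0) in E by (rewrite Cmod_0; auto). lra.
Qed.

Lemma log_coef_bound M R' k : (forall z, Cmod z < R -> ln (Cmod (PS f z)) <= M) -> 0 < R' < R ->
  (0 < k)%nat -> Cmod (g k) * R' ^ k <= 2 * (M - Re (g 0%nat)).
Proof.
  intros HM HR' Hk.
  destruct (log_radius ((R' + R) / 2) ltac:(lra)) as [B3 HB3].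
  apply Borel_Caratheodory; auto; [lra| |].
  - eapply PS_summ; [exact HB3|]. rewrite Cmod_R, Rabs_pos_eq; lra.
  - intros z Hz. rewrite <- log_extend by lra. apply HM; lra.
Qed.

End LogExtension.

(** * Exponential, logarithm and Poisson sums *)

Definition cexp (z : C) : C := (exp (Re z) * cos (Im z), exp (Re z) * sin (Im z)).

Lemma cexp_add a b : cexp (a + b) = Cmult (cexp a) (cexp b).
Proof.
  apply C_eq; unfold cexp; rewrite ?Re_mult, ?Im_mult;
    change (Re (a + b)) with (Re a + Re b); change (Im (a + b)) with (Im a + Im b); simpl;
    change (fst a) with (Re a); change (fst b) with (Re b);
    change (snd a) with (Im a); change (snd b) with (Im b).
  - rewrite exp_plus, cos_plus. ring.
  - rewrite exp_plus, sin_plus. ring.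
Qed.

Lemma cexp_0 : cexp 0 = RtoC 1.
Proof. apply C_eq; simpl; rewrite exp_0, ?cos_0, ?sin_0; ring. Qed.

Lemma cexp_cis z : cexp z = Cmult (RtoC (exp (Re z))) (cis (Im z)).
Proof. apply C_eq; simpl; ring. Qed.

Lemma Cmod_cexp z : Cmod (cexp z) = exp (Re z).
Proof.
  rewrite cexp_cis, Cmod_mult, Cmod_cis, Cmod_R, Rabs_pos_eq, Rmult_1_r; auto.
  apply Rlt_le, exp_pos.
Qed.

Definition expco (k : nat) : C := RtoC (/ INR (fact k)).

Lemma pow_fact_le_exp x k : 0 <= x -> x ^ k / INR (fact k) <= exp x.
Proof.
  intros Hx. eapply Rle_trans; [|apply (exp_ge_taylor x k Hx)].
  rewrite sum_f_R0_rsum. simpl rsum.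
  assert (0 <= rsum (fun j => x ^ j / INR (fact j)) k); [|lra].
  apply rsum_ge_0. intros i. apply Rle_mult_inv_pos; [apply pow_le; auto|apply INR_fact_lt_0].
Qed.

Lemma expco_bd r : 0 <= r -> pbd expco r (exp r).
Proof.
  intros Hr k. unfold expco. rewrite Cmod_R, Rabs_pos_eq.
  - rewrite Rmult_comm. apply pow_fact_le_exp; auto.
  - apply Rlt_le, Rinv_0_lt_compat, INR_fact_lt_0.
Qed.

Lemma dco_expco k : dco expco k = expco k.
Proof.
  unfold dco, expco. rewrite <- RtoC_mult. f_equal.
  rewrite fact_simpl, mult_INR. field. split; [apply INR_fact_neq_0|apply not_0_INR; lia].
Qed.

(* [t |-> PS expco (t z) * cexp (- t z)] has zero derivative on [0, 1]. *)
Lemma cexp_PS z : PS expco z = cexp z.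
Proof.
  set (R1 := Cmod z + 1).
  assert (Hz := Cmod_ge_0 z).
  assert (U : Udiff (fun w => Cmod w <= R1) (PS expco) (PS (dco expco))).
  { apply (PS_Udiff expco (R1 + 1) (exp (R1 + 1))); [apply expco_bd|]; unfold R1; lra. }
  set (d := / (Cmod z + 1)).
  assert (Hd : 0 < d) by (apply Rinv_0_lt_compat; lra).
  assert (HD : forall t, 0 <= t <= 1 -> forall s, Rabs (s - t) < d -> Cmod (0 + RtoC s * z) <= R1).
  { intros t Ht s Hs. rewrite Cplus_0_l, Cmod_mult, Cmod_R.
    assert (Rabs s <= 1 + d).
    { replace s with (t + (s - t)) by ring. eapply Rle_trans; [apply Rabs_triang|].
      rewrite (Rabs_pos_eq t); lra. }
    eapply Rle_trans; [apply Rmult_le_compat_r; [auto|exact H]|].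
    assert (d * (Cmod z + 1) = 1) by (unfold d; field; lra). unfold R1. nra. }
  set (x := Re z). set (y := Im z).
  set (er := fun s => Re (PS expco (0 + RtoC s * z)%C)).
  set (ei := fun s => Im (PS expco (0 + RtoC s * z)%C)).
  assert (Der : forall t, 0 <= t <= 1 ->
    is_derive er t (er t * x - ei t * y) /\ is_derive ei t (er t * y + ei t * x)).
  { intros t Ht.
    destruct (Udiff_path _ _ _ 0 z t d U Hd (HD t Ht)) as [H1 H2].
    rewrite (PS_ext (dco expco) expco) in H1, H2 by apply dco_expco.
    rewrite Re_mult in H1. rewrite Im_mult in H2. split; [exact H1|exact H2]. }
  set (ur := fun t => er t * (exp (- (t * x)) * cos (t * y)) + ei t * (exp (- (t * x)) * sin (t * y))).
  set (ui := fun t => ei t * (exp (- (t * x)) * cos (t * y)) - er t * (exp (- (t * x)) * sin (t * y))).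
  assert (Dur : forall t, 0 <= t <= 1 -> is_derive ur t 0).
  { intros t Ht. destruct (Der t Ht) as [H1 H2].
    clearbody er ei. unfold ur. clear ur ui.
    assert (E1 : ex_derive er t) by (eexists; exact H1).
    assert (E2 : ex_derive ei t) by (eexists; exact H2).
    auto_derive; [repeat split; auto|].
    replace (Derive (fun x => er x) t) with (er t * x - ei t * y) by (symmetry; apply is_derive_unique; exact H1).
    replace (Derive (fun x => ei x) t) with (er t * y + ei t * x) by (symmetry; apply is_derive_unique; exact H2).
    ring. }
  assert (Dui : forall t, 0 <= t <= 1 -> is_derive ui t 0).
  { intros t Ht. destruct (Der t Ht) as [H1 H2].
    clearbody er ei. unfold ui. clear ur ui Dur.
    assert (E1 : ex_derive er t) by (eexists; exact H1).
    assert (E2 : ex_derive ei t) by (eexists; exact H2).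
    auto_derive; [repeat split; auto|].
    replace (Derive (fun x => er x) t) with (er t * x - ei t * y) by (symmetry; apply is_derive_unique; exact H1).
    replace (Derive (fun x => ei x) t) with (er t * y + ei t * x) by (symmetry; apply is_derive_unique; exact H2).
    ring. }
  assert (Cst : forall u : R -> R, (forall t, 0 <= t <= 1 -> is_derive u t 0) -> u 1 = u 0).
  { intros u Hu. destruct (MVT_gen u 0 1 (fun _ => 0)) as [c [_ Hc]].
    - intros s Hs; rewrite Rmin_left, Rmax_right in Hs by lra. apply Hu; lra.
    - intros s Hs; rewrite Rmin_left, Rmax_right in Hs by lra.
      apply continuity_pt_filterlim. apply (ex_derive_continuous u). exists 0. apply Hu; lra.
    - lra. }
  apply Cst in Dur. apply Cst in Dui.
  assert (Z0 : er 0 = 1 /\ ei 0 = 0).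
  { unfold er, ei. replace (0 + RtoC 0 * z)%C with (RtoC 0) by ring. rewrite PS_0.
    unfold expco; simpl. split; [field|auto]. }
  destruct Z0 as [Z1 Z2].
  unfold ur in Dur. unfold ui in Dui.
  rewrite Z1, Z2, !Rmult_0_l, !Rmult_1_l, Ropp_0, exp_0, cos_0, sin_0 in *.
  assert (Ee : exp (- x) * exp x = 1) by (rewrite <- exp_plus, Rplus_opp_l, exp_0; auto).
  assert (Ec : cos y * cos y + sin y * sin y = 1) by (pose proof (sin2_cos2 y); unfold Rsqr in *; lra).
  assert (Q1 : er 1 = exp x * cos y).
  { replace (er 1) with (exp x * (cos y * (er 1 * (exp (- x) * cos y) + ei 1 * (exp (- x) * sin y)) -
      sin y * (ei 1 * (exp (- x) * cos y) - er 1 * (exp (- x) * sin y)))).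
    - rewrite Dur, Dui. ring.
    - transitivity (er 1 * (exp (- x) * exp x) * (cos y * cos y + sin y * sin y)); [ring|].
      rewrite Ee, Ec. ring. }
  assert (Q2 : ei 1 = exp x * sin y).
  { replace (ei 1) with (exp x * (sin y * (er 1 * (exp (- x) * cos y) + ei 1 * (exp (- x) * sin y)) +
      cos y * (ei 1 * (exp (- x) * cos y) - er 1 * (exp (- x) * sin y)))).
    - rewrite Dur, Dui. ring.
    - transitivity (ei 1 * (exp (- x) * exp x) * (cos y * cos y + sin y * sin y)); [ring|].
      rewrite Ee, Ec. ring. }
  unfold er, ei in Q1, Q2. replace (0 + RtoC 1 * z)%C with z in Q1, Q2 by ring.
  apply C_eq; [rewrite Q1|rewrite Q2]; reflexivity.
Qed.

Lemma cpow_neg_cexp n s : cpow_neg n s = cexp (- (s * RtoC (ln (INR n)))).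
Proof.
  unfold cpow_neg, cexp. generalize (ln (INR n)) as t. intros t. destruct s as [a b]. simpl.
  replace (- (a * t - b * 0)) with (- a * t) by ring.
  replace (- (a * 0 + b * t)) with (- (b * t)) by ring.
  rewrite cos_neg, sin_neg. f_equal; ring.
Qed.

Lemma Cmod_cpow_neg n s : Cmod (cpow_neg n s) = exp (- Re s * ln (INR n)).
Proof.
  rewrite cpow_neg_cexp, Cmod_cexp. f_equal. generalize (ln (INR n)) as t.
  intros t; destruct s as [a b]; simpl; ring.
Qed.

Lemma cpow_neg_mult n m s : (0 < n)%nat -> (0 < m)%nat ->
  cpow_neg (n * m) s = Cmult (cpow_neg n s) (cpow_neg m s).
Proof.
  intros Hn Hm. rewrite !cpow_neg_cexp, <- cexp_add, mult_INR, ln_mult; try (apply lt_0_INR; lia).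
  f_equal. rewrite RtoC_plus. ring.
Qed.

Lemma cpow_neg_1 s : cpow_neg 1 s = RtoC 1.
Proof.
  rewrite cpow_neg_cexp. simpl INR. rewrite ln_1.
  replace (- (s * 0))%C with (RtoC 0) by ring. apply cexp_0.
Qed.

Lemma CSer_geom z : Cmod z < 1 -> summ (fun k => Cpow z k) /\ CSer (fun k => Cpow z k) = Cinv (1 - z).
Proof.
  intros Hz.
  assert (Hs : summ (fun k => Cpow z k)).
  { apply (summ_ext (fun k => Cmult 1 (Cpow z k))); [intros; ring|].
    apply (PS_summ (fun _ => RtoC 1) 1 1); auto.
    intros k; rewrite Cmod_1, pow1; lra. }
  split; auto.
  assert (E : CSer (fun k => Cpow z k) = (1 + z * CSer (fun k => Cpow z k))%C).
  { rewrite (CSer_split _ 1 Hs) at 1. simpl csum. rewrite <- CSer_scal; auto.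
    rewrite (CSer_ext (fun k => Cpow z (1 + k)) (fun k => Cmult z (Cpow z k))) by (intros; reflexivity). ring. }
  assert (N : (1 - z)%C <> 0).
  { apply Cminus_eq_contra. intros H. rewrite <- H, Cmod_1 in Hz. lra. }
  set (S := CSer (fun k => Cpow z k)) in *.
  replace S with ((S - z * S) / (1 - z))%C by (field; auto).
  rewrite E at 1. field; auto.
Qed.

(** Taylor coefficients of [log (1 - z)] at [0]. *)
Definition lgco (k : nat) : C := match k with O => RtoC 0 | S j => RtoC (- / INR (S j)) end.

Lemma lgco_bd : pbd lgco 1 1.
Proof.
  intros [|k]; simpl; rewrite ?Cmod_0; [lra|].
  rewrite pow1, Rmult_1_l, Rmult_1_r, Cmod_R, Rabs_Ropp.
  change (match k with O => 1 | S _ => INR k + 1 end) with (INR (S k)).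
  rewrite S_INR. pose proof (pos_INR k).
  rewrite Rabs_pos_eq by (apply Rlt_le, Rinv_0_lt_compat; lra).
  rewrite <- Rinv_1. apply Rinv_le_contravar; lra.
Qed.

Lemma ln_one_minus z : Cmod z < 1 -> ln (Cmod (1 - z)) = Re (PS lgco z).
Proof.
  intros Hz. set (R1 := (Cmod z + 1) / 2).
  assert (HR1 : Cmod z < R1 < 1) by (unfold R1; lra).
  assert (Hp := Cmod_ge_0 z).
  assert (E : ln (Cmod (1 - z)) - Re (PS lgco z) = ln (Cmod (1 - 0)) - Re (PS lgco 0)).
  { apply (ln_const (fun z => Cminus 1 z) (fun _ => RtoC (-1)) (PS lgco) (PS (dco lgco)) R1).
    - exists (1 + R1). split; [lra|]. split.
      + intros w Hw. split.
        * eapply Rle_trans; [apply (Cmod_triangle 1 (- w))|]. rewrite Cmod_opp, Cmod_1. lra.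
        * rewrite Cmod_R, Rabs_left; lra.
      + intros v w _ _. replace (1 - w - (1 - v) - -1 * (w - v))%C with (RtoC 0) by ring.
        rewrite Cmod_0. apply Rmult_le_pos; [lra|apply pow_le, Cmod_ge_0].
    - apply (PS_Udiff _ 1 1); [apply lgco_bd|lra].
    - lra.
    - intros w Hw. apply Cminus_eq_contra. intros H. rewrite <- H, Cmod_1 in Hw. lra.
    - intros w Hw.
      destruct (CSer_geom w ltac:(lra)) as [Hs He].
      assert (E : PS (dco lgco) w = (-1 * CSer (fun k => Cpow w k))%C).
      { rewrite <- CSer_scal; auto. apply CSer_ext; intros k. f_equal.
        unfold dco, lgco. rewrite <- RtoC_mult. f_equal. field. apply not_0_INR; lia. }
      rewrite E, He. field. apply Cminus_eq_contra. intros H. rewrite <- H, Cmod_1 in Hw. lra. }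
  replace (1 - 0)%C with (RtoC 1) in E by ring. rewrite Cmod_1, ln_1, PS_0 in E.
  simpl (Re (lgco 0)) in E. lra.
Qed.

(** Terms of the series of [- log (1 - w)], indexed from the first power of [w]. *)
Definition lgterm (w : C) (m : nat) : C := Cmult (RtoC (/ INR (S m))) (Cpow w (S m)).

Lemma lgterm_bound w m : Cmod (lgterm w m) <= Cmod w ^ S m.
Proof.
  unfold lgterm. rewrite Cmod_mult, Cmod_pow, Cmod_R.
  assert (1 <= INR (S m)) by (rewrite S_INR; pose proof (pos_INR m); lra).
  rewrite Rabs_pos_eq by (apply Rlt_le, Rinv_0_lt_compat; lra).
  rewrite <- (Rmult_1_l (Cmod w ^ S m)) at 2.
  apply Rmult_le_compat_r; [apply pow_le, Cmod_ge_0|].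
  rewrite <- Rinv_1. apply Rinv_le_contravar; lra.
Qed.

Lemma geom_S_sum x : 0 <= x < 1 -> ex_series (fun m => x ^ S m) /\ Series (fun m => x ^ S m) = x / (1 - x).
Proof.
  intros Hx. assert (H : is_series (fun n => x ^ n) (/ (1 - x))).
  { apply is_series_geom. rewrite Rabs_pos_eq; lra. }
  pose proof (is_series_scal_l (V := R_NormedModule) x _ _ H) as H1.
  assert (H2 : is_series (fun m => x ^ S m) (x / (1 - x))).
  { eapply is_series_ext; [|exact H1]. intros; reflexivity. }
  split; [eexists; exact H2|apply is_series_unique; exact H2].
Qed.

Lemma lgterm_summ w : Cmod w < 1 -> summ (lgterm w).
Proof.
  intros Hw. apply (summ_le _ (fun m => Cmod w ^ S m)); [intros; apply lgterm_bound|].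
  apply geom_S_sum. split; auto; apply Cmod_ge_0.
Qed.

Lemma ln_series w : Cmod w < 1 -> - ln (Cmod (1 - w)) = Re (CSer (lgterm w)).
Proof.
  intros Hw. rewrite ln_one_minus; auto. unfold PS.
  assert (S1 : summ (fun k => Cmult (lgco k) (Cpow w k))) by (apply (PS_summ _ 1 1); [apply lgco_bd|auto]).
  rewrite (CSer_split _ 1 S1). simpl csum.
  rewrite (CSer_ext _ (fun k => Cmult (-1) (lgterm w k))).
  - rewrite CSer_scal by (apply lgterm_summ; auto).
    replace (0 + 0 * 1 + -1 * CSer (lgterm w))%C with (- CSer (lgterm w))%C by ring.
    change (Re (- CSer (lgterm w))) with (- Re (CSer (lgterm w))). ring.
  - intros k. unfold lgterm. change (1 + k)%nat with (S k). unfold lgco.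
    rewrite RtoC_opp. ring.
Qed.

Lemma exp_le x y : x <= y -> exp x <= exp y.
Proof. intros [H| ->]; [apply Rlt_le, exp_increasing; auto|lra]. Qed.

Definition pw (sigma : R) (n : nat) : R := exp (- sigma * ln (INR n)).

Lemma pw_pos s n : 0 < pw s n.
Proof. apply exp_pos. Qed.

Lemma pw_1 s : pw s 1 = 1.
Proof. unfold pw. simpl INR. rewrite ln_1, Rmult_0_r. apply exp_0. Qed.

Lemma ln_INR_ge_0 n : 0 <= ln (INR (S n)).
Proof.
  rewrite <- ln_1. apply ln_le; [lra|]. rewrite S_INR; pose proof (pos_INR n); lra.
Qed.

(** Comparison with the integral of [x^-s] over a unit interval, by the mean value theorem for its
    primitive. The right side telescopes, whence [zeta(s) <= 1 + 1 / (s - 1)]. *)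
Lemma pw_step s n : 1 < s -> pw s (S (S n)) <= / (s - 1) * (pw (s - 1) (S n) - pw (s - 1) (S (S n))).
Proof.
  intros Hs.
  assert (Hn : 1 <= INR (S n)) by (rewrite S_INR; pose proof (pos_INR n); lra).
  destruct (MVT_cor2 (fun x => - exp (- (s - 1) * ln x) / (s - 1)) (fun x => exp (- s * ln x))
    (INR (S n)) (INR (S (S n)))) as [c [E Hc]].
  - apply lt_INR; lia.
  - intros c Hc. apply is_derive_Reals. auto_derive; [lra|].
    replace (exp (- s * ln c)) with (exp (- (s - 1) * ln c) * / c).
    + field. lra.
    + replace (- s * ln c) with (- (s - 1) * ln c + - ln c) by ring.
      rewrite exp_plus, exp_Ropp, exp_ln; lra.
  - replace (INR (S (S n)) - INR (S n)) with 1 in E by (rewrite (S_INR (S n)); ring).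
    rewrite Rmult_1_r in E. unfold pw.
    replace (/ (s - 1) * (exp (- (s - 1) * ln (INR (S n))) - exp (- (s - 1) * ln (INR (S (S n))))))
      with (exp (- s * ln c)) by (rewrite <- E; field; lra).
    assert (L : ln c <= ln (INR (S (S n)))) by (apply ln_le; lra).
    apply exp_le. nra.
Qed.

Lemma pw_series s : 1 < s ->
  ex_series (fun n => pw s (S n)) /\ Series (fun n => pw s (S n)) <= 1 + / (s - 1).
Proof.
  intros Hs. apply ex_series_bounded; [intros; apply Rlt_le, pw_pos|].
  assert (Hi : 0 < / (s - 1)) by (apply Rinv_0_lt_compat; lra).
  assert (H : forall n, rsum (fun n => pw s (S n)) (S n) <= 1 + / (s - 1) * (1 - pw (s - 1) (S n))).
  { induction n.
    - simpl rsum. rewrite !pw_1. lra.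
    - simpl rsum in *. pose proof (pw_step s n Hs). lra. }
  intros [|n]; [simpl; lra|].
  eapply Rle_trans; [apply H|]. pose proof (pw_pos (s - 1) (S n)). nra.
Qed.

Definition pterm (A : R) (k : nat) (t : R) : R := exp (- A * t) * ((A * t) ^ k / INR (fact k)).

(* The probability that a Poisson variable of mean [A * t] is less than [K]. *)
Definition pois (A : R) (K : nat) (t : R) : R := rsum (fun j => pterm A j t) K.

Lemma pterm_ge_0 A k t : 0 <= A * t -> 0 <= pterm A k t.
Proof.
  intros H. apply Rmult_le_pos; [apply Rlt_le, exp_pos|].
  apply Rle_mult_inv_pos; [apply pow_le; auto|apply INR_fact_lt_0].
Qed.

Lemma pois_series A t : is_series (fun j => pterm A j t) 1.
Proof.
  pose proof (is_exp_Reals (A * t)) as H. apply is_pseries_R in H.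
  apply (is_series_scal_l (V := R_NormedModule) (exp (- A * t))) in H.
  unfold scal in H; simpl in H; unfold mult in H; simpl in H.
  rewrite <- exp_plus in H. replace (- A * t + A * t) with 0 in H by ring. rewrite exp_0 in H.
  eapply is_series_ext; [|exact H]. intros n. unfold pterm, Rdiv. cbv beta.
  rewrite (Rmult_comm (/ _)). reflexivity.
Qed.

Lemma pois_lim A t : is_lim_seq (fun K => pois A K t) 1.
Proof. apply rsum_lim, pois_series. Qed.

Lemma pois_bounds A K t : 0 <= A * t -> 0 <= pois A K t <= 1.
Proof.
  intros H. split; [apply rsum_ge_0; intros; apply pterm_ge_0; auto|].
  rewrite <- (is_series_unique _ _ (pois_series A t)).
  apply rsum_le_Series; [intros; apply pterm_ge_0; auto|]. eexists; apply pois_series.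
Qed.

(** Derivatives of consecutive Poisson terms telescope. The sign of what remains makes the weights
    decrease in [t], the property on which partial summation and the integral comparison for zeta
    rely. *)
Lemma pois_derive A k t : is_derive (pois A (S k)) t (- A * pterm A k t).
Proof.
  induction k.
  - unfold pois, pterm; simpl. auto_derive; auto. field.
  - assert (H : is_derive (pterm A (S k)) t (- A * pterm A (S k) t + A * pterm A k t)).
    { unfold pterm. auto_derive; auto.
      change (match k with O => 1 | S _ => INR k + 1 end) with (INR (S k)).
      change (fact k + k * fact k)%nat with (fact (S k)).
      change (fact (S k)) with (S k * fact k)%nat. rewrite mult_INR.
      pose proof (INR_fact_neq_0 k). assert (INR (S k) <> 0) by (apply not_0_INR; lia).
      simpl (_ ^ S k). field. split; auto. }
    evar_last; [exact (is_derive_plus _ _ _ _ _ IHk H)|]. unfold plus; simpl. ring.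
Qed.

Lemma pois_decr A K s t : 0 <= A -> 0 <= s <= t -> pois A K t <= pois A K s.
Proof.
  intros HA [Hs [Hst| <-]]; [|lra].
  destruct K as [|k]; [unfold pois; simpl; lra|].
  destruct (MVT_cor2 (pois A (S k)) (fun t => - A * pterm A k t) s t Hst) as [c [E Hc]].
  - intros c Hc. apply is_derive_Reals, pois_derive.
  - assert (0 <= A * pterm A k c) by (apply Rmult_le_pos; auto; apply pterm_ge_0; nra). nra.
Qed.

Lemma pois_0 A K : pois A (S K) 0 = 1.
Proof.
  unfold pois. assert (H : forall n, rsum (fun j => pterm A j 0) (S n) = 1).
  { induction n; simpl rsum in *.
    - unfold pterm. rewrite !Rmult_0_r, exp_0. simpl; field.
    - rewrite IHn. unfold pterm. rewrite !Rmult_0_r, (pow_i (S n)) by lia. lra. }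
  apply H.
Qed.

Lemma pterm_le_inv A k t : 0 < A -> 0 < t -> pterm A k t <= INR (S k) / (A * t).
Proof.
  intros HA Ht. assert (Hx : 0 < A * t) by (apply Rmult_lt_0_compat; auto).
  pose proof (pow_fact_le_exp (A * t) (S k) ltac:(lra)) as H.
  unfold pterm. apply Rmult_le_reg_r with (A * t); auto.
  replace (INR (S k) / (A * t) * (A * t)) with (INR (S k)) by (field; lra).
  replace (- A * t) with (- (A * t)) by ring. rewrite exp_Ropp.
  pose proof (exp_pos (A * t)) as He.
  apply Rmult_le_reg_l with (exp (A * t)); auto.
  replace (exp (A * t) * (/ exp (A * t) * ((A * t) ^ k / INR (fact k)) * (A * t))) with
    (INR (S k) * ((A * t) ^ S k / INR (fact (S k)))).
  - rewrite (Rmult_comm (exp _)). apply Rmult_le_compat_l; [apply pos_INR|auto].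
  - rewrite fact_simpl, mult_INR. simpl (_ ^ S k).
    pose proof (INR_fact_neq_0 k). assert (INR (S k) <> 0) by (apply not_0_INR; lia).
    assert (exp (A * t) <> 0) by lra. field. repeat split; auto.
Qed.

Lemma pois_lim_0 A K : 0 < A -> is_lim_seq (fun n => pois A K (ln (INR (S n)))) 0.
Proof.
  intros HA.
  assert (Hl : is_lim_seq (fun n => ln (INR (S n))) p_infty).
  { eapply (filterlim_comp nat R R (fun n => INR (S n)) ln); [|apply is_lim_ln_p].
    assert (H0 : is_lim_seq (fun n => INR (S n)) p_infty)
      by (apply (is_lim_seq_incr_1 INR p_infty), is_lim_seq_INR). exact H0. }
  assert (T : forall k, is_lim_seq (fun n => pterm A k (ln (INR (S n)))) 0).
  { intros k. apply (is_lim_seq_le_le_loc (fun _ => 0) _ (fun n => INR (S k) / A * / ln (INR (S n)))).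
    - exists 1%nat. intros n Hn.
      assert (Hp : 0 < ln (INR (S n))).
      { rewrite <- ln_1. apply ln_increasing; [lra|]. apply (lt_INR 1); lia. }
      split; [apply pterm_ge_0; nra|].
      replace (INR (S k) / A * / ln (INR (S n))) with (INR (S k) / (A * ln (INR (S n)))) by (field; lra).
      apply pterm_le_inv; auto.
    - apply is_lim_seq_const.
    - replace (Finite 0) with (Rbar_mult (Finite (INR (S k) / A)) (Finite 0)) by (simpl; f_equal; ring).
      apply is_lim_seq_scal_l. apply (is_lim_seq_inv _ p_infty Hl). discriminate. }
  unfold pois. induction K; simpl; [apply is_lim_seq_const|].
  replace (Finite 0) with (Finite (0 + 0)) by (f_equal; ring).
  apply is_lim_seq_plus'; auto.
Qed.

(** * Dirichlet series and Euler products *)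

Lemma Fubini_pos (a : nat -> nat -> R) : (forall n k, 0 <= a n k) ->
  (forall n, ex_series (a n)) -> ex_series (fun n => Series (a n)) ->
  ex_series (fun k => Series (fun n => a n k)) /\
  Series (fun k => Series (fun n => a n k)) = Series (fun n => Series (a n)).
Proof.
  intros Hp Hr Ht.
  assert (E : forall n k, Cmod (RtoC (a n k)) = a n k).
  { intros; rewrite Cmod_R, Rabs_pos_eq; auto. }
  destruct (Fubini (fun n k => RtoC (a n k))) as [H1 [H2 [H3 [H4 H5]]]].
  - intros n. eapply ex_series_ext; [|exact (Hr n)]. intros; symmetry; apply E.
  - eapply ex_series_ext; [|exact Ht]. intros n. apply Series_ext; intros; symmetry; apply E.
  - split.
    + eapply ex_series_ext; [|exact H3]. intros k. apply Series_ext; intros; apply E.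
    + apply (f_equal Re) in H5. symmetry; exact H5.
Qed.

Lemma series_pbd a r : 0 <= r -> ex_series (fun k => Cmod (a k) * r ^ k) ->
  pbd a r (Series (fun k => Cmod (a k) * r ^ k)).
Proof.
  intros Hr H k.
  assert (P : forall k, 0 <= Cmod (a k) * r ^ k).
  { intros; apply Rmult_le_pos; [apply Cmod_ge_0|apply pow_le; auto]. }
  eapply Rle_trans; [|apply (rsum_le_Series (fun k => Cmod (a k) * r ^ k) (S k)); auto].
  simpl. pose proof (rsum_ge_0 _ k P). lra.
Qed.

(** Coefficient of [z^k] in [exp (- (A + z) x)]; for [x = log n] this expands [n^-s] at [s = A]. *)
Definition ecf (x A : R) (k : nat) : R := exp (- A * x) * ((- x) ^ k / INR (fact k)).

Lemma ecf_abs x A k : 0 <= x -> Rabs (ecf x A k) = exp (- A * x) * (x ^ k / INR (fact k)).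
Proof.
  intros Hx. unfold ecf, Rdiv.
  rewrite !Rabs_mult, <- RPow_abs, Rabs_Ropp, (Rabs_pos_eq x) by auto.
  rewrite Rabs_pos_eq by (apply Rlt_le, exp_pos).
  rewrite (Rabs_pos_eq (/ _)); auto. apply Rlt_le, Rinv_0_lt_compat, INR_fact_lt_0.
Qed.

Lemma exp_series_scaled x A r :
  is_series (fun k => exp (- A * x) * (x ^ k / INR (fact k)) * r ^ k) (exp (- (A - r) * x)).
Proof.
  pose proof (is_exp_Reals (r * x)) as H. apply is_pseries_R in H.
  apply (is_series_scal_l (V := R_NormedModule) (exp (- A * x))) in H.
  unfold scal in H; simpl in H; unfold mult in H; simpl in H.
  rewrite <- exp_plus in H. replace (- A * x + r * x) with (- (A - r) * x) in H by ring.
  eapply is_series_ext; [|exact H]. intros n. cbv beta.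
  change (exp (- A * x) * (/ INR (fact n) * (r * x) ^ n) =
    exp (- A * x) * (x ^ n / INR (fact n)) * r ^ n).
  rewrite Rpow_mult_distr. unfold Rdiv; ring.
Qed.

Lemma ecf_PS x A z : summ (fun k => Cmult (RtoC (ecf x A k)) (Cpow z k)) /\
  PS (fun k => RtoC (ecf x A k)) z = cexp (- ((A + z) * x)).
Proof.
  assert (Hs : summ (fun k => Cmult (expco k) (Cpow (- (z * x)) k))).
  { apply (PS_summ _ (Cmod (- (z * x)) + 1) (exp (Cmod (- (z * x)) + 1))); [|lra].
    apply expco_bd. pose proof (Cmod_ge_0 (- (z * x))); lra. }
  assert (E : forall k, Cmult (RtoC (exp (- A * x))) (Cmult (expco k) (Cpow (- (z * x)) k)) =
     Cmult (RtoC (ecf x A k)) (Cpow z k)).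
  { intros k. unfold ecf, expco.
    replace (- (z * x))%C with (RtoC (- x) * z)%C by (rewrite RtoC_opp; ring).
    unfold Rdiv. rewrite Cpow_mult_l, !RtoC_mult, RtoC_pow. ring. }
  split; [eapply summ_ext; [exact E|]; apply summ_scal; auto|].
  replace (- ((A + z) * x))%C with (RtoC (- A * x) + - (z * x))%C
    by (rewrite RtoC_mult, RtoC_opp; ring).
  rewrite cexp_add, <- (cexp_PS (- (z * x))).
  replace (cexp (RtoC (- A * x))) with (RtoC (exp (- A * x)))
    by (apply C_eq; simpl; rewrite ?cos_0, ?sin_0; ring).
  unfold PS. rewrite <- CSer_scal by auto. apply CSer_ext; intros; symmetry; apply E.
Qed.

(** Taylor coefficients at [A] of the general Dirichlet series [sum c_n exp (- s x_n)]. The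
    frequencies are arbitrary because it serves twice: for a Dirichlet series, with [x_n = log n],
    and for its logarithm, with the logarithms of the powers of one prime. *)
Definition famco (c : nat -> C) (x : nat -> R) (A : R) (k : nat) : C :=
  CSer (fun n => Cmult (c n) (RtoC (ecf (x n) A k))).

Section Family.

Variables (c : nat -> C) (x : nat -> R) (A r : R).
Hypothesis Hx : forall n, 0 <= x n.
Hypothesis Hr : 0 < r.
Hypothesis Hs : ex_series (fun n => Cmod (c n) * exp (- (A - r) * x n)).

Local Lemma fam_abs n k :
  Cmod (Cmult (c n) (RtoC (ecf (x n) A k))) * r ^ k =
  Cmod (c n) * (exp (- A * x n) * (x n ^ k / INR (fact k)) * r ^ k).
Proof. rewrite Cmod_mult, Cmod_R, ecf_abs by auto. ring. Qed.

Local Lemma fam_row n :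
  is_series (fun k => Cmod (Cmult (c n) (RtoC (ecf (x n) A k))) * r ^ k)
    (Cmod (c n) * exp (- (A - r) * x n)).
Proof.
  eapply is_series_ext; [intros k; symmetry; apply fam_abs|].
  apply (is_series_scal_l (V := R_NormedModule) (Cmod (c n))), exp_series_scaled.
Qed.

Local Lemma fam_pos n k : 0 <= Cmod (Cmult (c n) (RtoC (ecf (x n) A k))) * r ^ k.
Proof. apply Rmult_le_pos; [apply Cmod_ge_0|apply pow_le; lra]. Qed.

Lemma fam_summ k : summ (fun n => Cmult (c n) (RtoC (ecf (x n) A k))).
Proof.
  assert (Hk : 0 < r ^ k) by (apply pow_lt; auto).
  apply (summ_le _ (fun n => / r ^ k * (Cmod (c n) * exp (- (A - r) * x n)))).
  - intros n. apply Rmult_le_reg_r with (r ^ k); auto.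
    replace (/ r ^ k * (Cmod (c n) * exp (- (A - r) * x n)) * r ^ k) with
      (Cmod (c n) * exp (- (A - r) * x n)) by (field; lra).
    rewrite <- (is_series_unique _ _ (fam_row n)).
    eapply Rle_trans; [|apply (rsum_le_Series _ (S k)); [intros; apply fam_pos|eexists; apply fam_row]].
    simpl. pose proof (rsum_ge_0 _ k (fam_pos n)). lra.
  - apply (ex_series_scal_l (V := R_NormedModule) (/ r ^ k) (fun n => Cmod (c n) * exp (- (A - r) * x n))), Hs.
Qed.

(** Summing [|ecf| r^k] over [k] gives [exp (- (A - r) x)], so the double sum is the absolute series
    at the real point [A - r]. *)
Lemma fam_bound : ex_series (fun k => Cmod (famco c x A k) * r ^ k) /\
  Series (fun k => Cmod (famco c x A k) * r ^ k) <=
    Series (fun n => Cmod (c n) * exp (- (A - r) * x n)).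
Proof.
  destruct (Fubini_pos (fun n k => Cmod (Cmult (c n) (RtoC (ecf (x n) A k))) * r ^ k)) as [F1 F2].
  - apply fam_pos.
  - intros n; eexists; apply fam_row.
  - eapply ex_series_ext; [|exact Hs]. intros n. symmetry. apply is_series_unique, fam_row.
  - assert (Hle : forall k, 0 <= Cmod (famco c x A k) * r ^ k <=
      Series (fun n => Cmod (Cmult (c n) (RtoC (ecf (x n) A k))) * r ^ k)).
    { intros k; split; [apply Rmult_le_pos; [apply Cmod_ge_0|apply pow_le; lra]|].
      rewrite Series_scal_r. apply Rmult_le_compat_r; [apply pow_le; lra|].
      apply Cmod_CSer, fam_summ. }
    split; [eapply ex_series_le_pos; [exact Hle|exact F1]|].
    eapply Rle_trans; [apply Series_le; [exact Hle|exact F1]|].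
    rewrite F2. right. apply Series_ext. intros n. apply is_series_unique, fam_row.
Qed.

Lemma fam_PS z : Cmod z <= r -> summ (fun n => Cmult (c n) (cexp (- ((A + z) * x n)))) /\
  PS (famco c x A) z = CSer (fun n => Cmult (c n) (cexp (- ((A + z) * x n)))).
Proof.
  intros Hz.
  assert (Hrow : forall n k, Cmod (Cmult (Cmult (c n) (RtoC (ecf (x n) A k))) (Cpow z k)) <=
     Cmod (Cmult (c n) (RtoC (ecf (x n) A k))) * r ^ k).
  { intros n k. rewrite (Cmod_mult (_ * _)), Cmod_pow. apply Rmult_le_compat_l; [apply Cmod_ge_0|].
    apply pow_incr; split; auto; apply Cmod_ge_0. }
  assert (Hrs : forall n, summ (fun k => Cmult (Cmult (c n) (RtoC (ecf (x n) A k))) (Cpow z k))).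
  { intros n. eapply summ_le; [apply Hrow|]. eexists; apply fam_row. }
  destruct (Fubini (fun n k => Cmult (Cmult (c n) (RtoC (ecf (x n) A k))) (Cpow z k))) as [H1 [H2 [H3 [H4 H5]]]].
  - exact Hrs.
  - eapply ex_series_le_pos; [|exact Hs]. intros n. cbv beta. split.
    + exact (Series_ge_0 _ (fun k => Cmod_ge_0 _) (Hrs n)).
    + rewrite <- (is_series_unique _ _ (fam_row n)).
      apply Series_le; [intros k; split; [apply Cmod_ge_0|apply Hrow]|eexists; apply fam_row].
  - assert (E : forall n, CSer (fun k => Cmult (Cmult (c n) (RtoC (ecf (x n) A k))) (Cpow z k)) =
       Cmult (c n) (cexp (- ((A + z) * x n)))).
    { intros n. destruct (ecf_PS (x n) A z) as [E1 E2]. rewrite <- E2.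
      unfold PS. rewrite <- CSer_scal by auto. apply CSer_ext; intros; ring. }
    split.
    + eapply summ_ext; [exact E|exact H2].
    + rewrite <- (CSer_ext _ _ E), H5. apply CSer_ext; intros k.
      unfold famco. rewrite Cmult_comm, <- CSer_scal by apply fam_summ.
      apply CSer_ext; intros; ring.
Qed.

End Family.

(* Taylor coefficients of the Dirichlet series of [a] at the point [A]. *)
Definition fco (a : nat -> C) (A : R) : nat -> C :=
  famco (fun n => a (S n)) (fun n => ln (INR (S n))) A.

Definition dirser (a : nat -> C) (s : C) : C := CSer (fun n => Cmult (a (S n)) (cpow_neg (S n) s)).

Section DirichletPS.

Variables (a : nat -> C) (A r : R).
Hypothesis Ha : forall n, Cmod (a n) <= 1.
Hypothesis Hr : 0 < r < A - 1.

Local Lemma dir_ex : ex_series (fun n => Cmod (a (S n)) * exp (- (A - r) * ln (INR (S n)))).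
Proof.
  eapply ex_series_le_pos; [|apply (pw_series (A - r)); lra].
  intros n; split; [apply Rmult_le_pos; [apply Cmod_ge_0|apply Rlt_le, exp_pos]|].
  unfold pw. rewrite <- (Rmult_1_l (exp (- (A - r) * ln (INR (S n))))) at 2.
  apply Rmult_le_compat_r; [apply Rlt_le, exp_pos|apply Ha].
Qed.

Lemma fco_summ k : summ (fun n => Cmult (a (S n)) (RtoC (ecf (ln (INR (S n))) A k))).
Proof.
  apply (fam_summ (fun n => a (S n)) (fun n => ln (INR (S n))) A r);
    [apply ln_INR_ge_0|lra|apply dir_ex].
Qed.

Lemma fco_bd : exists B, pbd (fco a A) r B.
Proof.
  destruct (fam_bound (fun n => a (S n)) (fun n => ln (INR (S n))) A r) as [H1 H2];
    [apply ln_INR_ge_0|lra|apply dir_ex|].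
  eexists. apply (series_pbd (fco a A)); [lra|exact H1].
Qed.

Lemma fco_PS z : Cmod z <= r -> PS (fco a A) z = dirser a (A + z).
Proof.
  intros Hz.
  destruct (fam_PS (fun n => a (S n)) (fun n => ln (INR (S n))) A r ltac:(apply ln_INR_ge_0) ltac:(lra) dir_ex z Hz) as [_ E].
  unfold fco. rewrite E. apply CSer_ext; intros n. rewrite cpow_neg_cexp; auto.
Qed.

End DirichletPS.

Lemma dirser_summ a s : (forall n, Cmod (a n) <= 1) -> 1 < Re s ->
  summ (fun n => Cmult (a (S n)) (cpow_neg (S n) s)).
Proof.
  intros Ha Hs. apply (summ_le _ (fun n => pw (Re s) (S n))); [|apply pw_series; auto].
  intros n. rewrite Cmod_mult, Cmod_cpow_neg. unfold pw.
  rewrite <- (Rmult_1_l (exp _)) at 2. apply Rmult_le_compat_r; [apply Rlt_le, exp_pos|apply Ha].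
Qed.

(** * The sieve and the Euler product *)

Definition isp (n : nat) : bool := if prime_dec (Z.of_nat n) then true else false.

(** The second base case starts the sieve at [2]: testing divisibility by [1] would leave
    nothing. *)
Fixpoint rough (N n : nat) : bool :=
  match N with
  | O => true
  | S O => true
  | S M => andb (rough M n) (negb (Nat.eqb (n mod S M) 0))
  end.

Lemma rough_S N n : (1 <= N)%nat ->
  rough (S N) n = andb (rough N n) (negb (Nat.eqb (n mod S N) 0)).
Proof. destruct N; [lia|reflexivity]. Qed.

Lemma mod_divide n d : (d <> 0)%nat -> (n mod d = 0)%nat <-> Nat.divide d n.
Proof. intros; apply Nat.Lcm0.mod_divide. Qed.

Lemma rough_spec N n : rough N n = true <-> forall d, (2 <= d <= N)%nat -> ~ Nat.divide d n.
Proof.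
  induction N as [|N IH]; [split; [intros; lia|auto]|].
  destruct (Nat.eq_dec N 0) as [->|HN]; [simpl; split; [intros; lia|auto]|].
  rewrite rough_S, Bool.andb_true_iff, IH, Bool.negb_true_iff, Nat.eqb_neq by lia.
  split.
  - intros [H1 H2] d Hd. destruct (Nat.eq_dec d (S N)) as [->|]; [|apply H1; lia].
    intros H3. apply H2, mod_divide; auto.
  - intros H. split; [intros d Hd; apply H; lia|].
    intros H3. apply (H (S N)); [lia|]. apply mod_divide in H3; auto.
Qed.

Lemma not_prime_divisor n : (2 <= n)%nat -> ~ prime (Z.of_nat n) ->
  exists d, (2 <= d < n)%nat /\ Nat.divide d n.
Proof.
  intros Hn Hp. apply NNPP; intros Hno. apply Hp. apply prime_alt. split; [lia|].
  intros m Hm Hd. apply Hno. exists (Z.to_nat m). split; [lia|].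
  destruct Hd as [k Hk]. exists (Z.to_nat k).
  assert (0 <= k)%Z by nia.
  apply Nat2Z.inj. rewrite Nat2Z.inj_mul, !Z2Nat.id by lia. auto.
Qed.

Lemma prime_coprime_lt p d : prime (Z.of_nat p) -> (0 < d < p)%nat -> Nat.gcd d p = 1%nat.
Proof.
  intros Hp Hd.
  destruct (Nat.gcd_divide_l d p) as [u Hu]. destruct (Nat.gcd_divide_r d p) as [v Hv].
  set (g := Nat.gcd d p) in *.
  apply prime_alt in Hp. destruct Hp as [_ Hp].
  destruct (Nat.eq_dec g 1) as [|Hg]; auto. exfalso.
  assert (g <> 0)%nat by (intros E; rewrite E in Hu; lia).
  assert (g <= d)%nat by (apply Nat.divide_pos_le; [lia|exists u; auto]).
  apply (Hp (Z.of_nat g)); [lia|]. exists (Z.of_nat v). rewrite Hv at 1. apply Nat2Z.inj_mul.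
Qed.

Lemma rough_mult N p m : prime (Z.of_nat p) -> (N < p)%nat -> rough N (p * m) = rough N m.
Proof.
  intros Hp HN. apply Bool.eq_iff_eq_true. rewrite !rough_spec.
  split; intros H d Hd Hdiv; apply (H d Hd).
  - apply Nat.divide_mul_r; auto.
  - apply (Nat.gauss d p m); auto. apply prime_coprime_lt; auto; lia.
Qed.

Lemma csum_zero (f : nat -> C) n : (forall i, (i < n)%nat -> f i = 0) -> csum f n = 0.
Proof. induction n; intros H; simpl; auto. rewrite IHn, H; auto. ring. Qed.

(** Each block of [p] consecutive positive indices has exactly one multiple of [p], in last place,
    so the partial sum to [p * M] on the left is the partial sum to [M] on the right. *)
Lemma CSer_multiples (u : nat -> C) p : (0 < p)%nat -> summ (fun n => u (S n)) ->
  summ (fun m => u (p * S m)%nat) ->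
  (forall j, ~ Nat.divide p j -> u j = 0) ->
  CSer (fun n => u (S n)) = CSer (fun m => u (p * S m)%nat).
Proof.
  intros Hp H1 H2 Hu.
  assert (E : forall M, csum (fun n => u (S n)) (p * M) = csum (fun m => u (p * S m)%nat) M).
  { induction M; [rewrite Nat.mul_0_r; auto|].
    replace (p * S M)%nat with (p * M + p)%nat by lia. rewrite csum_app, IHM. simpl csum. f_equal.
    destruct p as [|p]; [lia|]. simpl csum.
    rewrite csum_zero.
    - rewrite Cplus_0_l. f_equal. lia.
    - intros i Hi. apply Hu. intros [q Hq].
      assert (S (S p * M + i) = S p * M + S i)%nat by lia.
      assert (q = M \/ q < M \/ M < q)%nat as [ | [ | ] ] by lia; nia. }
  eapply Clim_unique; [|apply CSer_lim; exact H2].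
  eapply Clim_ext; [exact E|].
  apply (Clim_subseq (csum (fun n => u (S n))) _ (fun M => (p * M)%nat)); [intros; nia|].
  apply CSer_lim; auto.
Qed.

Fixpoint eprod (t : nat -> C) (N : nat) : C :=
  match N with
  | O => RtoC 1
  | S m => Cmult (eprod t m) (if isp (S m) then Cminus 1 (t (S m)) else RtoC 1)
  end.

Lemma prime_1_false : isp 1 = false.
Proof.
  unfold isp. destruct (prime_dec (Z.of_nat 1)) as [H|]; auto.
  apply prime_ge_2 in H. simpl in H. lia.
Qed.

Section Euler.

Variable t : nat -> C.
Hypothesis t1 : t 1%nat = 1.
Hypothesis tm : forall m n, (0 < m)%nat -> (0 < n)%nat -> t (m * n)%nat = Cmult (t m) (t n).
Hypothesis ts : summ (fun n => t (S n)).

Let dn (N : nat) (j : nat) : C := if rough N j then t j else RtoC 0.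

Local Lemma dn_le N j : Cmod (dn N j) <= Cmod (t j).
Proof. unfold dn. destruct (rough N j); [lra|rewrite Cmod_0; apply Cmod_ge_0]. Qed.

Local Lemma dn_summ N : summ (fun n => dn N (S n)).
Proof. eapply summ_le; [|exact ts]; intros; apply dn_le. Qed.

(** Sieve of Eratosthenes. At a prime [p] the multiples of [p] still present sum to [t p] times the
    current sum, which produces the factor [1 - t p]; at a composite number a proper divisor has
    already removed every multiple. *)
Local Lemma dn_euler N : CSer (fun n => dn N (S n)) = Cmult (CSer (fun n => t (S n))) (eprod t N).
Proof.
  induction N; [cbn [eprod]; rewrite Cmult_1_r; apply CSer_ext; reflexivity|].
  cbn [eprod]. rewrite Cmult_assoc, <- IHN. clear IHN.
  destruct (isp (S N)) eqn:Ep.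
  - assert (Hp : prime (Z.of_nat (S N))).
    { unfold isp in Ep. destruct (prime_dec (Z.of_nat (S N))); [auto|discriminate]. }
    assert (HN : (1 <= N)%nat) by (apply prime_ge_2 in Hp; lia).
    set (u := fun j => if Nat.eqb (j mod S N) 0 then dn N j else RtoC 0).
    assert (Su : summ (fun n => u (S n))).
    { eapply summ_le; [|exact ts]. intros n. unfold u. destruct (Nat.eqb _ _); [apply dn_le|].
      rewrite Cmod_0; apply Cmod_ge_0. }
    assert (Eu : forall m, u (S N * S m)%nat = Cmult (t (S N)) (dn N (S m))).
    { intros m. unfold u.
      replace ((S N * S m) mod S N)%nat with 0%nat.
      - simpl Nat.eqb. cbv iota. unfold dn. rewrite rough_mult by (auto; lia).
        destruct (rough N (S m)); [apply tm; lia|ring].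
      - symmetry. apply mod_divide; [lia|]. exists (S m). lia. }
    assert (Sm : summ (fun m => u (S N * S m)%nat)).
    { eapply summ_ext; [intros m; symmetry; apply Eu|]. apply summ_scal, dn_summ. }
    assert (E1 : CSer (fun n => u (S n)) = Cmult (t (S N)) (CSer (fun n => dn N (S n)))).
    { rewrite (CSer_multiples u (S N) ltac:(lia) Su Sm).
      - rewrite (CSer_ext _ _ Eu), CSer_scal; auto. apply dn_summ.
      - intros j Hj. unfold u. destruct (Nat.eqb (j mod S N) 0) eqn:E; auto.
        apply Nat.eqb_eq in E. apply mod_divide in E; [contradiction|lia]. }
    replace (CSer (fun n => dn N (S n)) * (1 - t (S N)))%C with
      (CSer (fun n => dn N (S n)) - CSer (fun n => u (S n)))%C by (rewrite E1; ring).
    rewrite <- CSer_minus by (auto; apply dn_summ).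
    apply CSer_ext; intros n. unfold u, dn. rewrite rough_S by auto.
    destruct (rough N (S n)), (Nat.eqb (S n mod S N) 0); simpl; ring.
  - rewrite Cmult_1_r. apply CSer_ext; intros n. unfold dn.
    destruct (Nat.eq_dec N 0) as [->|HN]; [auto|].
    rewrite rough_S by lia.
    destruct (Nat.eqb (S n mod S N) 0) eqn:E; [|rewrite Bool.andb_true_r; auto].
    apply Nat.eqb_eq in E. apply mod_divide in E; [|lia].
    assert (Hnp : ~ prime (Z.of_nat (S N))).
    { unfold isp in Ep. destruct (prime_dec (Z.of_nat (S N))); [discriminate|auto]. }
    destruct (not_prime_divisor (S N) ltac:(lia) Hnp) as [d [Hd1 Hd2]].
    destruct (rough N (S n)) eqn:Er; auto. exfalso.
    apply (proj1 (rough_spec N (S n)) Er d); [lia|].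
    eapply Nat.divide_trans; eauto.
Qed.

(** Once the sieve has passed [N], only [1] and integers above [N] remain, and the latter form part
    of the tail of a convergent series. *)
Lemma euler_lim : Clim (fun N => Cmult (CSer (fun n => t (S n))) (eprod t N)) 1.
Proof.
  eapply Clim_ext; [apply dn_euler|].
  apply Clim_eps; intros eps Heps.
  destruct (Series_tail_lim _ (fun n => Cmod_ge_0 _) ts eps Heps) as [N0 HN0].
  exists (S N0). intros N HN.
  rewrite (CSer_split _ N (dn_summ N)).
  destruct N as [|N]; [lia|].
  assert (E : csum (fun n => dn (S N) (S n)) (S N) = 1).
  { change (csum (fun n => dn (S N) (S n)) (1 + N) = 1). rewrite csum_app, (csum_zero _ N).
    - simpl csum. unfold dn. replace (rough (S N) 1) with true; [rewrite t1; ring|].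
      symmetry. apply rough_spec. intros d Hd [q Hq]. destruct q; simpl in Hq; lia.
    - intros i Hi. unfold dn. destruct (rough (S N) (S (1 + i))) eqn:Er; auto. exfalso.
      apply (proj1 (rough_spec _ _) Er (S (1 + i))); [lia|]. apply Nat.divide_refl. }
  rewrite E.
  replace (1 + CSer (fun k => dn (S N) (S (S N + k))) - 1)%C with
    (CSer (fun k => dn (S N) (S (S N + k)))) by ring.
  apply (Clim_bound (csum (fun k => dn (S N) (S (S N + k))))).
  - intros m. eapply Rle_trans; [apply Cmod_csum|].
    eapply Rle_trans; [|apply (HN0 (S N) m); lia].
    apply rsum_le. intros; apply dn_le.
  - apply CSer_lim. apply (summ_incr (fun n => dn (S N) (S n)) (S N)), dn_summ.
Qed.

Lemma euler_nonzero : CSer (fun n => t (S n)) <> 0.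
Proof.
  intros E. assert (H := euler_lim). rewrite E in H.
  assert (H2 : RtoC 1 = RtoC 0).
  { eapply Clim_unique; [exact H|]. eapply Clim_ext; [|apply Clim_const]. intros; cbv beta; ring. }
  apply RtoC_inj in H2. lra.
Qed.

Hypothesis tb : forall n, (2 <= n)%nat -> Cmod (t n) < 1.

(** Taking moduli first leaves real logarithms, whose partial sums converge by continuity of [ln] at
    [1]. *)
Lemma euler_log : is_series (fun n => if isp (S n) then - ln (Cmod (1 - t (S n))) else 0)
  (ln (Cmod (CSer (fun n => t (S n))))).
Proof.
  assert (Hnz : forall n, isp (S n) = true -> 0 < Cmod (1 - t (S n))).
  { intros n Hn. apply Cmod_gt_0, Cminus_eq_contra. intros E.
    assert (H2 : (2 <= S n)%nat).
    { destruct n; [rewrite prime_1_false in Hn; discriminate|lia]. }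
    specialize (tb (S n) H2). rewrite <- E, Cmod_1 in tb. lra. }
  assert (Hep : forall N, 0 < Cmod (eprod t N)).
  { induction N; cbn [eprod]; [rewrite Cmod_1; lra|]. rewrite Cmod_mult.
    apply Rmult_lt_0_compat; auto. destruct (isp (S N)) eqn:E; [apply Hnz; auto|rewrite Cmod_1; lra]. }
  assert (Hr : forall N, rsum (fun n => if isp (S n) then - ln (Cmod (1 - t (S n))) else 0) N =
    - ln (Cmod (eprod t N))).
  { induction N; cbn [rsum eprod]; [rewrite Cmod_1, ln_1; ring|]. rewrite IHN, Cmod_mult.
    destruct (isp (S N)) eqn:E.
    - rewrite ln_mult; auto; ring.
    - rewrite Cmod_1, Rmult_1_r. ring. }
  assert (HL : 0 < Cmod (CSer (fun n => t (S n)))) by (apply Cmod_gt_0, euler_nonzero).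
  apply rsum_lim. eapply is_lim_seq_ext; [intros; symmetry; apply Hr|].
  pose proof (Clim_norm _ _ euler_lim) as H. rewrite Cmod_1 in H.
  apply (is_lim_seq_continuous ln) in H.
  - rewrite ln_1 in H.
    apply (is_lim_seq_ext _ (fun N => ln (Cmod (CSer (fun n => t (S n)))) + ln (Cmod (eprod t N)))) in H.
    + pose proof (is_lim_seq_minus' _ _ _ _ (is_lim_seq_const (ln (Cmod (CSer (fun n => t (S n)))))) H) as H2.
      rewrite Rminus_0_r in H2. eapply is_lim_seq_ext; [|exact H2]. intros; simpl; ring.
    + intros N. rewrite Cmod_mult, ln_mult; auto.
  - apply derivable_continuous_pt. exists (/ 1). apply derivable_pt_lim_ln; lra.
Qed.

End Euler.

(** * Logarithms of Dirichlet series *)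

Lemma Re_CSer f : Re (CSer f) = Series (fun n => Re (f n)).
Proof. reflexivity. Qed.

Definition completely_mult (a : nat -> C) : Prop :=
  a 1%nat = 1 /\ (forall m n, a (m * n)%nat = Cmult (a m) (a n)) /\ (forall n, Cmod (a n) <= 1).

(* Prime powers are written [(S n) ^ (S m)]. *)
Definition logpp (n m : nat) : R := INR (S m) * ln (INR (S n)).

(** Coefficient [a(p)^k / k] of [p^(-k s)] in the logarithm of the Euler product, with [p = n + 1]
    and [k = m + 1]. *)
Definition ppcoef (a : nat -> C) (n m : nat) : C :=
  if isp (S n) then Cmult (RtoC (/ INR (S m))) (Cpow (a (S n)) (S m)) else RtoC 0.

Definition gcp (a : nat -> C) (A : R) (n : nat) : nat -> C := famco (ppcoef a n) (logpp n) A.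

(* Taylor coefficients of the logarithm of the Dirichlet series of [a] at the point [A]. *)
Definition gco (a : nat -> C) (A : R) (k : nat) : C := CSer (fun n => gcp a A n k).

Lemma logpp_ge_0 n m : 0 <= logpp n m.
Proof. apply Rmult_le_pos; [apply pos_INR|apply ln_INR_ge_0]. Qed.

Lemma exp_mul_nat x m : exp (INR m * x) = exp x ^ m.
Proof.
  induction m; [simpl; rewrite Rmult_0_l; apply exp_0|].
  rewrite S_INR, Rmult_plus_distr_r, exp_plus, IHm, Rmult_1_l. simpl; ring.
Qed.

Lemma exp_logpp s n m : exp (- s * logpp n m) = pw s (S n) ^ S m.
Proof. unfold logpp, pw. rewrite <- exp_mul_nat. f_equal. ring. Qed.

Lemma pw_half s n : 1 < s -> (2 <= n)%nat -> 0 < pw s n <= / 2.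
Proof.
  intros Hs Hn. split; [apply pw_pos|].
  assert (L : ln 2 <= ln (INR n)) by (apply ln_le; [lra|apply (le_INR 2); auto]).
  assert (0 < ln 2) by (rewrite <- ln_1; apply ln_increasing; lra).
  rewrite <- (exp_ln (/ 2)) by lra. rewrite ln_Rinv by lra. apply exp_le. nra.
Qed.

Lemma isp_ge_2 n : isp n = true -> (2 <= n)%nat.
Proof.
  unfold isp. destruct (prime_dec (Z.of_nat n)) as [H|]; [|discriminate].
  intros _. apply prime_ge_2 in H. lia.
Qed.

Lemma ppcoef_bound a n m : (forall n, Cmod (a n) <= 1) -> Cmod (ppcoef a n m) <= / INR (S m).
Proof.
  intros Ha. assert (Hm : 0 < / INR (S m)) by (apply Rinv_0_lt_compat, lt_0_INR; lia).
  unfold ppcoef. destruct (isp (S n)); [|rewrite Cmod_0; lra].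
  rewrite Cmod_mult, Cmod_pow, Cmod_R, Rabs_pos_eq by lra.
  rewrite <- (Rmult_1_r (/ INR (S m))) at 2. apply Rmult_le_compat_l; [lra|].
  rewrite <- (pow1 (S m)). apply pow_incr. split; [apply Cmod_ge_0|auto].
Qed.

Lemma inv_S_le_1 m : / INR (S m) <= 1.
Proof.
  rewrite <- Rinv_1. apply Rinv_le_contravar; [lra|]. rewrite S_INR; pose proof (pos_INR m); lra.
Qed.

Lemma ppcoef_term_le a s n m : (forall n, Cmod (a n) <= 1) ->
  0 <= Cmod (ppcoef a n m) * exp (- s * logpp n m) <= (if isp (S n) then pw s (S n) ^ S m else 0).
Proof.
  intros Ha. split; [apply Rmult_le_pos; [apply Cmod_ge_0|apply Rlt_le, exp_pos]|].
  destruct (isp (S n)) eqn:E.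
  - rewrite exp_logpp. rewrite <- (Rmult_1_l (pw s (S n) ^ S m)) at 2.
    apply Rmult_le_compat_r; [apply pow_le, Rlt_le, pw_pos|].
    eapply Rle_trans; [apply ppcoef_bound; auto|apply inv_S_le_1].
  - unfold ppcoef. rewrite E, Cmod_0. lra.
Qed.

(** At a prime, [x = p^-s <= 1/2], so the geometric sum [x / (1 - x)] is at most [2 x]. *)
Lemma ppcoef_row a s n : (forall n, Cmod (a n) <= 1) -> 1 < s ->
  ex_series (fun m => Cmod (ppcoef a n m) * exp (- s * logpp n m)) /\
  Series (fun m => Cmod (ppcoef a n m) * exp (- s * logpp n m)) <= 2 * pw s (S n).
Proof.
  intros Ha Hs.
  assert (G : ex_series (fun m => if isp (S n) then pw s (S n) ^ S m else 0) /\
    Series (fun m => if isp (S n) then pw s (S n) ^ S m else 0) <= 2 * pw s (S n)).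
  { destruct (isp (S n)) eqn:E.
    - apply isp_ge_2 in E. pose proof (pw_half s (S n) Hs E) as Hh.
      destruct (geom_S_sum (pw s (S n)) ltac:(lra)) as [G1 G2]. split; auto.
      rewrite G2. apply Rmult_le_reg_r with (1 - pw s (S n)); [lra|].
      unfold Rdiv; rewrite Rmult_assoc, Rinv_l by lra. nra.
    - destruct (ex_series_bounded (fun _ : nat => 0) 0) as [H1 H2].
      + intros; lra.
      + intros k; rewrite rsum_const; lra.
      + split; auto. pose proof (pw_pos s (S n)); lra. }
  destruct G as [G1 G2]. split.
  - eapply ex_series_le_pos; [|exact G1]. intros m; apply ppcoef_term_le; auto.
  - eapply Rle_trans; [|exact G2]. apply Series_le; auto. intros m; apply ppcoef_term_le; auto.
Qed.

Lemma cexp_mul_nat z m : cexp (INR m * z) = Cpow (cexp z) m.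
Proof.
  induction m; [simpl; replace (0 * z)%C with (RtoC 0) by ring; apply cexp_0|].
  rewrite S_INR, RtoC_plus.
  replace ((INR m + 1) * z)%C with (z + INR m * z)%C by ring.
  rewrite cexp_add, IHm, Cpow_S; auto.
Qed.

Lemma ppcoef_lgterm a s n m : Cmult (ppcoef a n m) (cexp (- (s * logpp n m))) =
  if isp (S n) then lgterm (a (S n) * cpow_neg (S n) s)%C m else RtoC 0.
Proof.
  unfold ppcoef. destruct (isp (S n)); [|ring].
  unfold lgterm. rewrite Cpow_mult_l, cpow_neg_cexp, <- cexp_mul_nat. unfold logpp.
  replace (- (s * RtoC (INR (S m) * ln (INR (S n)))))%C with
    (INR (S m) * (- (s * RtoC (ln (INR (S n))))))%C by (rewrite RtoC_mult; ring). ring.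
Qed.

Definition logsum (a : nat -> C) (s : C) : C :=
  CSer (fun n => CSer (fun m => Cmult (ppcoef a n m) (cexp (- (s * logpp n m))))).

Lemma ppcoef_cexp_mod a s n m : Cmod (ppcoef a n m * cexp (- (s * logpp n m))) =
  Cmod (ppcoef a n m) * exp (- Re s * logpp n m).
Proof.
  rewrite Cmod_mult, Cmod_cexp. f_equal. f_equal. destruct s as [u v]. simpl. ring.
Qed.

Lemma logsum_row a s n : (forall n, Cmod (a n) <= 1) -> 1 < Re s ->
  summ (fun m => Cmult (ppcoef a n m) (cexp (- (s * logpp n m)))) /\
  Cmod (CSer (fun m => Cmult (ppcoef a n m) (cexp (- (s * logpp n m))))) <= 2 * pw (Re s) (S n).
Proof.
  intros Ha Hs. destruct (ppcoef_row a (Re s) n Ha Hs) as [H1 H2].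
  assert (S1 : summ (fun m => Cmult (ppcoef a n m) (cexp (- (s * logpp n m))))).
  { eapply ex_series_ext; [|exact H1]. intros m. symmetry. apply ppcoef_cexp_mod. }
  split; auto. eapply Rle_trans; [apply Cmod_CSer; auto|].
  eapply Rle_trans; [|exact H2]. right. apply Series_ext. intros; apply ppcoef_cexp_mod.
Qed.

Lemma pw2_series s : 1 < s -> ex_series (fun n => 2 * pw s (S n)).
Proof.
  intros Hs. apply (ex_series_scal_l (V := R_NormedModule) 2 (fun n => pw s (S n))).
  apply pw_series; auto.
Qed.

Lemma logsum_summ a s : (forall n, Cmod (a n) <= 1) -> 1 < Re s ->
  summ (fun n => CSer (fun m => Cmult (ppcoef a n m) (cexp (- (s * logpp n m))))).
Proof.
  intros Ha Hs. apply (summ_le _ (fun n => 2 * pw (Re s) (S n))); [|apply pw2_series; auto].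
  intros n. apply logsum_row; auto.
Qed.

Section LogDirichlet.

Variables (a : nat -> C) (s : C).
Hypothesis Ha : completely_mult a.
Hypothesis Hs : 1 < Re s.

Let t (n : nat) : C := Cmult (a n) (cpow_neg n s).

Local Lemma t_1 : t 1%nat = 1.
Proof. unfold t. rewrite (proj1 Ha), cpow_neg_1. ring. Qed.

Local Lemma t_mult m n : (0 < m)%nat -> (0 < n)%nat -> t (m * n)%nat = Cmult (t m) (t n).
Proof.
  intros Hm Hn. unfold t. rewrite (proj1 (proj2 Ha)), cpow_neg_mult by auto. ring.
Qed.

Local Lemma t_lt n : (2 <= n)%nat -> Cmod (t n) < 1.
Proof.
  intros Hn. unfold t. rewrite Cmod_mult, Cmod_cpow_neg.
  pose proof (pw_half (Re s) n Hs Hn) as H. unfold pw in H.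
  pose proof (proj2 (proj2 Ha) n) as H1. pose proof (Cmod_ge_0 (a n)). nra.
Qed.

Lemma dirser_nonzero : dirser a s <> 0.
Proof.
  apply (euler_nonzero t t_1 t_mult). apply dirser_summ; auto. apply Ha.
Qed.

Lemma log_dirser : ln (Cmod (dirser a s)) = Re (logsum a s).
Proof.
  assert (Ha1 := proj2 (proj2 Ha)).
  pose proof (euler_log t t_1 t_mult (dirser_summ a s Ha1 Hs) t_lt) as H.
  apply is_series_unique in H. unfold dirser. unfold t in H. rewrite <- H.
  unfold logsum. rewrite Re_CSer. apply Series_ext. intros n. rewrite Re_CSer.
  destruct (isp (S n)) eqn:E.
  - rewrite ln_series by (apply (t_lt (S n)), isp_ge_2; auto).
    rewrite Re_CSer. apply Series_ext. intros m. rewrite ppcoef_lgterm, E. auto.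
  - symmetry. apply is_series_unique, rsum_lim.
    eapply is_lim_seq_ext; [|apply is_lim_seq_const].
    intros k. rewrite (rsum_ext _ (fun _ => 0)); [rewrite rsum_const; ring|].
    intros i _. rewrite ppcoef_lgterm, E. auto.
Qed.

End LogDirichlet.

Section LogPS.

Variables (a : nat -> C) (A r : R).
Hypothesis Ha : forall n, Cmod (a n) <= 1.
Hypothesis Hr : 0 < r < A - 1.

Local Lemma gcp_row n : ex_series (fun k => Cmod (gcp a A n k) * r ^ k) /\
  Series (fun k => Cmod (gcp a A n k) * r ^ k) <= 2 * pw (A - r) (S n).
Proof.
  destruct (ppcoef_row a (A - r) n Ha ltac:(lra)) as [H1 H2].
  destruct (fam_bound (ppcoef a n) (logpp n) A r) as [H3 H4]; [apply logpp_ge_0|lra|exact H1|].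
  split; auto. unfold gcp. lra.
Qed.

Local Lemma gcp_pos n k : 0 <= Cmod (gcp a A n k) * r ^ k.
Proof. apply Rmult_le_pos; [apply Cmod_ge_0|apply pow_le; lra]. Qed.

Local Lemma gcp_tot : ex_series (fun n => Series (fun k => Cmod (gcp a A n k) * r ^ k)).
Proof.
  eapply ex_series_le_pos; [|apply (pw2_series (A - r)); lra].
  intros n. split; [apply Series_ge_0; [apply gcp_pos|]|]; apply gcp_row.
Qed.

Lemma gco_summ k : summ (fun n => gcp a A n k).
Proof.
  assert (Hk : 0 < r ^ k) by (apply pow_lt; lra).
  apply (summ_le _ (fun n => / r ^ k * (2 * pw (A - r) (S n)))).
  - intros n. apply Rmult_le_reg_r with (r ^ k); auto.
    replace (/ r ^ k * (2 * pw (A - r) (S n)) * r ^ k) with (2 * pw (A - r) (S n)) by (field; lra).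
    eapply Rle_trans; [|apply (gcp_row n)].
    apply (series_pbd (gcp a A n) r ltac:(lra) (proj1 (gcp_row n))).
  - apply (ex_series_scal_l (V := R_NormedModule) (/ r ^ k) (fun n => 2 * pw (A - r) (S n))).
    apply pw2_series; lra.
Qed.

Lemma gco_bd : exists B, pbd (gco a A) r B.
Proof.
  destruct (Fubini_pos (fun n k => Cmod (gcp a A n k) * r ^ k)) as [F1 F2].
  - apply gcp_pos.
  - intros; apply gcp_row.
  - apply gcp_tot.
  - assert (Hle : forall k, 0 <= Cmod (gco a A k) * r ^ k <=
      Series (fun n => Cmod (gcp a A n k) * r ^ k)).
    { intros k; split; [apply Rmult_le_pos; [apply Cmod_ge_0|apply pow_le; lra]|].
      rewrite Series_scal_r. apply Rmult_le_compat_r; [apply pow_le; lra|].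
      apply Cmod_CSer, gco_summ. }
    eexists. apply series_pbd; [lra|]. eapply ex_series_le_pos; [exact Hle|exact F1].
Qed.

Lemma gco_PS z : Cmod z <= r -> PS (gco a A) z = logsum a (A + z).
Proof.
  intros Hz.
  assert (Hrow : forall n k, Cmod (Cmult (gcp a A n k) (Cpow z k)) <= Cmod (gcp a A n k) * r ^ k).
  { intros n k. rewrite Cmod_mult, Cmod_pow. apply Rmult_le_compat_l; [apply Cmod_ge_0|].
    apply pow_incr; split; auto; apply Cmod_ge_0. }
  assert (Hrs : forall n, summ (fun k => Cmult (gcp a A n k) (Cpow z k))).
  { intros n. eapply summ_le; [apply Hrow|]. apply gcp_row. }
  destruct (Fubini (fun n k => Cmult (gcp a A n k) (Cpow z k))) as [H1 [H2 [H3 [H4 H5]]]].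
  - exact Hrs.
  - eapply ex_series_le_pos; [|exact gcp_tot]. intros n. cbv beta. split.
    + exact (Series_ge_0 _ (fun k => Cmod_ge_0 _) (Hrs n)).
    + apply Series_le; [intros k; split; [apply Cmod_ge_0|apply Hrow]|apply gcp_row].
  - unfold logsum. rewrite (CSer_ext _ (fun n => PS (gcp a A n) z)).
    + unfold PS at 2. rewrite H5. apply CSer_ext. intros k.
      unfold gco. rewrite Cmult_comm, <- CSer_scal by apply gco_summ.
      apply CSer_ext; intros; ring.
    + intros n. symmetry. apply (fam_PS (ppcoef a n) (logpp n) A r); auto; [apply logpp_ge_0|lra|].
      apply ppcoef_row; auto. lra.
Qed.

End LogPS.

Lemma ln_fco_gco a A z : completely_mult a -> Cmod z < A - 1 ->
  ln (Cmod (PS (fco a A) z)) = Re (PS (gco a A) z).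
Proof.
  intros Ha Hz. assert (Hp := Cmod_ge_0 z).
  assert (Ha1 := proj2 (proj2 Ha)).
  rewrite (fco_PS a A ((Cmod z + (A - 1)) / 2)), (gco_PS a A ((Cmod z + (A - 1)) / 2)); auto; try lra.
  apply log_dirser; auto.
  change (1 < A + Re z). pose proof (re_le_Cmod z) as H. apply Rabs_le_between in H. lra.
Qed.

Definition poisw (B : R) (K n m : nat) : R := pois B K (logpp n m).

(** The origin of the weights: with [B = A - 1], the product [ecf x A k * (- B)^k] is [exp (- x)]
    times the probability of [k] for a Poisson variable of mean [B x], since the signs cancel and
    [exp (- A x)] splits. At [x = m log p] the factor [exp (- x)] is [p^-m], as it should be at
    [s = 1]. *)
Lemma gco_partial a A K : (forall n, Cmod (a n) <= 1) -> 1 < A ->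
  csum (fun k => Cmult (gco a A k) (Cpow (RtoC (- (A - 1))) k)) K =
  CSer (fun n => CSer (fun m => Cmult (ppcoef a n m) (RtoC (exp (- logpp n m) * poisw (A - 1) K n m)))).
Proof.
  intros Ha HA.
  set (r := (A - 1) / 2). assert (Hr : 0 < r < A - 1) by (unfold r; lra).
  set (B := A - 1) in *. set (zk := fun k => Cpow (RtoC (- B)) k).
  assert (Sn : forall k, summ (fun n => Cmult (zk k) (gcp a A n k))).
  { intros k; apply summ_scal, (gco_summ a A r); auto. }
  assert (Sm : forall n k, summ (fun m => Cmult (ppcoef a n m) (RtoC (ecf (logpp n m) A k)))).
  { intros n k. apply (fam_summ (ppcoef a n) (logpp n) A r); [apply logpp_ge_0|lra|].
    apply ppcoef_row; auto. unfold B in *; lra. }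
  rewrite (csum_ext _ (fun k => CSer (fun n => Cmult (zk k) (gcp a A n k)))).
  2: { intros k _. rewrite CSer_scal by (apply (gco_summ a A r); auto). unfold gco, zk. ring. }
  rewrite <- (proj2 (CSer_csum (fun k n => Cmult (zk k) (gcp a A n k)) K (fun i _ => Sn i))).
  apply CSer_ext. intros n.
  rewrite (csum_ext _ (fun k => CSer (fun m => Cmult (zk k) (Cmult (ppcoef a n m) (RtoC (ecf (logpp n m) A k)))))).
  2: { intros k _. rewrite CSer_scal by auto. auto. }
  rewrite <- (proj2 (CSer_csum (fun k m => Cmult (zk k) (Cmult (ppcoef a n m) (RtoC (ecf (logpp n m) A k)))) K
     (fun i _ => summ_scal _ _ (Sm n i)))).
  apply CSer_ext. intros m. unfold poisw.
  generalize (logpp n m). intros x.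
  assert (E : forall k, Cmult (zk k) (Cmult (ppcoef a n m) (RtoC (ecf x A k))) =
     Cmult (ppcoef a n m) (RtoC (exp (- x) * pterm B k x))).
  { intros k. unfold zk, ecf, pterm. rewrite <- RtoC_pow.
    rewrite (Cmult_comm (RtoC ((- B) ^ k))), <- Cmult_assoc, <- RtoC_mult. f_equal. f_equal.
    replace (- A * x) with (- x + - B * x) by (unfold B; ring). rewrite exp_plus.
    replace (B * x) with ((- B) * (- x)) by ring. rewrite Rpow_mult_distr. unfold Rdiv; ring. }
  rewrite (csum_ext _ _ _ (fun k _ => E k)), csum_scal. f_equal.
  unfold pois. clear. induction K; cbn [csum rsum]; [f_equal; ring|].
  rewrite IHK, <- RtoC_plus. f_equal. ring.
Qed.

(** With [w = a(p)^m p^(- i m tau)], a prime power contributes a nonnegative factor times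
    [Re (3 + 4 w + w^2)], which is [2 (1 + Re w)^2] if [|w| = 1] and [3] if [w = 0]. Primes with
    [a p = 0] are thus harmless, and zeta can stand for the principal character. *)
Lemma three_four_one a sigma tau : completely_mult a -> (forall n, a n = 0 \/ Cmod (a n) = 1) -> 1 < sigma ->
  0 <= 3 * ln (Cmod (dirser (fun _ => RtoC 1) sigma)) + 4 * ln (Cmod (dirser a (sigma, tau))) +
       ln (Cmod (dirser (fun n => Cmult (a n) (a n)) (sigma, 2 * tau))).
Proof.
  intros Ha Hv Hs.
  assert (Ha1 := proj2 (proj2 Ha)).
  assert (H1 : completely_mult (fun _ => RtoC 1)).
  { repeat split; [intros; ring|intros; rewrite Cmod_1; lra]. }
  assert (H2 : completely_mult (fun n => Cmult (a n) (a n))).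
  { destruct Ha as [h1 [h2 h3]]. repeat split.
    - rewrite h1. ring.
    - intros; rewrite h2; ring.
    - intros n. rewrite Cmod_mult. specialize (h3 n). pose proof (Cmod_ge_0 (a n)). nra. }
  rewrite !log_dirser; auto.
  set (T1 := fun n m => Cmult (ppcoef (fun _ => RtoC 1) n m) (cexp (- (RtoC sigma * logpp n m)))).
  set (T2 := fun n m => Cmult (ppcoef a n m) (cexp (- ((sigma, tau) * logpp n m)))).
  set (T3 := fun n m => Cmult (ppcoef (fun n => Cmult (a n) (a n)) n m) (cexp (- ((sigma, 2 * tau) * logpp n m)))).
  assert (R1 : forall n, summ (T1 n)) by (intros; apply logsum_row; [apply H1|auto]).
  assert (R2 : forall n, summ (T2 n)) by (intros; apply logsum_row; auto).
  assert (R3 : forall n, summ (T3 n)) by (intros; apply logsum_row; [apply H2|auto]).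
  assert (S1 : summ (fun n => CSer (T1 n))) by (apply logsum_summ; [apply H1|auto]).
  assert (S2 : summ (fun n => CSer (T2 n))) by (apply logsum_summ; auto).
  assert (S3 : summ (fun n => CSer (T3 n))) by (apply logsum_summ; [apply H2|auto]).
  change (0 <= 3 * Re (CSer (fun n => CSer (T1 n))) + 4 * Re (CSer (fun n => CSer (T2 n))) +
    Re (CSer (fun n => CSer (T3 n)))).
  assert (E : 3 * Re (CSer (fun n => CSer (T1 n))) + 4 * Re (CSer (fun n => CSer (T2 n))) +
    Re (CSer (fun n => CSer (T3 n))) =
    Re (CSer (fun n => CSer (fun m => (3 * T1 n m + 4 * T2 n m + T3 n m)%C)))).
  { rewrite (CSer_ext (fun n => CSer (fun m => (3 * T1 n m + 4 * T2 n m + T3 n m)%C))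
      (fun n => (3 * CSer (T1 n) + 4 * CSer (T2 n) + CSer (T3 n))%C)).
    - rewrite !CSer_plus, !CSer_scal; auto;
        try (apply summ_plus; apply summ_scal; auto); try (apply summ_scal; auto).
      rewrite <- !Re_scal. reflexivity.
    - intros n. rewrite !CSer_plus, !CSer_scal; auto;
        try (apply summ_plus; apply summ_scal; auto); try (apply summ_scal; auto). }
  rewrite E, Re_CSer.
  assert (P : forall n m, 0 <= Re (3 * T1 n m + 4 * T2 n m + T3 n m)%C).
  { intros n m. unfold T1, T2, T3, ppcoef. destruct (isp (S n)); [|simpl; lra].
    set (x := logpp n m).
    assert (Ei : 0 < / INR (S m)) by (apply Rinv_0_lt_compat, lt_0_INR; lia).
    set (iv := / INR (S m)) in *.
    set (w := (Cpow (a (S n)) (S m) * cis (- (tau * x)))%C).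
    assert (Ex1 : cexp (- (RtoC sigma * x)) = RtoC (exp (- (sigma * x)))).
    { apply C_eq; simpl; rewrite ?Rmult_0_l, ?Rmult_0_r, ?Rplus_0_r, ?Rminus_0_r, ?Ropp_0, ?cos_0, ?sin_0; ring. }
    assert (Ex2 : forall y, cexp (- ((sigma, y) * x)) = Cmult (RtoC (exp (- (sigma * x)))) (cis (- (y * x)))).
    { intros y. rewrite cexp_cis. simpl. f_equal; [f_equal; f_equal; ring|f_equal; ring]. }
    rewrite Ex1, !Ex2, Cpow_1_l, Cpow_mult_l.
    replace (- (2 * tau * x)) with (- (tau * x) + - (tau * x)) by ring. rewrite cis_add.
    replace (3 * (iv * 1 * exp (- (sigma * x))) +
      4 * (iv * Cpow (a (S n)) (S m) * (exp (- (sigma * x)) * cis (- (tau * x)))) +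
      iv * (Cpow (a (S n)) (S m) * Cpow (a (S n)) (S m)) *
        (exp (- (sigma * x)) * (cis (- (tau * x)) * cis (- (tau * x)))))%C with
      (RtoC (iv * exp (- (sigma * x))) * (3 + 4 * w + w * w))%C by (rewrite RtoC_mult; unfold w; ring).
    rewrite Re_scal. apply Rmult_le_pos.
    { apply Rmult_le_pos; [lra|apply Rlt_le, exp_pos]. }
    assert (Hw : w = 0 \/ Cmod w = 1).
    { unfold w. destruct (Hv (S n)) as [Z|Z].
      - left. rewrite Z. simpl. ring.
      - right. rewrite Cmod_mult, Cmod_cis, Cmod_pow, Z, pow1. ring. }
    destruct Hw as [-> | Hw]; [simpl; lra|].
    assert (Hq : Re w ^ 2 + Im w ^ 2 = 1) by (rewrite <- Cmod2_alt, Hw; ring).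
    replace (Re (3 + 4 * w + w * w)%C) with (3 + 4 * Re w + (Re w * Re w - Im w * Im w)).
    - nra.
    - destruct w; simpl; ring. }
  assert (Hr : forall n, ex_series (fun m => Re (3 * T1 n m + 4 * T2 n m + T3 n m)%C)).
  { intros n. apply summ_Re. apply summ_plus; auto. apply summ_plus; apply summ_scal; auto. }
  apply Series_ge_0; [intros n; rewrite Re_CSer; apply Series_ge_0; [apply P|apply Hr]|].
  apply (summ_Re (fun n => CSer (fun m => (3 * T1 n m + 4 * T2 n m + T3 n m)%C))).
  eapply (summ_ext (fun n => (3 * CSer (T1 n) + 4 * CSer (T2 n) + CSer (T3 n))%C)).
  - intros n. rewrite !CSer_plus, !CSer_scal; auto;
        try (apply summ_plus; apply summ_scal; auto); try (apply summ_scal; auto).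
  - apply summ_plus; auto. apply summ_plus; apply summ_scal; auto.
Qed.

(** * Series with bounded partial sums *)

(** Summation by parts: the weights [u N] and [u n - u (n+1)] are nonnegative and add up to
    [u 0]. *)
Lemma abel_decr (c : nat -> C) (u : nat -> R) Q N : (forall N, Cmod (csum c N) <= Q) ->
  (forall n, 0 <= u n) -> (forall n, u (S n) <= u n) ->
  Cmod (csum (fun n => Cmult (c n) (RtoC (u n))) N) <= Q * u 0%nat.
Proof.
  intros HQ Hu Hd.
  assert (E : csum (fun n => Cmult (c n) (RtoC (u n))) N =
    Cplus (Cmult (csum c N) (RtoC (u N))) (csum (fun n => Cmult (csum c (S n)) (RtoC (u n - u (S n)))) N)).
  { induction N; [simpl; ring|]. cbn [csum] in *. rewrite IHN, RtoC_minus. ring. }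
  rewrite E. eapply Rle_trans; [apply Cmod_triangle|].
  assert (H1 : Cmod (csum c N * RtoC (u N)) <= Q * u N).
  { rewrite Cmod_mult, Cmod_R, Rabs_pos_eq by auto. apply Rmult_le_compat_r; auto. }
  assert (H2 : Cmod (csum (fun n => Cmult (csum c (S n)) (RtoC (u n - u (S n)))) N) <= Q * (u 0%nat - u N)).
  { clear E H1. eapply Rle_trans; [apply Cmod_csum|].
    assert (T : forall n, rsum (fun n => Q * (u n - u (S n))) n = Q * (u 0%nat - u n)).
    { induction n; simpl; [ring|rewrite IHn; ring]. }
    rewrite <- T. apply rsum_le. intros i _. rewrite Cmod_mult, Cmod_R, Rabs_pos_eq.
    - apply Rmult_le_compat_r; auto. specialize (Hd i); lra.
    - specialize (Hd i); lra. }
  lra.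
Qed.

Lemma ecf_pois x A k : ecf x A k * A ^ k = (-1) ^ k * (pois A (S k) x - pois A k x).
Proof.
  unfold pois. simpl rsum. unfold pterm, ecf.
  replace (- x) with ((-1) * x) by ring. rewrite !Rpow_mult_distr. unfold Rdiv. ring.
Qed.

Lemma ln_INR_mono n : ln (INR (S n)) <= ln (INR (S (S n))).
Proof. apply ln_le; [apply lt_0_INR; lia|apply le_INR; lia]. Qed.

Lemma dpartial_csum a s N : dpartial a s N = csum (fun n => Cmult (a (S n)) (cpow_neg (S n) s)) N.
Proof. induction N; simpl; auto. rewrite IHN; auto. Qed.

Lemma neg_one_pow_abs k : Rabs ((-1) ^ k) = 1.
Proof. rewrite <- RPow_abs, Rabs_left by lra. rewrite <- (pow1 k). f_equal; lra. Qed.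

(* Up to the sign [(-1)^k], [ecf x A k * A ^ k] is the difference of two decreasing functions of [x]
   with values in [[0, 1]], so partial summation bounds the Taylor coefficients. *)
Section BoundedSums.

Variables (a : nat -> C) (A Q : R).
Hypothesis Ha : forall n, Cmod (a n) <= 1.
Hypothesis HQ : forall N, Cmod (csum (fun n => a (S n)) N) <= Q.
Hypothesis HA : 1 < A.

Let fN (N k : nat) : C := csum (fun n => Cmult (a (S n)) (RtoC (ecf (ln (INR (S n))) A k))) N.

Local Lemma Q_ge_0 : 0 <= Q.
Proof. eapply Rle_trans; [apply Cmod_ge_0|apply (HQ 0)]. Qed.

(** Uniformity in [N] matters: the same bound passes to the limit coefficients and serves as
    majorant in [dpartial_lim]. *)
Local Lemma fN_bound N k : Cmod (fN N k) * A ^ k <= 2 * Q.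
Proof.
  assert (HAk : 0 < A ^ k) by (apply pow_lt; lra).
  rewrite <- (Rabs_pos_eq (A ^ k)) by lra. rewrite <- Cmod_R, <- Cmod_mult.
  assert (E : (fN N k * RtoC (A ^ k))%C = (RtoC ((-1) ^ k) *
    (csum (fun n => a (S n) * RtoC (pois A (S k) (ln (INR (S n))))) N -
     csum (fun n => a (S n) * RtoC (pois A k (ln (INR (S n))))) N))%C).
  { unfold fN. rewrite <- csum_minus, <- csum_scal, Cmult_comm, <- csum_scal.
    apply csum_ext. intros n _.
    replace (RtoC (A ^ k) * (a (S n) * RtoC (ecf (ln (INR (S n))) A k)))%C with
      (a (S n) * RtoC (ecf (ln (INR (S n))) A k * A ^ k))%C by (rewrite RtoC_mult; ring).
    rewrite ecf_pois, RtoC_mult, RtoC_minus. ring. }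
  rewrite E, Cmod_mult, Cmod_R, neg_one_pow_abs, Rmult_1_l.
  eapply Rle_trans; [apply (Cmod_triangle _ (- _))|]. rewrite Cmod_opp.
  assert (HH : forall K, Cmod (csum (fun n => a (S n) * RtoC (pois A K (ln (INR (S n)))))%C N) <= Q * 1).
  { intros K. eapply Rle_trans.
    - apply (abel_decr (fun n => a (S n)) (fun n => pois A K (ln (INR (S n)))) Q N HQ).
      + intros n. apply pois_bounds, Rmult_le_pos; [lra|apply ln_INR_ge_0].
      + intros n. apply pois_decr; [lra|]. split; [apply ln_INR_ge_0|apply ln_INR_mono].
    - apply Rmult_le_compat_l; [apply Q_ge_0|]. apply pois_bounds.
      apply Rmult_le_pos; [lra|apply ln_INR_ge_0]. }
  pose proof (HH (S k)); pose proof (HH k). lra.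
Qed.

Local Lemma fN_lim k : Clim (fun N => fN N k) (fco a A k).
Proof. apply CSer_lim, (fco_summ a A ((A - 1) / 2)); auto; lra. Qed.

(** The radius is [A], against radii below [A - 1] in [fco_bd]: this is the continuation of the
    series from [Re s > 1] to a disc reaching up to the line [Re s = 0]. *)
Lemma fco_bd_full : pbd (fco a A) A (2 * Q).
Proof.
  intros k. assert (HAk : 0 < A ^ k) by (apply pow_lt; lra).
  apply Rmult_le_reg_r with (/ A ^ k); [apply Rinv_0_lt_compat; auto|].
  rewrite Rmult_assoc, Rinv_r, Rmult_1_r by lra.
  apply (Clim_bound (fun N => fN N k)); [|apply fN_lim].
  intros N. apply Rmult_le_reg_r with (A ^ k); auto.
  rewrite Rmult_assoc, Rinv_l, Rmult_1_r by lra. apply fN_bound.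
Qed.

(** A finite Dirichlet sum is entire, with Taylor coefficients [fN N k] bounded by [2 Q / A^k];
    dominated convergence over [k] lets [N] tend to infinity in the whole disc. This ties the power
    series to the partial sums in which [GRH] and [L1] are phrased. *)
Lemma dpartial_lim z : Cmod z < A -> Clim (dpartial a (A + z)) (PS (fco a A) z).
Proof.
  intros Hz.
  assert (E : forall N, CSer (fun k => Cmult (fN N k) (Cpow z k)) = dpartial a (A + z) N).
  { intros N. rewrite dpartial_csum.
    set (b := fun n k => Cmult (a (S n)) (Cmult (RtoC (ecf (ln (INR (S n))) A k)) (Cpow z k))).
    assert (Sb : forall n, summ (b n)) by (intros n; apply summ_scal, ecf_PS).
    rewrite (CSer_ext _ (fun k => csum (fun n => b n k) N)).
    - rewrite (proj2 (CSer_csum b N (fun i _ => Sb i))). apply csum_ext. intros n _.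
      unfold b. rewrite CSer_scal by apply ecf_PS. f_equal.
      rewrite cpow_neg_cexp. apply ecf_PS.
    - intros k. unfold fN, b. rewrite Cmult_comm, <- csum_scal. apply csum_ext. intros; ring. }
  eapply Clim_ext; [exact E|].
  apply (Tannery (fun N k => Cmult (fN N k) (Cpow z k)) (fun k => Cmult (fco a A k) (Cpow z k))
    (fun k => 2 * Q * (Cmod z / A) ^ k)).
  - intros N k. rewrite Cmod_mult, Cmod_pow. unfold Rdiv. rewrite Rpow_mult_distr, pow_inv.
    assert (HAk : 0 < A ^ k) by (apply pow_lt; lra).
    replace (Cmod (fN N k) * Cmod z ^ k) with (Cmod (fN N k) * A ^ k * (Cmod z ^ k * / A ^ k)) by (field; lra).
    apply Rmult_le_compat_r; [|apply fN_bound].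
    apply Rle_mult_inv_pos; auto. apply pow_le, Cmod_ge_0.
  - apply (ex_series_scal_l (V := R_NormedModule)), ex_series_geom.
    rewrite Rabs_pos_eq by (apply Rle_mult_inv_pos; [apply Cmod_ge_0|lra]).
    apply Rmult_lt_reg_r with A; [lra|]. unfold Rdiv; rewrite Rmult_assoc, Rinv_l; lra.
  - intros k. apply Clim_mult; [apply fN_lim|apply Clim_const].
Qed.

Lemma PS_dirser z : Cmod z < A -> 1 < A + Re z -> PS (fco a A) z = dirser a (A + z).
Proof.
  intros Hz Hs. eapply Clim_unique; [apply dpartial_lim; auto|].
  eapply Clim_ext; [intros N; symmetry; apply dpartial_csum|].
  apply CSer_lim, dirser_summ; auto.
Qed.

End BoundedSums.

(** Any given point of the line [Re s = 1] lies in the disc of radius [A] about [A] once [A] is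
    large. *)
Lemma disc_radius A tau : 1 < A -> 1 + tau ^ 2 < 2 * A -> Cmod (A - 1, tau) < A.
Proof.
  intros HA Ht. unfold Cmod. simpl fst; simpl snd.
  rewrite <- (sqrt_pow2 A) at 2 by lra. apply sqrt_lt_1_alt. split; [nra|nra].
Qed.

Lemma disc_segment A sigma tau tau' : 2 <= A -> 1 <= sigma <= 2 -> Rabs tau <= Rabs tau' ->
  Cmod ((sigma, tau) - RtoC A) <= Cmod (A - 1, tau').
Proof.
  intros HA Hs Ht. unfold Cmod. simpl fst; simpl snd. apply sqrt_le_1_alt.
  assert (tau ^ 2 <= tau' ^ 2).
  { rewrite <- (pow2_abs tau), <- (pow2_abs tau'). apply pow_incr. split; [apply Rabs_pos|auto]. }
  assert ((sigma + - A) ^ 2 <= (A - 1) ^ 2).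
  { rewrite <- (pow2_abs (sigma + - A)). apply pow_incr. split; [apply Rabs_pos|].
    apply Rabs_le; lra. }
  simpl in *. nra.
Qed.

(** At real part [1 + h] zeta is at most [2 / h], a zero at [1 + i tau] makes the second factor at
    most [(L + 1) h], and the third stays bounded. With exponents [3], [4], [1] their product is
    [O(h)], against [three_four_one]. *)
Lemma nonvanishing_line a Q Q2 tau : completely_mult a -> (forall n, a n = 0 \/ Cmod (a n) = 1) ->
  (forall N, Cmod (csum (fun n => a (S n)) N) <= Q) ->
  (forall N, Cmod (csum (fun n => Cmult (a (S n)) (a (S n))) N) <= Q2) ->
  ~ Clim (dpartial a (1, tau)) 0.
Proof.
  intros Ha Hv HQ HQ2 HZ.
  assert (Ha1 := proj2 (proj2 Ha)).
  set (a2 := fun n => Cmult (a n) (a n)).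
  assert (Ha2 : forall n, Cmod (a2 n) <= 1).
  { intros n. unfold a2. rewrite Cmod_mult. specialize (Ha1 n). pose proof (Cmod_ge_0 (a n)). nra. }
  assert (Hc2 : completely_mult a2).
  { destruct Ha as [h1 [h2 h3]]. repeat split; auto; unfold a2.
    - rewrite h1. ring.
    - intros; rewrite h2; ring. }
  (* Since [1 + (2 tau)^2 < 2 A], the disc about [A] contains [1 + 2 i tau] as well as
     [1 + i tau]. *)
  set (A := 2 + 2 * tau ^ 2).
  assert (Ht2 : 0 <= tau ^ 2) by apply pow2_ge_0.
  assert (HA : 2 <= A) by (unfold A; lra).
  set (R1 := Cmod (A - 1, 2 * tau)).
  assert (HR1 : R1 < A).
  { apply disc_radius; [lra|]. unfold A. replace ((2 * tau) ^ 2) with (4 * tau ^ 2) by ring. lra. }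
  assert (HR0 : 0 < R1).
  { unfold R1. apply Cmod_gt_0. intros E. apply (f_equal Re) in E. simpl in E. lra. }
  assert (Habs : Rabs tau <= Rabs (2 * tau)).
  { rewrite Rabs_mult, (Rabs_pos_eq 2) by lra. pose proof (Rabs_pos tau); lra. }
  assert (Hin1 : forall s, 1 <= s <= 2 -> Cmod ((s, tau) - RtoC A) <= R1).
  { intros s Hs. apply disc_segment; auto. }
  assert (Hin2 : forall s, 1 <= s <= 2 -> Cmod ((s, 2 * tau) - RtoC A) <= R1).
  { intros s Hs. apply disc_segment; auto; lra. }
  assert (U1 : Udiff (fun z => Cmod z <= R1) (PS (fco a A)) (PS (dco (fco a A)))).
  { apply (PS_Udiff _ A (2 * Q)); [apply fco_bd_full; auto; lra|lra]. }
  assert (U2 : Udiff (fun z => Cmod z <= R1) (PS (fco a2 A)) (PS (dco (fco a2 A)))).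
  { apply (PS_Udiff _ A (2 * Q2)); [apply fco_bd_full; auto; lra|lra]. }
  destruct (Udiff_lip _ _ _ (2 * R1) U1 (disc_diam R1)) as [L [HL HL2]].
  destruct U2 as [B2 [HB2 [HB2b _]]].
  assert (Es : forall w : C, (RtoC A + (w - RtoC A))%C = w) by (intros; ring).
  assert (Z0 : PS (fco a A) ((1, tau) - RtoC A) = 0).
  { eapply Clim_unique; [|exact HZ].
    pose proof (dpartial_lim a A Q Ha1 HQ ltac:(lra) ((1, tau) - RtoC A)) as H.
    rewrite Es in H. apply H. eapply Rle_lt_trans; [apply Hin1; lra|auto]. }
  (* Chosen so that [(2 / h)^3 * ((L + 1) * h)^4 * (B2 + 1)] equals [1 / 2]. *)
  set (h := / (16 * (L + 1) ^ 4 * (B2 + 1))).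
  assert (HL4 : 1 <= (L + 1) ^ 4) by (apply pow_R1_Rle; lra).
  assert (Hden : 16 <= 16 * (L + 1) ^ 4 * (B2 + 1)) by nra.
  assert (Hh : 0 < h) by (apply Rinv_0_lt_compat; lra).
  assert (Hh1 : h <= 1).
  { unfold h. rewrite <- Rinv_1. apply Rinv_le_contravar; lra. }
  set (s := 1 + h).
  assert (F1 : PS (fco a A) ((s, tau) - RtoC A) = dirser a (s, tau)).
  { rewrite <- (Es (s, tau)) at 2. apply (PS_dirser a A Q); auto; [lra| |].
    - eapply Rle_lt_trans; [apply Hin1; unfold s; lra|auto].
    - simpl. unfold s; lra. }
  assert (F2 : PS (fco a2 A) ((s, 2 * tau) - RtoC A) = dirser a2 (s, 2 * tau)).
  { rewrite <- (Es (s, 2 * tau)) at 2. apply (PS_dirser a2 A Q2); auto; [lra| |].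
    - eapply Rle_lt_trans; [apply Hin2; unfold s; lra|auto].
    - simpl. unfold s; lra. }
  assert (Hs1 : 1 < s) by (unfold s; lra).
  assert (B1 : Cmod (dirser a (s, tau)) <= (L + 1) * h).
  { rewrite <- F1.
    pose proof (HL2 ((1, tau) - RtoC A)%C ((s, tau) - RtoC A)%C (Hin1 1 ltac:(lra)) (Hin1 s ltac:(unfold s; lra))) as H.
    rewrite Z0 in H.
    replace (PS (fco a A) ((s, tau) - A) - 0)%C with (PS (fco a A) ((s, tau) - A)) in H by ring.
    replace ((s, tau) - A - ((1, tau) - A))%C with (RtoC h) in H
      by (apply C_eq; simpl; unfold s; ring).
    rewrite Cmod_R, Rabs_pos_eq in H by lra. nra. }
  assert (B2' : Cmod (dirser a2 (s, 2 * tau)) <= B2 + 1).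
  { rewrite <- F2. destruct (HB2b ((s, (2 * tau)%R) - RtoC A)%C) as [H _]; [apply Hin2; unfold s; lra|lra]. }
  assert (B3 : Cmod (dirser (fun _ => RtoC 1) s) <= 2 / h).
  { assert (H1 : forall n : nat, Cmod (RtoC 1) <= 1) by (intros; rewrite Cmod_1; lra).
    eapply Rle_trans; [apply Cmod_CSer, (dirser_summ (fun _ => RtoC 1)); auto|].
    destruct (pw_series s Hs1) as [P1 P2].
    rewrite (Series_ext _ (fun n => pw s (S n))).
    - eapply Rle_trans; [exact P2|]. replace (s - 1) with h by (unfold s; ring).
      assert (1 <= / h) by (rewrite <- Rinv_1; apply Rinv_le_contravar; lra). unfold Rdiv; lra.
    - intros n. rewrite Cmod_mult, Cmod_1, Cmod_cpow_neg. simpl Re. unfold pw. ring. }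
  pose proof (three_four_one a s tau Ha Hv Hs1) as T. fold a2 in T.
  assert (N1 : 0 < Cmod (dirser a (s, tau))) by (apply Cmod_gt_0, dirser_nonzero; auto).
  assert (N2 : 0 < Cmod (dirser a2 (s, 2 * tau))) by (apply Cmod_gt_0, dirser_nonzero; auto).
  assert (N3 : 0 < Cmod (dirser (fun _ => RtoC 1) s)).
  { apply Cmod_gt_0, dirser_nonzero; auto. repeat split; [intros; ring|intros; rewrite Cmod_1; lra]. }
  apply ln_le in B1; auto. apply ln_le in B2'; auto. apply ln_le in B3; auto.
  unfold Rdiv in B3. rewrite ln_mult, ln_Rinv in B3; try lra; [|apply Rinv_0_lt_compat; auto].
  rewrite ln_mult in B1 by lra.
  assert (E : ln h = - (ln 16 + 4 * ln (L + 1) + ln (B2 + 1))).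
  { unfold h. rewrite ln_Rinv by lra. rewrite !ln_mult, ln_pow by lra. simpl INR. ring. }
  assert (E16 : ln 16 = 4 * ln 2).
  { replace 16 with (2 ^ 4) by ring. rewrite ln_pow by lra. simpl INR. ring. }
  assert (P2 : 0 < ln 2) by (rewrite <- ln_1; apply ln_increasing; lra).
  lra.
Qed.

(** * Characters of odd prime order *)

Definition lsum (f : nat -> C) (l : list nat) : C := fold_right (fun x s => Cplus (f x) s) (RtoC 0) l.

Lemma lsum_perm f l l' : Permutation l l' -> lsum f l = lsum f l'.
Proof. induction 1; simpl; auto; [rewrite IHPermutation; auto|ring|congruence]. Qed.

Lemma lsum_map f g l : lsum f (map g l) = lsum (fun x => f (g x)) l.
Proof. induction l; simpl; auto. rewrite IHl; auto. Qed.

Lemma lsum_csum f n : lsum f (seq 0 n) = csum f n.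
Proof.
  assert (H : forall l1 l2, lsum f (l1 ++ l2) = Cplus (lsum f l1) (lsum f l2)).
  { induction l1; intros; simpl; [ring|rewrite IHl1; ring]. }
  induction n; auto. rewrite seq_S, H, IHn. simpl. ring.
Qed.

Lemma mul_mod_perm q m : (0 < q)%nat -> Nat.gcd m q = 1%nat ->
  Permutation (map (fun n => (m * n) mod q)%nat (seq 0 q)) (seq 0 q).
Proof.
  intros Hq Hg. apply NoDup_Permutation_bis.
  - apply NoDup_map_NoDup_ForallPairs; [|apply seq_NoDup].
    assert (ppweight : forall x y, (x <= y < q)%nat -> ((m * x) mod q = (m * y) mod q)%nat -> x = y).
    { intros x y Hxy E.
      assert (D : Nat.divide q (m * (y - x))).
      { exists ((m * y) / q - (m * x) / q)%nat.
        pose proof (Nat.div_mod_eq (m * y) q). pose proof (Nat.div_mod_eq (m * x) q).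
        rewrite Nat.mul_sub_distr_r, Nat.mul_sub_distr_l. lia. }
      apply Nat.gauss in D; [|rewrite Nat.gcd_comm; auto].
      destruct (Nat.eq_dec (y - x) 0); [lia|].
      apply Nat.divide_pos_le in D; lia. }
    intros x y Hx Hy E. apply in_seq in Hx. apply in_seq in Hy.
    destruct (Nat.le_ge_cases x y); [apply ppweight; auto; lia|symmetry; apply ppweight; auto; lia].
  - rewrite length_map. auto.
  - intros x Hx. apply in_map_iff in Hx. destruct Hx as [n [<- _]].
    apply in_seq. split; [lia|]. simpl. apply Nat.mod_upper_bound. lia.
Qed.

Section PeriodicSums.

Variables (psi : nat -> C) (q : nat).
Hypothesis Hq : (2 <= q)%nat.
Hypothesis Hper : forall n, psi (n + q)%nat = psi n.
Hypothesis Hmul : forall m n, psi (m * n)%nat = Cmult (psi m) (psi n).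
Hypothesis H0 : psi 0%nat = 0.
Hypothesis Hb : forall n, Cmod (psi n) <= 1.
Hypothesis Hnp : exists m, Nat.gcd m q = 1%nat /\ psi m <> 1.

Local Lemma per_mult n k : psi (n + k * q)%nat = psi n.
Proof.
  induction k; [f_equal; lia|].
  replace (n + S k * q)%nat with (n + k * q + q)%nat by lia. rewrite Hper; auto.
Qed.

Local Lemma per_mod n : psi (n mod q)%nat = psi n.
Proof.
  rewrite (Nat.div_mod_eq n q) at 2.
  replace (q * (n / q) + n mod q)%nat with (n mod q + (n / q) * q)%nat by lia.
  symmetry. apply per_mult.
Qed.

(** Multiplication by [m] permutes the residues modulo [q], so the sum equals [psi m] times
    itself. *)
Local Lemma period_sum : csum psi q = 0.
Proof.
  destruct Hnp as [m [Hm1 Hm2]].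
  assert (E : Cmult (psi m) (csum psi q) = csum psi q).
  { rewrite <- csum_scal. rewrite <- (lsum_csum psi), <- (lsum_perm psi _ _ (mul_mod_perm q m ltac:(lia) Hm1)).
    rewrite lsum_map, lsum_csum. apply csum_ext. intros. rewrite per_mod, Hmul; auto. }
  destruct (Ceq_dec (csum psi q) 0) as [|Hn]; auto. exfalso. apply Hm2.
  replace (psi m) with (psi m * csum psi q / csum psi q)%C by (field; auto). rewrite E. field; auto.
Qed.

Local Lemma csum_period N : csum psi N = csum psi (N mod q).
Proof.
  rewrite (Nat.div_mod_eq N q) at 1. generalize (N / q)%nat as k. intros k.
  induction k; [rewrite Nat.mul_0_r; auto|].
  replace (q * S k + N mod q)%nat with (q + (q * k + N mod q))%nat by lia.
  rewrite csum_app, period_sum, Cplus_0_l, <- IHk. apply csum_ext. intros.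
  rewrite Nat.add_comm. auto.
Qed.

Lemma periodic_sum_bound N : Cmod (csum (fun n => psi (S n)) N) <= INR q.
Proof.
  assert (E : csum (fun n => psi (S n)) N = csum psi (S N)).
  { change (S N) with (1 + N)%nat. rewrite csum_app. simpl csum. rewrite H0. ring. }
  rewrite E, csum_period.
  eapply Rle_trans; [apply Cmod_csum|].
  eapply Rle_trans; [apply (rsum_le _ (fun _ => 1)); intros; apply Hb|].
  rewrite rsum_const, Rmult_1_r. apply le_INR.
  pose proof (Nat.mod_upper_bound (S N) q). lia.
Qed.

End PeriodicSums.

Lemma cpow_Cpow z k : cpow z k = Cpow z k.
Proof. reflexivity. Qed.

Lemma Cmod_root_of_unity z l : (0 < l)%nat -> Cpow z l = 1 -> Cmod z = 1.
Proof.
  intros Hl E. apply (f_equal Cmod) in E. rewrite Cmod_pow, Cmod_1 in E.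
  assert (Hp := Cmod_ge_0 z). set (x := Cmod z) in *.
  destruct (Rtotal_order x 1) as [H|[H|H]]; auto; exfalso.
  - assert (x ^ l < 1); [|lra]. rewrite <- (pow1 l).
    destruct l as [|l]; [lia|]. simpl. rewrite pow1.
    assert (x ^ l <= 1) by (rewrite <- (pow1 l); apply pow_incr; lra).
    assert (0 <= x ^ l) by (apply pow_le; lra). nra.
  - assert (1 < x ^ l); [|lra]. apply Rlt_pow_R1; auto.
Qed.

Section Character.

Variables (l q : nat) (chi : nat -> C).
Hypothesis Hl : prime (Z.of_nat l).
Hypothesis Hl2 : l <> 2%nat.
Hypothesis Hchi : is_dirichlet_char q chi.
Hypothesis Hord : char_order q chi l.
Hypothesis Hq : (2 <= q)%nat.

Lemma l_ge_3 : (3 <= l)%nat.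
Proof. apply prime_ge_2 in Hl. lia. Qed.

Lemma char_val n : chi n = 0 \/ Cpow (chi n) l = 1.
Proof.
  destruct Hchi as [_ [_ [_ [_ H]]]]. destruct (Nat.eq_dec (Nat.gcd n q) 1) as [E|E].
  - right. rewrite <- cpow_Cpow. apply Hord; auto.
  - left. apply H; auto.
Qed.

Lemma char_val_mod n : chi n = 0 \/ Cmod (chi n) = 1.
Proof.
  destruct (char_val n) as [H|H]; auto. right. apply (Cmod_root_of_unity _ l); auto.
  pose proof l_ge_3; lia.
Qed.

Lemma char_le_1 n : Cmod (chi n) <= 1.
Proof. destruct (char_val_mod n) as [-> | ->]; [rewrite Cmod_0|]; lra. Qed.

Lemma char_cmult : completely_mult chi.
Proof. destruct Hchi as [_ [H1 [_ [H2 _]]]]. repeat split; auto. apply char_le_1. Qed.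

Local Lemma char_0 : chi 0%nat = 0.
Proof.
  destruct Hchi as [_ [_ [_ [_ H]]]]. apply H. rewrite Nat.gcd_0_l. lia.
Qed.

Lemma char_nonprincipal : ~ principal q chi.
Proof.
  intros Hp. destruct Hord as [_ [_ H]].
  destruct (H 1%nat) as [n [H1 H2]]; [pose proof l_ge_3; lia|].
  apply H2. rewrite (Hp n H1). simpl. ring.
Qed.

Lemma char_sums N : Cmod (csum (fun n => chi (S n)) N) <= INR q.
Proof.
  destruct Hchi as [_ [H1 [H2 _]]]. destruct Hord as [_ [_ H]].
  apply periodic_sum_bound; auto; [apply char_0|apply char_le_1|].
  destruct (H 1%nat) as [n [H3 H4]]; [pose proof l_ge_3; lia|].
  exists n. split; auto. intros E; apply H4. rewrite E. simpl; ring.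
Qed.

(** The order exceeds [2], so the square of [chi] is still nontrivial; for a quadratic character
    these sums would be unbounded. They are needed in [nonvanishing_line]. *)
Lemma char_sq_sums N : Cmod (csum (fun n => Cmult (chi (S n)) (chi (S n))) N) <= INR q.
Proof.
  destruct Hchi as [_ [H1 [H2 _]]]. destruct Hord as [_ [_ H]].
  apply (periodic_sum_bound (fun n => Cmult (chi n) (chi n))); auto.
  - intros; rewrite H2; auto.
  - intros; rewrite H1; ring.
  - rewrite char_0; ring.
  - intros n. rewrite Cmod_mult. pose proof (char_le_1 n). pose proof (Cmod_ge_0 (chi n)). nra.
  - destruct (H 2%nat) as [n [H3 H4]]; [pose proof l_ge_3; lia|].
    exists n. split; auto. intros E; apply H4. rewrite cpow_Cpow. simpl. rewrite Cmult_1_r. auto.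
Qed.

Hypothesis Hgrh : GRH.

Variable A : R.
Hypothesis HA : 2 <= A.

(** [A - 1/2] is the distance from [A] to the critical line, so [Re s > 1/2] throughout the disc,
    while [GRH] would force [Re s = 1/2] at a zero of the strip. *)
Lemma char_nonvanishing z : Cmod z < A - 1 / 2 -> PS (fco chi A) z <> 0.
Proof.
  intros Hz E.
  assert (Hre := re_le_Cmod z). apply Rabs_le_between in Hre.
  pose proof (dpartial_lim chi A (INR q) char_le_1 char_sums ltac:(lra) z ltac:(lra)) as HL.
  rewrite E in HL.
  assert (Hs : Re (A + z) = A + Re z) by reflexivity.
  destruct (Rtotal_order (A + Re z) 1) as [H|[H|H]].
  - assert (Re (A + z) = 1 / 2); [|lra].
    destruct Hgrh as [_ G]. apply (G q chi Hchi char_nonprincipal); [lra|]. exact HL.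
  - apply (nonvanishing_line chi (INR q) (INR q) (Im z) char_cmult char_val_mod char_sums char_sq_sums).
    replace (1, Im z) with (A + z)%C; auto. apply C_eq; simpl; auto. apply Rplus_0_l.
  - rewrite (PS_dirser chi A (INR q) char_le_1 char_sums) in E; auto; try lra.
    apply (dirser_nonzero chi (A + z)) in E; auto. apply char_cmult.
Qed.

(** In this disc [|z| / A <= 1 - 1 / (2 A)], so the geometric series of ratio [|z| / A] is at most
    [2 A]. *)
Local Lemma char_ln_bound z : Cmod z < A - 1 / 2 -> ln (Cmod (PS (fco chi A) z)) <= ln (4 * INR q * A).
Proof.
  intros Hz.
  assert (Hp := Cmod_ge_0 z).
  assert (Hq2 : 2 <= INR q) by (apply (le_INR 2); auto).
  pose proof (fco_bd_full chi A (INR q) char_le_1 char_sums ltac:(lra)) as Hbd.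
  apply ln_le; [apply Cmod_gt_0, char_nonvanishing; auto|].
  set (x := Cmod z / A).
  assert (HAi : 0 < / A) by (apply Rinv_0_lt_compat; lra).
  assert (Hx0 : 0 <= x) by (apply Rmult_le_pos; lra).
  assert (Hx1 : x <= 1 - / (2 * A)).
  { unfold x. apply Rmult_le_reg_r with A; [lra|]. field_simplify; lra. }
  assert (Hx2 : x < 1) by (assert (0 < / (2 * A)) by (apply Rinv_0_lt_compat; lra); lra).
  assert (Hg : is_series (fun k => 2 * INR q * x ^ k) (2 * INR q * / (1 - x))).
  { apply (is_series_scal_l (V := R_NormedModule)), is_series_geom. rewrite Rabs_pos_eq; lra. }
  eapply Rle_trans; [apply Cmod_CSer, (PS_summ _ A (2 * INR q)); auto; lra|].
  eapply Rle_trans; [apply (Series_le _ (fun k => 2 * INR q * x ^ k)); [|eexists; exact Hg]|].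
  - intros k. split; [apply Cmod_ge_0|]. rewrite Cmod_mult, Cmod_pow.
    assert (HAk : 0 < A ^ k) by (apply pow_lt; lra).
    unfold x, Rdiv. rewrite Rpow_mult_distr, pow_inv.
    replace (Cmod (fco chi A k) * Cmod z ^ k) with (Cmod (fco chi A k) * A ^ k * (Cmod z ^ k * / A ^ k)) by (field; lra).
    apply Rmult_le_compat_r; [|apply Hbd]. apply Rle_mult_inv_pos; auto. apply pow_le; auto.
  - rewrite (is_series_unique _ _ Hg).
    replace (4 * INR q * A) with (2 * INR q * (2 * A)) by ring.
    apply Rmult_le_compat_l; [lra|].
    rewrite <- (Rinv_inv (2 * A)). apply Rinv_le_contravar; [apply Rinv_0_lt_compat|]; lra.
Qed.

Local Lemma gco_0_bound : - 4 <= Re (gco chi A 0).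
Proof.
  rewrite <- PS_0. rewrite (gco_PS chi A ((A - 1) / 2) char_le_1) by (rewrite ?Cmod_0; lra).
  rewrite Cplus_0_r.
  assert (H : Cmod (logsum chi A) <= 4).
  { assert (HAr : 1 < Re (RtoC A)) by (simpl; lra).
    eapply Rle_trans; [apply Cmod_CSer, logsum_summ; auto; apply char_le_1|].
    destruct (pw_series A ltac:(lra)) as [P1 P2].
    eapply Rle_trans; [apply (Series_le _ (fun n => 2 * pw A (S n))); [|apply pw2_series; lra]|].
    - intros n; split; [apply Cmod_ge_0|]. apply (logsum_row chi (RtoC A) n char_le_1 HAr).
    - rewrite Series_scal_l.
      assert (/ (A - 1) <= 1) by (rewrite <- Rinv_1; apply Rinv_le_contravar; lra). lra. }
  pose proof (re_le_Cmod (logsum chi A)) as H2. apply Rabs_le_between in H2. lra.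
Qed.

Variable theta : R.
Hypothesis Hth : 0 < theta < 1 / 2.

(** The Taylor remainder at [z = - B] is dominated by a geometric series of ratio [B / (B + theta)];
    [theta < 1/2] keeps radius [B + theta] strictly inside the zero-free disc. [K >= 1] because
    Borel-Caratheodory bounds every coefficient except the constant one. *)
Lemma L1_approx K : (1 <= K)%nat -> 0 < Cmod (L1 chi) /\
  Rabs (ln (Cmod (L1 chi)) -
    Re (CSer (fun n => CSer (fun m => Cmult (ppcoef chi n m) (RtoC (exp (- logpp n m) * poisw (A - 1) K n m)))))) <=
  2 * (ln (4 * INR q * A) + 4) * ((A - 1) / (A - 1 + theta)) ^ K / (1 - (A - 1) / (A - 1 + theta)).
Proof.
  intros HK.
  set (B := A - 1). set (z := RtoC (- B)).
  assert (Hz : Cmod z = B) by (unfold z; rewrite Cmod_R, Rabs_Ropp, Rabs_pos_eq; unfold B; lra).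
  assert (HL : L1 chi = PS (fco chi A) z).
  { pose proof (dpartial_lim chi A (INR q) char_le_1 char_sums ltac:(lra) z ltac:(unfold B in *; lra)) as [H1 H2].
    replace (A + z)%C with (RtoC 1) in H1, H2 by (unfold z, B; rewrite <- RtoC_plus; f_equal; ring).
    unfold L1, dseries_val. apply is_lim_seq_unique in H1. apply is_lim_seq_unique in H2.
    apply C_eq; simpl; [rewrite H1|rewrite H2]; reflexivity. }
  rewrite HL. split; [apply Cmod_gt_0, char_nonvanishing; unfold B in *; lra|].
  (* A starting disc inside [Re s > 1], where the Euler product provides the logarithm; any radius
     below [A - 1] would serve. *)
  destruct (gco_bd chi A (1 / 2) char_le_1 ltac:(lra)) as [B0 HB0].
  pose proof (fco_bd_full chi A (INR q) char_le_1 char_sums ltac:(lra)) as Hf.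
  assert (Heq : forall w, Cmod w < 1 / 2 -> ln (Cmod (PS (fco chi A) w)) = Re (PS (gco chi A) w)).
  { intros w Hw. apply ln_fco_gco; [apply char_cmult|lra]. }
  pose proof (log_extend (fco chi A) (gco chi A) A (2 * INR q) (1 / 2) B0 (A - 1 / 2) Hf ltac:(lra) HB0
    ltac:(lra) char_nonvanishing Heq) as Hext.
  pose proof (fun k => log_coef_bound (fco chi A) (gco chi A) A (2 * INR q) (1 / 2) B0 (A - 1 / 2) Hf ltac:(lra) HB0
    ltac:(lra) char_nonvanishing Heq (ln (4 * INR q * A)) (B + theta) k char_ln_bound ltac:(unfold B; lra)) as Hcoef.
  destruct (log_radius (fco chi A) (gco chi A) A (2 * INR q) (1 / 2) B0 (A - 1 / 2) Hf ltac:(lra) HB0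
    ltac:(lra) char_nonvanishing Heq (B + theta) ltac:(unfold B; lra)) as [B1 HB1].
  rewrite Hext by (unfold B in *; lra).
  pose proof (gco_partial chi A K char_le_1 ltac:(lra)) as HP. fold B in HP. fold z in HP.
  rewrite <- HP. clear HP.
  set (M := 2 * (ln (4 * INR q * A) + 4)).
  assert (HM : forall k, (1 <= k)%nat -> Cmod (gco chi A k) * (B + theta) ^ k <= M).
  { intros k Hk. eapply Rle_trans; [apply Hcoef; lia|]. pose proof gco_0_bound. unfold M; lra. }
  assert (HM0 : 0 <= M).
  { eapply Rle_trans; [|apply (HM 1%nat); lia].
    apply Rmult_le_pos; [apply Cmod_ge_0|apply pow_le; unfold B; lra]. }
  assert (HB : 1 <= B) by (unfold B; lra).
  assert (Ss : summ (fun k => Cmult (gco chi A k) (Cpow z k))) by (eapply PS_summ; [exact HB1|lra]).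
  unfold PS. rewrite (CSer_split _ K Ss).
  change (Re (csum (fun k => gco chi A k * z ^ k)%C K + CSer (fun k => gco chi A (K + k) * z ^ (K + k)))%C) with
    (Re (csum (fun k => gco chi A k * z ^ k)%C K) + Re (CSer (fun k => gco chi A (K + k) * z ^ (K + k))%C)).
  match goal with |- Rabs (?u + ?v - ?u) <= _ => replace (u + v - u) with v by ring end.
  eapply Rle_trans; [apply re_le_Cmod|].
  set (rho := B / (B + theta)).
  assert (Hrho : 0 <= rho < 1).
  { unfold rho. split; [apply Rle_mult_inv_pos; lra|].
    apply Rmult_lt_reg_r with (B + theta); [lra|]. unfold Rdiv; rewrite Rmult_assoc, Rinv_l; lra. }
  assert (Hg : is_series (fun k => M * rho ^ K * rho ^ k) (M * rho ^ K * / (1 - rho))).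
  { apply (is_series_scal_l (V := R_NormedModule)), is_series_geom. rewrite Rabs_pos_eq; lra. }
  eapply Rle_trans; [apply Cmod_CSer, (summ_incr (fun k => Cmult (gco chi A k) (Cpow z k))), Ss|].
  eapply Rle_trans; [apply (Series_le _ (fun k => M * rho ^ K * rho ^ k)); [|eexists; exact Hg]|].
  - intros k. split; [apply Cmod_ge_0|]. rewrite Cmod_mult, Cmod_pow, Hz, Rmult_assoc, <- pow_add.
    set (j := (K + k)%nat).
    assert (Hj : 0 < (B + theta) ^ j) by (apply pow_lt; lra).
    unfold rho, Rdiv. rewrite Rpow_mult_distr, pow_inv.
    replace (Cmod (gco chi A j) * B ^ j) with (Cmod (gco chi A j) * (B + theta) ^ j * (B ^ j * / (B + theta) ^ j)) by (field; lra).
    apply Rmult_le_compat_r; [|apply HM; unfold j; lia]. apply Rle_mult_inv_pos; auto. apply pow_le; lra.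
  - rewrite (is_series_unique _ _ Hg). right. unfold Rdiv. auto.
Qed.

End Character.

(** * The zeta function near its pole *)

Definition one (n : nat) : C := RtoC 1.

Lemma one_cmult : completely_mult one.
Proof. repeat split; unfold one; intros; [ring|rewrite Cmod_1; lra]. Qed.

Lemma one_le_1 n : Cmod (one n) <= 1.
Proof. apply one_cmult. Qed.

Section Zeta.

Variable A : R.
Hypothesis HA : 2 <= A.
Let B := A - 1.

Let HB : 1 <= B.
Proof. unfold B; lra. Qed.

(* [J k] is a primitive of [x |-> pterm A k (ln x)]. *)
Let J (k : nat) (x : R) : R := - / B * (A / B) ^ k * pois B (S k) (ln x).

Local Lemma J_derive k x : 0 < x -> is_derive (J k) x (pterm A k (ln x)).
Proof.
  intros Hx. unfold J.
  assert (H1 : is_derive ln x (/ x)) by (apply is_derive_ln; auto).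
  pose proof (is_derive_comp (pois B (S k)) ln x _ _ (pois_derive B k (ln x)) H1) as H2.
  pose proof (is_derive_scal _ x (- / B * (A / B) ^ k) _ H2) as H3.
  evar_last; [exact H3|]. unfold scal; simpl. unfold mult; simpl.
  unfold pterm. unfold Rdiv. rewrite !Rpow_mult_distr, pow_inv.
  replace (- A * ln x) with (- B * ln x + - ln x) by (unfold B; ring).
  rewrite exp_plus, (exp_Ropp (ln x)), exp_ln by auto.
  pose proof (INR_fact_neq_0 k). assert (B ^ k <> 0) by (apply pow_nonzero; lra).
  field. repeat split; auto; lra.
Qed.

Local Lemma sum_J_derive k x : 0 < x -> is_derive (fun y => rsum (fun j => J j y) k) x (pois A k (ln x)).
Proof.
  intros Hx. induction k.
  - unfold pois; simpl. apply (is_derive_const (V := R_NormedModule)).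
  - unfold pois in *; simpl. apply (is_derive_plus (V := R_NormedModule)); auto. apply J_derive; auto.
Qed.

Let V k n := rsum (fun j => J j (INR n)) k.

Local Lemma V_step k n : pois A k (ln (INR (S (S n)))) <= V k (S (S n)) - V k (S n) <= pois A k (ln (INR (S n))).
Proof.
  assert (Hn : 0 < INR (S n)) by (apply lt_0_INR; lia).
  destruct (MVT_cor2 (fun y => rsum (fun j => J j y) k) (fun x => pois A k (ln x)) (INR (S n)) (INR (S (S n)))) as [c [E Hc]].
  - apply lt_INR; lia.
  - intros c Hc. apply is_derive_Reals, sum_J_derive. lra.
  - unfold V. rewrite E. replace (INR (S (S n)) - INR (S n)) with 1 by (rewrite (S_INR (S n)); ring).
    rewrite Rmult_1_r.
    assert (L0 : 0 <= ln (INR (S n))) by apply ln_INR_ge_0.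
    assert (L1 : ln (INR (S n)) <= ln c) by (apply ln_le; lra).
    assert (L2 : ln c <= ln (INR (S (S n)))) by (apply ln_le; lra).
    split; apply pois_decr; lra.
Qed.

(** Sum against integral for a decreasing function with values in [[0, 1]]: the error lies between
    [0] and the total drop. *)
Local Lemma V_sum k N : 0 <= rsum (fun n => pois A k (ln (INR (S n)))) N - (V k (S N) - V k 1) <= 1.
Proof.
  assert (H : 0 <= rsum (fun n => pois A k (ln (INR (S n)))) N - (V k (S N) - V k 1)
     <= pois A k (ln (INR 1)) - pois A k (ln (INR (S N)))).
  { induction N; [simpl rsum; lra|]. cbn [rsum]. pose proof (V_step k N). lra. }
  assert (H1 : 0 <= pois A k (ln (INR 1)) <= 1).
  { apply pois_bounds, Rmult_le_pos; [lra|apply (ln_INR_ge_0 0)]. }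
  assert (H2 : 0 <= pois A k (ln (INR (S N))) <= 1).
  { apply pois_bounds, Rmult_le_pos; [lra|apply ln_INR_ge_0]. }
  lra.
Qed.

(** Taylor coefficients at [A] of [zeta(s) - 1 / (s - 1)], because
    [1 / (B + z) = sum (-1)^k z^k / B^(k+1)]. *)
Let zc (k : nat) : C := Cminus (fco one A k) (RtoC ((-1) ^ k / B ^ S k)).

Local Lemma J_1 k : J k (INR 1) = - (/ B * (A / B) ^ k).
Proof. unfold J. simpl INR. rewrite ln_1, pois_0. ring. Qed.

(** Up to the factor [(-1)^k / A^k], the pole term is the integral of [pterm A k (ln x)] from [1] to
    infinity. So [zc k * A^k] is, up to sign, a limit of differences of two sum-integral errors,
    each in [[0, 1]]. *)
Local Lemma zc_bound k : Cmod (zc k) * A ^ k <= 1.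
Proof.
  assert (HAk : 0 < A ^ k) by (apply pow_lt; lra).
  assert (HBk : 0 < B ^ k) by (apply pow_lt; lra).
  assert (Hm1 : (-1) ^ k * (-1) ^ k = 1) by (rewrite <- Rpow_mult_distr; replace (-1 * -1) with 1 by ring; apply pow1).
  set (u := fun N => rsum (fun n => ecf (ln (INR (S n))) A k) N -
    (-1) ^ k / A ^ k * (J k (INR (S N)) - J k (INR 1))).
  assert (Hu : forall N, Rabs (u N) * A ^ k <= 1).
  { intros N. rewrite <- (Rabs_pos_eq (A ^ k)) by lra. rewrite <- Rabs_mult.
    replace (u N * A ^ k) with ((-1) ^ k *
      ((rsum (fun n => pois A (S k) (ln (INR (S n)))) N - (V (S k) (S N) - V (S k) 1)) -
       (rsum (fun n => pois A k (ln (INR (S n)))) N - (V k (S N) - V k 1)))).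
    - rewrite Rabs_mult, neg_one_pow_abs, Rmult_1_l. apply Rabs_le.
      pose proof (V_sum (S k) N). pose proof (V_sum k N). lra.
    - unfold u, V. cbn [rsum].
      assert (E : rsum (fun n => ecf (ln (INR (S n))) A k) N * A ^ k =
        (-1) ^ k * (rsum (fun n => pois A (S k) (ln (INR (S n)))) N - rsum (fun n => pois A k (ln (INR (S n)))) N)).
      { clear. induction N; cbn [rsum]; [ring|]. rewrite Rmult_plus_distr_r, IHN, ecf_pois. ring. }
      rewrite Rmult_minus_distr_r, E. field. lra. }
  assert (Lu : Clim (fun N => RtoC (u N)) (zc k)).
  { assert (S1 : Clim (fun N => RtoC (rsum (fun n => ecf (ln (INR (S n))) A k) N)) (fco one A k)).
    { eapply Clim_ext; [|apply CSer_lim, (fco_summ one A ((A - 1) / 2)); [apply one_le_1|lra]].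
      intros N. induction N; cbn [csum rsum]; auto. rewrite IHN. unfold one. rewrite RtoC_plus. ring. }
    apply (Clim_ext (fun N => Cminus (RtoC (rsum (fun n => ecf (ln (INR (S n))) A k) N))
       (RtoC ((-1) ^ k / A ^ k * (J k (INR (S N)) - J k (INR 1)))))).
    { intros N. rewrite <- RtoC_minus. auto. }
    apply Clim_minus; auto. split; simpl; [|apply is_lim_seq_const].
    replace ((-1) ^ k / (B * B ^ k)) with ((-1) ^ k / A ^ k * (0 - J k (INR 1))).
    2: { rewrite J_1. unfold Rdiv. rewrite Rpow_mult_distr, pow_inv. field. repeat split; lra. }
    apply (is_lim_seq_scal_l _ _ (Finite (0 - J k (INR 1)))).
    apply is_lim_seq_minus'; [|apply is_lim_seq_const].
    unfold J. replace (Finite 0) with (Rbar_mult (Finite (- / B * (A / B) ^ k)) (Finite 0)) by (simpl; f_equal; ring).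
    apply is_lim_seq_scal_l. apply pois_lim_0. lra. }
  apply Rmult_le_reg_r with (/ A ^ k); [apply Rinv_0_lt_compat; auto|].
  rewrite Rmult_assoc, Rinv_r, Rmult_1_r by lra.
  apply (Clim_bound (fun N => RtoC (u N))); auto.
  intros N. rewrite Cmod_R. apply Rmult_le_reg_r with (A ^ k); auto.
  rewrite Rmult_assoc, Rinv_l, Rmult_1_r by lra. apply Hu.
Qed.

Local Lemma zc_bd : pbd zc A 1.
Proof. exact zc_bound. Qed.

(* Taylor coefficients at [A] of [(s - 1) zeta(s)]. *)
Let phi (k : nat) : C :=
  match k with O => Cmult B (fco one A 0) | S j => Cplus (Cmult B (fco one A (S j))) (fco one A j) end.

(** Multiplying [1 / (B + z)] by [B + z] leaves [1], so [phi] inherits the radius [A] of [zc]. *)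
Local Lemma phi_zc k : phi k =
  match k with O => Cplus (Cmult B (zc 0)) 1 | S j => Cplus (Cmult B (zc (S j))) (zc j) end.
Proof.
  assert (HBz : RtoC B <> 0) by (apply RtoC_neq; lra).
  destruct k as [|k]; unfold phi, zc.
  - replace (RtoC ((-1) ^ 0 / B ^ 1)) with (/ B)%C.
    + field; auto.
    + simpl. rewrite Rmult_1_r. rewrite RtoC_div by lra. field; auto.
  - assert (HBk : 0 < B ^ k) by (apply pow_lt; lra).
    replace (RtoC ((-1) ^ S k / B ^ S (S k))) with (- / B * RtoC ((-1) ^ k / B ^ S k))%C; [field; auto|].
    rewrite <- RtoC_inv, <- RtoC_opp, <- RtoC_mult by lra. f_equal. simpl. field. split; lra.
Qed.

Local Lemma phi_bd : pbd phi A (A + B).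
Proof.
  intros k. rewrite phi_zc. destruct k as [|k].
  - simpl. rewrite Rmult_1_r. eapply Rle_trans; [apply Cmod_triangle|].
    rewrite Cmod_mult, Cmod_1, Cmod_R, Rabs_pos_eq by lra.
    pose proof (zc_bound 0) as H. simpl in H. rewrite Rmult_1_r in H. nra.
  - assert (HAk : 0 < A ^ k) by (apply pow_lt; lra).
    eapply Rle_trans; [apply Rmult_le_compat_r; [apply pow_le; lra|apply Cmod_triangle]|].
    rewrite Cmod_mult, Cmod_R, Rabs_pos_eq by lra.
    pose proof (zc_bound (S k)) as H1. pose proof (zc_bound k) as H2.
    replace ((B * Cmod (zc (S k)) + Cmod (zc k)) * A ^ S k) with
      (B * (Cmod (zc (S k)) * A ^ S k) + A * (Cmod (zc k) * A ^ k)) by (simpl; ring).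
    nra.
Qed.

Local Lemma phi_shift (c : nat -> C) z : summ (fun k => Cmult (c k) (Cpow z k)) ->
  PS (fun k => match k with O => Cmult B (c 0%nat) | S j => Cplus (Cmult B (c (S j))) (c j) end) z =
  Cmult (B + z) (PS c z).
Proof.
  intros Hs. unfold PS.
  set (d := fun k => match k with O => RtoC 0 | S j => Cmult (c j) (Cpow z (S j)) end).
  assert (Sd1 : summ (fun k => d (1 + k)%nat)).
  { apply (summ_ext (fun k => Cmult z (Cmult (c k) (Cpow z k)))); [intros; simpl; ring|].
    apply summ_scal; auto. }
  assert (Sd : summ d) by (apply (ex_series_incr_n (fun k => Cmod (d k)) 1); exact Sd1).
  rewrite (CSer_ext _ (fun k => Cplus (Cmult B (Cmult (c k) (Cpow z k))) (d k))).
  - rewrite CSer_plus, CSer_scal by (auto; apply summ_scal; auto).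
    rewrite (CSer_split d 1 Sd). simpl csum.
    rewrite (CSer_ext (fun k => d (1 + k)%nat) (fun k => Cmult z (Cmult (c k) (Cpow z k)))) by (intros; simpl; ring).
    rewrite CSer_scal by auto. ring.
  - intros [|k]; unfold d; ring.
Qed.

Local Lemma phi_fco z : Cmod z < B -> PS phi z = Cmult (B + z) (PS (fco one A) z).
Proof.
  intros Hz. apply phi_shift.
  assert (Hp := Cmod_ge_0 z).
  destruct (fco_bd one A ((Cmod z + B) / 2) one_le_1 ltac:(unfold B in *; lra)) as [B0 HB0].
  eapply PS_summ; [exact HB0|lra].
Qed.

Local Lemma phi_at_pole : PS phi (RtoC (- B)) = 1.
Proof.
  assert (Hz : Cmod (RtoC (- B)) < A) by (rewrite Cmod_R, Rabs_Ropp, Rabs_pos_eq; unfold B in *; lra).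
  assert (Sz : summ (fun k => Cmult (zc k) (Cpow (RtoC (- B)) k))) by (eapply PS_summ; [apply zc_bd|auto]).
  set (p0 := fun k => match k with O => Cmult B (zc 0) | S j => Cplus (Cmult B (zc (S j))) (zc j) end).
  set (dl := fun k : nat => match k with O => RtoC 1 | S _ => RtoC 0 end).
  assert (Sphi : summ (fun k => Cmult (phi k) (Cpow (RtoC (- B)) k))) by (eapply PS_summ; [apply phi_bd|auto]).
  destruct (CSer_single (fun k => Cmult (dl k) (Cpow (RtoC (- B)) k)) 0) as [Sd Ed].
  { intros [|n] Hn; [lia|]. simpl. ring. }
  assert (E : PS phi (RtoC (- B)) = (PS p0 (RtoC (- B)) + 1)%C).
  { unfold PS. rewrite (CSer_ext (fun k => phi k * RtoC (- B) ^ k)%C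
      (fun k => Cplus (Cmult (p0 k) (Cpow (RtoC (- B)) k)) (Cmult (dl k) (Cpow (RtoC (- B)) k)))).
    - rewrite CSer_plus; auto.
      + rewrite Ed. simpl. ring.
      + apply (summ_ext (fun k => Cplus (Cmult (phi k) (Cpow (RtoC (- B)) k)) (Cmult (-1) (Cmult (dl k) (Cpow (RtoC (- B)) k))))).
        * intros k. rewrite phi_zc. unfold p0, dl. destruct k; ring.
        * apply summ_plus; auto. apply summ_scal; auto.
    - intros k. rewrite phi_zc. unfold p0, dl. destruct k; ring. }
  rewrite E. unfold p0. rewrite (phi_shift zc _ Sz).
  replace (B + RtoC (- B))%C with (RtoC 0) by (rewrite RtoC_opp; ring). ring.
Qed.

(** [|zeta| >= exp (- |log zeta|)], and the Euler product bounds the logarithm uniformly on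
    [Re s >= sigma]. *)
Local Lemma dirser_lower s sigma : 1 < sigma -> sigma <= Re s ->
  exp (- (2 * (1 + / (sigma - 1)))) <= Cmod (dirser one s).
Proof.
  intros H1 H2.
  assert (Hs : 1 < Re s) by lra.
  assert (Hnz : 0 < Cmod (dirser one s)) by (apply Cmod_gt_0, dirser_nonzero; auto; apply one_cmult).
  rewrite <- (exp_ln (Cmod (dirser one s)) Hnz). apply exp_le.
  rewrite log_dirser by (auto; apply one_cmult).
  assert (H : Cmod (logsum one s) <= 2 * (1 + / (sigma - 1))).
  { eapply Rle_trans; [apply Cmod_CSer, logsum_summ; auto; apply one_le_1|].
    destruct (pw_series sigma H1) as [P1 P2].
    eapply Rle_trans; [apply (Series_le _ (fun n => 2 * pw sigma (S n))); [|apply pw2_series; lra]|].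
    - intros n; split; [apply Cmod_ge_0|].
      eapply Rle_trans; [apply (logsum_row one s n one_le_1 Hs)|].
      apply Rmult_le_compat_l; [lra|]. unfold pw. apply exp_le.
      pose proof (ln_INR_ge_0 n). nra.
    - rewrite Series_scal_l. lra. }
  pose proof (re_le_Cmod (logsum one s)) as H3. apply Rabs_le_between in H3. lra.
Qed.

Local Lemma phi_lip R1 : 0 < R1 < A -> exists L, 0 <= L /\ forall z w, Cmod z <= R1 -> Cmod w <= R1 ->
  Cmod (PS phi w - PS phi z) <= L * Cmod (w - z).
Proof.
  intros H. apply (Udiff_lip _ _ (PS (dco phi)) (2 * R1)); [|apply disc_diam].
  apply (PS_Udiff _ A (A + B)); [apply phi_bd|auto].
Qed.

(* On [|z| <= B] the only point with [Re (A + z) <= 1] is the pole [z = - B]; the Euler product bounds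
   [zeta (A + t z)] from below uniformly in [t < 1]. *)
Local Lemma phi_nonzero z : Cmod z <= B -> PS phi z <> 0.
Proof.
  intros Hz E.
  destruct (Ceq_dec z (RtoC (- B))) as [->|Hne].
  { rewrite phi_at_pole in E. apply RtoC_inj in E. lra. }
  destruct (phi_lip B ltac:(unfold B in *; lra)) as [L [HL HL2]].
  assert (Hre : - B < Re z).
  { pose proof (re_le_Cmod z) as H. apply Rabs_le_between in H.
    destruct (Rle_lt_or_eq_dec (- B) (Re z)) as [|He]; [lra|auto|]. exfalso. apply Hne.
    assert (Im z = 0).
    { assert (H2 : Re z ^ 2 + Im z ^ 2 <= B ^ 2).
      { rewrite <- Cmod2_alt. apply pow_incr. split; auto; apply Cmod_ge_0. }
      rewrite <- He in H2. nra. }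
    apply C_eq; simpl; auto. }
  (* At [(1 - d) z] the real part of [s] is [1 + B + (1 - d) Re z], at least [1 + B + Re z] or
     [1 + B] according to the sign of [Re z]. *)
  set (sigma := 1 + Rmin (B + Re z) B).
  assert (Hmin : 0 < Rmin (B + Re z) B) by (apply Rmin_glb_lt; lra).
  pose proof (Rmin_l (B + Re z) B). pose proof (Rmin_r (B + Re z) B).
  set (c := exp (- (2 * (1 + / (sigma - 1))))).
  assert (Hc : 0 < c) by apply exp_pos.
  assert (Hbz : 0 < Cmod (B + z)).
  { apply Cmod_gt_0. intros H1. apply Hne. apply C_eq.
    - apply (f_equal Re) in H1. simpl in H1. change (fst z) with (Re z) in H1. simpl. lra.
    - apply (f_equal Im) in H1. simpl in H1. change (snd z) with (Im z) in H1. simpl. lra. }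
  (* A zero at [z] makes [phi] at most [L * d * B] at the point [(1 - d) z], while the Euler product
     keeps it away from [0]; a small [d] gives the contradiction. *)
  assert (Key : forall d, 0 < d <= 1 -> (Cmod (B + z) - d * B) * c <= L * (d * B)).
  { intros d Hd. set (w := (RtoC (1 - d) * z)%C).
    assert (Hw : Cmod w <= (1 - d) * B).
    { unfold w. rewrite Cmod_mult, Cmod_R, Rabs_pos_eq by lra. apply Rmult_le_compat_l; lra. }
    assert (HwB : Cmod w < B) by nra.
    assert (Hwz : Cmod (w - z) <= d * B).
    { replace (w - z)%C with (RtoC (- d) * z)%C by (unfold w; rewrite RtoC_minus, RtoC_opp; ring).
      rewrite Cmod_mult, Cmod_R, Rabs_Ropp, Rabs_pos_eq by lra. apply Rmult_le_compat_l; lra. }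
    pose proof (HL2 z w Hz ltac:(lra)) as H1. rewrite E in H1.
    replace (PS phi w - 0)%C with (PS phi w) in H1 by ring.
    rewrite phi_fco, Cmod_mult in H1 by auto.
    assert (HwB2 : Cmod w <= (Cmod w + B) / 2) by lra.
    rewrite (fco_PS one A ((Cmod w + B) / 2) one_le_1) in H1 by (auto; pose proof (Cmod_ge_0 w); unfold B in *; lra).
    assert (Hd1 : c <= Cmod (dirser one (A + w))).
    { apply dirser_lower; [unfold sigma; lra|].
      replace (Re (A + w)) with (1 + B + (1 - d) * Re z) by (unfold w, B; destruct z; simpl; ring).
      unfold sigma. destruct (Rle_dec 0 (Re z)); nra. }
    assert (Hbw : Cmod (B + z) - d * B <= Cmod (B + w)).
    { pose proof (Cmod_triangle' (B + z) (B + w)) as H2.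
      replace (B + z - (B + w))%C with (z - w)%C in H2 by ring.
      rewrite Cmod_minus_sym in H2. lra. }
    assert (H3 : L * Cmod (w - z) <= L * (d * B)) by (apply Rmult_le_compat_l; auto).
    assert (H4 : (Cmod (B + z) - d * B) * c <= Cmod (B + w) * c) by (apply Rmult_le_compat_r; lra).
    assert (H5 : Cmod (B + w) * c <= Cmod (B + w) * Cmod (dirser one (A + w))).
    { apply Rmult_le_compat_l; [apply Cmod_ge_0|auto]. }
    lra. }
  set (y := Cmod (B + z) * c) in *.
  assert (Hy : 0 < y) by (apply Rmult_lt_0_compat; auto).
  set (q := B * (L + c)).
  assert (Hq : 0 < q) by (apply Rmult_lt_0_compat; lra).
  set (d := Rmin 1 (y / (2 * q))).
  assert (Hd : 0 < d <= 1).
  { unfold d. split; [apply Rmin_glb_lt; [lra|apply Rdiv_lt_0_compat; lra]|apply Rmin_l]. }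
  assert (Hd2 : d * q <= y / 2).
  { apply Rle_trans with (y / (2 * q) * q); [apply Rmult_le_compat_r; [lra|apply Rmin_r]|].
    right. field. lra. }
  specialize (Key d Hd). unfold q in Hd2.
  replace ((Cmod (B + z) - d * B) * c) with (y - d * B * c) in Key by (unfold y; ring). lra.
Qed.

(** The point [s = 1] lies on the circle [|z| = B], whereas [log_extend] works in an open disc.
    Minimum modulus and a Lipschitz bound push the zero-free region slightly past that circle. *)
Local Lemma phi_nonzero_larger : exists R, B < R <= A /\ forall z, Cmod z < R -> PS phi z <> 0.
Proof.
  assert (HAB : A = B + 1) by (unfold B; ring).
  destruct (phi_lip (B + 1 / 2) ltac:(lra)) as [L [HL HL2]].
  destruct (disc_min_modulus (PS phi) B L HL) as [m [Hm Hm2]].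
  - intros; apply HL2; lra.
  - apply phi_nonzero.
  - set (d := Rmin (1 / 2) (m / (2 * (L + 1)))).
    assert (Hd : 0 < d <= 1 / 2).
    { unfold d. split; [apply Rmin_glb_lt; [lra|apply Rdiv_lt_0_compat; lra]|apply Rmin_l]. }
    assert (Hd2 : L * d < m).
    { assert (d * (L + 1) <= m / 2).
      { apply Rle_trans with (m / (2 * (L + 1)) * (L + 1)); [apply Rmult_le_compat_r; [lra|apply Rmin_r]|].
        right; field; lra. }
      nra. }
    exists (B + d). split; [lra|]. intros z Hz E.
    destruct (Rle_dec (Cmod z) B) as [H|H]; [apply (phi_nonzero z H E)|].
    set (w := (RtoC (B / Cmod z) * z)%C).
    assert (Hq : 0 < B / Cmod z) by (apply Rdiv_lt_0_compat; lra).
    assert (Hw : Cmod w = B).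
    { unfold w. rewrite Cmod_mult, Cmod_R, Rabs_pos_eq by lra. field. lra. }
    assert (Hwz : Cmod (w - z) = Cmod z - B).
    { replace (w - z)%C with (RtoC (- ((Cmod z - B) / Cmod z)) * z)%C.
      - rewrite Cmod_mult, Cmod_R, Rabs_Ropp, Rabs_pos_eq; [field; lra|].
        apply Rle_mult_inv_pos; lra.
      - unfold w. replace (- ((Cmod z - B) / Cmod z)) with (B / Cmod z - 1) by (field; lra).
        rewrite RtoC_minus. ring. }
    pose proof (HL2 z w ltac:(lra) ltac:(lra)) as H1. rewrite E in H1.
    replace (PS phi w - 0)%C with (PS phi w) in H1 by ring.
    specialize (Hm2 w ltac:(lra)). rewrite Hwz in H1. nra.
Qed.

(** Coefficients of [log ((B + z) zeta(A + z))]: those of [log zeta] plus those of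
    [ln B + log (1 + z / B)]. *)
Let gam (k : nat) : C := Cplus (gco one A k)
  (match k with O => RtoC (ln B) | S j => Cmult (lgco k) (RtoC ((- / B) ^ k)) end).

Local Lemma gam_bd r : 0 < r < B -> exists M, pbd gam r M.
Proof.
  intros Hr. destruct (gco_bd one A r one_le_1 Hr) as [M HM].
  exists (M + (Rabs (ln B) + 1)). intros k. unfold gam.
  assert (Hrk : 0 <= r ^ k) by (apply pow_le; lra).
  eapply Rle_trans; [apply Rmult_le_compat_r; [auto|apply Cmod_triangle]|].
  rewrite Rmult_plus_distr_r. apply Rplus_le_compat; [apply HM|].
  destruct k as [|k].
  - rewrite Cmod_R. simpl. lra.
  - rewrite Cmod_mult, Cmod_R, <- RPow_abs, Rabs_Ropp.
    rewrite (Rabs_pos_eq (/ B)) by (apply Rlt_le, Rinv_0_lt_compat; lra).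
    pose proof (lgco_bd (S k)) as H. rewrite pow1, Rmult_1_r in H.
    assert (H2 : 0 <= (/ B) ^ S k * r ^ S k <= 1).
    { rewrite <- Rpow_mult_distr. split; [apply pow_le, Rmult_le_pos; [apply Rlt_le, Rinv_0_lt_compat|]; lra|].
      rewrite <- (pow1 (S k)). apply pow_incr. split; [apply Rmult_le_pos; [apply Rlt_le, Rinv_0_lt_compat|]; lra|].
      apply Rmult_le_reg_l with B; [lra|]. rewrite <- Rmult_assoc, Rinv_r by lra. lra. }
    pose proof (Cmod_ge_0 (lgco (S k))). pose proof (Rabs_pos (ln B)). nra.
Qed.

Local Lemma ln_phi z : Cmod z < B -> ln (Cmod (PS phi z)) = Re (PS gam z).
Proof.
  intros Hz. assert (Hp := Cmod_ge_0 z).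
  assert (HBz : RtoC B <> 0) by (apply RtoC_neq; lra).
  set (w := (RtoC (- / B) * z)%C).
  assert (Hw : Cmod w < 1).
  { unfold w. rewrite Cmod_mult, Cmod_R, Rabs_Ropp, Rabs_pos_eq by (apply Rlt_le, Rinv_0_lt_compat; lra).
    apply Rmult_lt_reg_l with B; [lra|]. rewrite <- Rmult_assoc, Rinv_r by lra. lra. }
  assert (Ebz : (B + z)%C = (B * (1 - w))%C).
  { unfold w. rewrite RtoC_opp, RtoC_inv by lra. field; auto. }
  assert (N1 : (1 - w)%C <> 0).
  { apply Cminus_eq_contra. intros H. rewrite <- H, Cmod_1 in Hw. lra. }
  assert (Hm : 0 < Cmod (1 - w)) by (apply Cmod_gt_0; auto).
  assert (Hphi : PS phi z <> 0) by (apply phi_nonzero; lra).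
  rewrite phi_fco in * by auto.
  assert (N2 : 0 < Cmod (PS (fco one A) z)).
  { apply Cmod_gt_0. intros H. apply Hphi. rewrite H. ring. }
  rewrite Ebz, !Cmod_mult, Cmod_R, (Rabs_pos_eq B) by lra.
  rewrite !ln_mult; try lra; [|apply Rmult_lt_0_compat; lra].
  rewrite ln_fco_gco by (auto; apply one_cmult). rewrite ln_one_minus by auto.
  destruct (gco_bd one A ((Cmod z + B) / 2) one_le_1 ltac:(unfold B in *; lra)) as [M HM].
  assert (S1 : summ (fun k => Cmult (gco one A k) (Cpow z k))) by (eapply PS_summ; [exact HM|lra]).
  assert (S2 : summ (fun k => Cmult (lgco k) (Cpow w k))) by (eapply PS_summ; [apply lgco_bd|auto]).
  set (dl := fun k : nat => match k with O => RtoC (ln B) | S _ => RtoC 0 end).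
  destruct (CSer_single dl 0) as [Sd Ed]; [intros [|n] Hn; [lia|reflexivity]|].
  assert (E : PS gam z = (PS (gco one A) z + (PS lgco w + RtoC (ln B)))%C).
  { unfold PS. rewrite (CSer_ext _ (fun k => Cplus (Cmult (gco one A k) (Cpow z k)) (Cplus (Cmult (lgco k) (Cpow w k)) (dl k)))).
    - rewrite CSer_plus, CSer_plus, Ed; auto. apply summ_plus; auto.
    - intros k. unfold gam, w. rewrite Cpow_mult_l, <- RtoC_pow. destruct k; unfold dl.
      + simpl. ring.
      + ring. }
  rewrite E. simpl. change (fst (PS (gco one A) z)) with (Re (PS (gco one A) z)). ring.
Qed.

(** At [z = - B] the logarithm of [phi] is [0], while the expansion of [ln B + log (1 + z / B)]
    becomes [ln B] minus the harmonic series. The partial sums of [log zeta] must therefore diverge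
    exactly as the harmonic sums do. *)
Lemma zeta_partial : is_lim_seq (fun K => Re (csum (fun k => Cmult (gco one A k) (Cpow (RtoC (- B)) k)) (S K)) -
  (rsum (fun j => / INR (S j)) K - ln B)) 0.
Proof.
  destruct phi_nonzero_larger as [R [HR Hnz]].
  destruct (gam_bd (B / 2) ltac:(lra)) as [M HM].
  assert (Heq : forall z, Cmod z < B / 2 -> ln (Cmod (PS phi z)) = Re (PS gam z)).
  { intros; apply ln_phi; lra. }
  assert (Hb : Cmod (RtoC (- B)) = B) by (rewrite Cmod_R, Rabs_Ropp, Rabs_pos_eq; lra).
  pose proof (log_extend phi gam A (A + B) (B / 2) M R phi_bd ltac:(lra) HM ltac:(lra) Hnz Heq (RtoC (- B)) ltac:(lra)) as H1.
  destruct (log_radius phi gam A (A + B) (B / 2) M R phi_bd ltac:(lra) HM ltac:(lra) Hnz Heq ((B + R) / 2) ltac:(lra)) as [M2 HM2].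
  rewrite phi_at_pole, Cmod_1, ln_1 in H1.
  assert (Ss : summ (fun k => Cmult (gam k) (Cpow (RtoC (- B)) k))) by (eapply PS_summ; [exact HM2|lra]).
  pose proof (Re_lim_of_Clim _ _ (CSer_lim _ Ss)) as HL.
  change (Re (CSer (fun k => (gam k * RtoC (- B) ^ k)%C))) with (Re (PS gam (RtoC (- B)))) in HL.
  rewrite <- H1 in HL. apply is_lim_seq_incr_1 in HL.
  eapply is_lim_seq_ext; [|exact HL].
  intros K. cbv beta. induction K.
  - cbn [csum rsum]. unfold gam. simpl. ring.
  - change (csum (fun k => gam k * RtoC (- B) ^ k)%C (S (S K))) with
      (csum (fun k => gam k * RtoC (- B) ^ k)%C (S K) + gam (S K) * RtoC (- B) ^ S K)%C.
    change (csum (fun k => gco one A k * RtoC (- B) ^ k)%C (S (S K))) with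
      (csum (fun k => gco one A k * RtoC (- B) ^ k)%C (S K) + gco one A (S K) * RtoC (- B) ^ S K)%C.
    change (Re (csum (fun k => gam k * RtoC (- B) ^ k)%C (S K) + gam (S K) * RtoC (- B) ^ S K)%C) with
      (Re (csum (fun k => gam k * RtoC (- B) ^ k)%C (S K)) + Re (gam (S K) * RtoC (- B) ^ S K)%C).
    change (Re (csum (fun k => gco one A k * RtoC (- B) ^ k)%C (S K) + gco one A (S K) * RtoC (- B) ^ S K)%C) with
      (Re (csum (fun k => gco one A k * RtoC (- B) ^ k)%C (S K)) + Re (gco one A (S K) * RtoC (- B) ^ S K)%C).
    rewrite IHK. change (rsum (fun j => / INR (S j)) (S K)) with (rsum (fun j => / INR (S j)) K + / INR (S K)).
    assert (E : (gam (S K) * RtoC (- B) ^ S K)%C = (gco one A (S K) * RtoC (- B) ^ S K + RtoC (- / INR (S K)))%C).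
    { unfold gam. rewrite Cmult_plus_distr_r. f_equal. unfold lgco.
      rewrite <- RtoC_pow, <- !RtoC_mult. f_equal. rewrite Rmult_assoc, <- Rpow_mult_distr.
      replace (- / B * - B) with 1 by (field; lra). rewrite pow1. ring. }
    rewrite E.
    change (Re (gco one A (S K) * RtoC (- B) ^ S K + RtoC (- / INR (S K)))%C) with
      (Re (gco one A (S K) * RtoC (- B) ^ S K)%C + - / INR (S K)). ring.
Qed.

End Zeta.

(** * Sums over prime powers *)

Lemma ln_1p_le x : -1 < x -> ln (1 + x) <= x.
Proof.
  intros Hx. rewrite <- (ln_exp x) at 2. apply ln_le; [lra|].
  destruct (Req_dec x 0) as [->|H]; [rewrite exp_0; lra|]. apply Rlt_le, exp_ineq1; auto.
Qed.

Lemma ln_1p_ge x : 0 <= x -> x / (1 + x) <= ln (1 + x).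
Proof.
  intros Hx. pose proof (ln_1p_le (- (x / (1 + x)))) as H.
  assert (E : 1 + - (x / (1 + x)) = / (1 + x)) by (field; lra).
  rewrite E, ln_Rinv in H by lra.
  assert (0 < / (1 + x)) by (apply Rinv_0_lt_compat; lra). lra.
Qed.

(** [euler_gamma] is defined through [Lim_seq], so convergence must be supplied: the sequence is
    nonnegative, and it decreases because [x / (1 + x) <= ln (1 + x)]. *)
Lemma euler_gamma_lim : is_lim_seq (fun n => rsum (fun k => / INR (S k)) (S n) - ln (INR (S n))) euler_gamma.
Proof.
  set (e := fun n => rsum (fun k => / INR (S k)) (S n) - ln (INR (S n))).
  assert (Hstep : forall n, ln (INR (S (S n))) = ln (INR (S n)) + ln (1 + / INR (S n))).
  { intros n. assert (Hn : 0 < INR (S n)) by (apply lt_0_INR; lia).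
    assert (0 < / INR (S n)) by (apply Rinv_0_lt_compat; auto).
    rewrite <- ln_mult by lra. f_equal. rewrite (S_INR (S n)). field. lra. }
  assert (Hpos : forall n, 0 < / INR (S n)) by (intros; apply Rinv_0_lt_compat, lt_0_INR; lia).
  assert (Hd : forall n, e (S n) <= e n).
  { intros n. unfold e. cbn [rsum]. rewrite Hstep.
    pose proof (ln_1p_ge (/ INR (S n)) (Rlt_le _ _ (Hpos n))) as H.
    replace (/ INR (S n) / (1 + / INR (S n))) with (/ INR (S (S n))) in H.
    - lra.
    - assert (Hn : 0 < INR (S n)) by (apply lt_0_INR; lia). rewrite (S_INR (S n)). field. lra. }
  assert (Hb : forall n, ln (INR (S (S n))) <= rsum (fun k => / INR (S k)) (S n)).
  { induction n.
    - rewrite Hstep. simpl. rewrite ln_1, Rinv_1. pose proof (ln_1p_le 1 ltac:(lra)). lra.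
    - rewrite Hstep. cbn [rsum] in *. pose proof (ln_1p_le (/ INR (S (S n))) ltac:(pose proof (Hpos (S n)); lra)). lra. }
  assert (He : forall n, 0 <= e n).
  { intros n. unfold e. pose proof (Hb n). pose proof (ln_INR_mono n). lra. }
  destruct (ex_finite_lim_seq_decr e 0 Hd He) as [g Hg].
  assert (E : euler_gamma = g).
  { unfold euler_gamma. rewrite (Lim_seq_ext _ e).
    - rewrite (is_lim_seq_unique _ _ Hg). reflexivity.
    - intros n. rewrite sum_f_R0_rsum. reflexivity. }
  rewrite E. exact Hg.
Qed.

(** Up to conjugation [z = cis th] with [0 <= th <= PI]. If [th > PI - PI / l] and [l = 2 j + 1],
    then [l * th] lies in [(2 j PI, (2 j + 1) PI]], where the cosine differs from [1]. *)
Lemma root_of_unity_Re z l : Nat.odd l = true -> (3 <= l)%nat -> Cpow z l = 1 ->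
  - cos (PI / INR l) <= Re z.
Proof.
  intros Hodd Hl Hz.
  assert (Hl3 : 3 <= INR l) by (apply (le_INR 3) in Hl; simpl in Hl; lra).
  assert (Hm : Cmod z = 1) by (apply (Cmod_root_of_unity z l); [lia|auto]).
  assert (Hsq : Re z ^ 2 + Im z ^ 2 = 1) by (rewrite <- Cmod2_alt, Hm; ring).
  set (th := acos (Re z)).
  assert (Hth : 0 <= th <= PI) by apply acos_bound.
  assert (Hr : -1 <= Re z <= 1) by nra.
  assert (Hc : cos th = Re z) by (apply cos_acos; auto).
  assert (Hs0 : 0 <= sin th) by (apply sin_ge_0; lra).
  assert (Hs2 : sin th ^ 2 = Im z ^ 2).
  { pose proof (sin2_cos2 th) as H. unfold Rsqr in H. rewrite Hc in H. simpl in *. lra. }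
  assert (Hcis : Cpow (cis th) l = 1).
  { destruct (Rle_dec 0 (Im z)).
    - replace (cis th) with z; auto. apply C_eq; simpl; [auto|]. nra.
    - replace (cis th) with (Cconj z).
      + rewrite <- Cpow_conj, Hz. apply C_eq; simpl; ring.
      + apply C_eq; simpl; [auto|]. change (snd z) with (Im z). nra. }
  rewrite cis_pow in Hcis. apply (f_equal Re) in Hcis. simpl in Hcis.
  apply Rnot_lt_le. intros Hlt.
  assert (HPI := PI_RGT_0).
  assert (Hq : 0 < PI / INR l <= PI / 3).
  { split; [apply Rdiv_lt_0_compat; lra|]. apply Rmult_le_compat_l; [lra|]. apply Rinv_le_contravar; lra. }
  assert (Hgt : PI - PI / INR l < th).
  { apply Rnot_le_lt. intros Hle.
    assert (cos (PI - PI / INR l) <= cos th) by (apply cos_decr_1; lra).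
    rewrite Rtrigo_facts.cos_pi_minus in H. lra. }
  apply Nat.odd_spec in Hodd. destruct Hodd as [j Hj].
  assert (HlR : INR l = 2 * INR j + 1) by (rewrite Hj, plus_INR, mult_INR; simpl; ring).
  apply (cos_neq_1 (INR l * th - 2 * INR j * PI)).
  - assert (H1 : INR l * (PI - PI / INR l) < INR l * th) by (apply Rmult_lt_compat_l; lra).
    replace (INR l * (PI - PI / INR l)) with (INR l * PI - PI) in H1 by (field; lra).
    assert (H2 : INR l * th <= INR l * PI) by (apply Rmult_le_compat_l; lra).
    rewrite HlR in *. split; lra.
  - rewrite <- (cos_period (INR l * th - 2 * INR j * PI) j).
    replace (INR l * th - 2 * INR j * PI + 2 * INR j * PI) with (INR l * th) by ring. auto.
Qed.

Definition ppinv (n m : nat) : R := if isp (S n) then / INR (S m) else 0.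

Definition ppweight (A : R) (K n m : nat) : R := exp (- logpp n m) * poisw (A - 1) K n m.

Lemma ppinv_bounds n m : 0 <= ppinv n m <= 1.
Proof.
  unfold ppinv. destruct (isp (S n)); [|lra]. split; [|apply inv_S_le_1].
  apply Rlt_le, Rinv_0_lt_compat, lt_0_INR; lia.
Qed.

Lemma ppinv_ppcoef n m : RtoC (ppinv n m) = ppcoef one n m.
Proof.
  unfold ppinv, ppcoef. destruct (isp (S n)); auto. unfold one. rewrite Cpow_1_l. ring.
Qed.

Lemma ppcoef_ppinv a n m : ppcoef a n m = Cmult (ppinv n m) (Cpow (a (S n)) (S m)).
Proof. unfold ppinv, ppcoef. destruct (isp (S n)); ring. Qed.

Lemma poisw_bounds A K n m : 1 < A -> 0 <= poisw (A - 1) K n m <= 1.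
Proof. intros HA. apply pois_bounds, Rmult_le_pos; [lra|apply logpp_ge_0]. Qed.

Lemma ppweight_ge_0 A K n m : 1 < A -> 0 <= ppweight A K n m.
Proof. intros; apply Rmult_le_pos; [apply Rlt_le, exp_pos|apply poisw_bounds; auto]. Qed.

(** Since [(B x)^k / k! <= 2^k exp (B x / 2)], each of the [K] Poisson terms keeps a factor
    [exp (- B x / 2)]. Truncation thus makes the sums over prime powers at [s = 1] absolutely
    convergent. *)
Lemma ppweight_bound A K : 1 < A -> exists M, 0 <= M /\ forall n m,
  ppweight A K n m <= M * exp (- (1 + (A - 1) / 2) * logpp n m).
Proof.
  intros HA. set (B := A - 1). assert (HB : 0 < B) by (unfold B; lra).
  exists (rsum (fun k => 2 ^ k) K). split; [apply rsum_ge_0; intros; apply pow_le; lra|].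
  intros n m. unfold ppweight, poisw. fold B. pose proof (logpp_ge_0 n m) as Hx. set (x := logpp n m) in *.
  unfold pois. rewrite <- rsum_scal, Rmult_comm, <- rsum_scal. apply rsum_le. intros k _.
  unfold pterm.
  pose proof (pow_fact_le_exp (B / 2 * x) k ltac:(apply Rmult_le_pos; lra)) as H.
  replace (B * x) with (2 * (B / 2 * x)) by field. rewrite Rpow_mult_distr.
  replace (- (1 + B / 2) * x) with (- x + (- B * x + B / 2 * x)) by field.
  rewrite !exp_plus.
  pose proof (exp_pos (- x)). pose proof (exp_pos (- B * x)).
  assert (0 < 2 ^ k) by (apply pow_lt; lra).
  replace (exp (- x) * (exp (- B * x) * (2 ^ k * (B / 2 * x) ^ k / INR (fact k)))) with
    (exp (- x) * exp (- B * x) * 2 ^ k * ((B / 2 * x) ^ k / INR (fact k))) by (unfold Rdiv; ring).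
  replace (exp (- x) * (exp (- B * x) * exp (B / 2 * x)) * 2 ^ k) with
    (exp (- x) * exp (- B * x) * 2 ^ k * exp (B / 2 * x)) by ring.
  apply Rmult_le_compat_l; auto. repeat apply Rmult_le_pos; lra.
Qed.

Definition dsum (A : R) (K : nat) (y : nat -> nat -> R) : R :=
  Series (fun n => Series (fun m => y n m * ppweight A K n m)).

Lemma dsum_ex A K y c : 1 < A -> (forall n m, Rabs (y n m) <= c * ppinv n m) ->
  (forall n, ex_series (fun m => y n m * ppweight A K n m)) /\
  ex_series (fun n => Series (fun m => y n m * ppweight A K n m)).
Proof.
  intros HA Hy.
  destruct (ppweight_bound A K HA) as [M [HM HW]].
  set (s := 1 + (A - 1) / 2) in *. assert (Hs : 1 < s) by (unfold s; lra).
  assert (Hc : forall n m, 0 <= c * ppinv n m).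
  { intros n m. eapply Rle_trans; [apply Rabs_pos|apply Hy]. }
  assert (Hterm : forall n m, Rabs (y n m * ppweight A K n m) <= Rabs c * M * (Cmod (ppcoef one n m) * exp (- s * logpp n m))).
  { intros n m. rewrite Rabs_mult, (Rabs_pos_eq (ppweight A K n m)) by (apply ppweight_ge_0; auto).
    rewrite <- ppinv_ppcoef, Cmod_R, (Rabs_pos_eq (ppinv n m)) by apply ppinv_bounds.
    replace (Rabs c * M * (ppinv n m * exp (- s * logpp n m))) with
      ((Rabs c * ppinv n m) * (M * exp (- s * logpp n m))) by ring.
    apply Rmult_le_compat; auto; [apply Rabs_pos|apply ppweight_ge_0; auto|].
    eapply Rle_trans; [apply Hy|]. apply Rmult_le_compat_r; [apply ppinv_bounds|apply Rle_abs]. }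
  assert (Hrow : forall n, ex_series (fun m => Rabs c * M * (Cmod (ppcoef one n m) * exp (- s * logpp n m)))).
  { intros n. apply (ex_series_scal_l (V := R_NormedModule) (Rabs c * M) (fun m => Cmod (ppcoef one n m) * exp (- s * logpp n m))).
    apply ppcoef_row; auto. apply one_le_1. }
  assert (Habs : forall n, ex_series (fun m => Rabs (y n m * ppweight A K n m))).
  { intros n. eapply ex_series_le_pos; [|apply Hrow]. intros m; split; [apply Rabs_pos|apply Hterm]. }
  split; [intros n; apply ex_series_Rabs, Habs|].
  apply ex_series_Rabs.
  apply (ex_series_le_pos _ (fun n => Rabs c * M * (2 * pw s (S n)))).
  - intros n. split; [apply Rabs_pos|].
    eapply Rle_trans; [apply Series_Rabs, Habs|].
    eapply Rle_trans; [apply Series_le; [|apply Hrow]; intros m; split; [apply Rabs_pos|apply Hterm]|].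
    rewrite Series_scal_l. apply Rmult_le_compat_l; [apply Rmult_le_pos; [apply Rabs_pos|auto]|].
    apply ppcoef_row; auto. apply one_le_1.
  - apply (ex_series_scal_l (V := R_NormedModule) (Rabs c * M) (fun n => 2 * pw s (S n))).
    apply pw2_series; auto.
Qed.

Lemma Series_mono (f g : nat -> R) : (forall n, f n <= g n) -> ex_series f -> ex_series g ->
  Series f <= Series g.
Proof.
  intros H Hf Hg. apply (is_lim_seq_le (rsum f) (rsum g) (Series f) (Series g)).
  - intros n. apply rsum_le; auto.
  - apply rsum_lim_Series; auto.
  - apply rsum_lim_Series; auto.
Qed.

Lemma dsum_le A K y y' c : 1 < A -> (forall n m, Rabs (y n m) <= c * ppinv n m) ->
  (forall n m, Rabs (y' n m) <= c * ppinv n m) -> (forall n m, y n m <= y' n m) ->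
  dsum A K y <= dsum A K y'.
Proof.
  intros HA H1 H2 H.
  destruct (dsum_ex A K y c HA H1) as [E1 E2]. destruct (dsum_ex A K y' c HA H2) as [E3 E4].
  apply Series_mono; auto. intros n. apply Series_mono; auto.
  intros m. apply Rmult_le_compat_r; auto. apply ppweight_ge_0; auto.
Qed.

Lemma dsum_plus A K y y' c k : 1 < A -> (forall n m, Rabs (y n m) <= c * ppinv n m) ->
  (forall n m, Rabs (y' n m) <= c * ppinv n m) ->
  dsum A K (fun n m => y n m + k * y' n m) = dsum A K y + k * dsum A K y'.
Proof.
  intros HA H1 H2.
  destruct (dsum_ex A K y c HA H1) as [E1 E2]. destruct (dsum_ex A K y' c HA H2) as [E3 E4].
  assert (Sc : forall f, ex_series f -> ex_series (fun n => k * f n)).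
  { intros f Hf. apply (ex_series_scal_l (V := R_NormedModule) k f Hf). }
  unfold dsum.
  rewrite (Series_ext _ (fun n => Series (fun m => y n m * ppweight A K n m) + k * Series (fun m => y' n m * ppweight A K n m))).
  - rewrite Series_plus, Series_scal_l; auto.
  - intros n. rewrite <- Series_scal_l, <- Series_plus; auto.
    apply Series_ext; intros; ring.
Qed.

Definition re_ppcoef (a : nat -> C) (n m : nat) : R := ppinv n m * Re (Cpow (a (S n)) (S m)).

Lemma re_ppcoef_dsum a A K : Re (CSer (fun n => CSer (fun m => Cmult (ppcoef a n m) (RtoC (exp (- logpp n m) * poisw (A - 1) K n m))))) =
  dsum A K (re_ppcoef a).
Proof.
  rewrite Re_CSer. apply Series_ext; intros n. rewrite Re_CSer. apply Series_ext; intros m.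
  rewrite Cmult_comm, Re_scal, ppcoef_ppinv, Re_scal. unfold re_ppcoef, ppweight. ring.
Qed.

Lemma re_ppcoef_bound a n m : (forall n, Cmod (a n) <= 1) -> Rabs (re_ppcoef a n m) <= 1 * ppinv n m.
Proof.
  intros Ha. unfold re_ppcoef. rewrite Rabs_mult, (Rabs_pos_eq (ppinv n m)) by apply ppinv_bounds.
  rewrite Rmult_comm. apply Rmult_le_compat_r; [apply ppinv_bounds|].
  eapply Rle_trans; [apply re_le_Cmod|]. rewrite Cmod_pow, <- (pow1 (S m)).
  apply pow_incr. split; [apply Cmod_ge_0|auto].
Qed.

(** An upper bound serves both final estimates: the zeta sum majorizes the one for [chi], and it
    enters the lower estimate with coefficient [- c]. *)
Lemma zeta_dsum_upper A eps : 2 <= A -> 0 < eps -> exists K0, forall K, (K0 <= K)%nat ->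
  dsum A K ppinv <= ln (INR K) - ln (A - 1) + euler_gamma + eps.
Proof.
  intros HA Heps.
  pose proof (zeta_partial A HA) as H1. pose proof euler_gamma_lim as H2.
  apply is_lim_seq_spec in H1. apply is_lim_seq_spec in H2.
  destruct (H1 (mkposreal (eps / 2) ltac:(lra))) as [N1 HN1].
  destruct (H2 (mkposreal (eps / 2) ltac:(lra))) as [N2 HN2].
  exists (S (N1 + N2)). intros K HK. destruct K as [|K]; [lia|].
  specialize (HN1 K ltac:(lia)). specialize (HN2 K ltac:(lia)). simpl in HN1, HN2.
  apply Rabs_def2 in HN1. apply Rabs_def2 in HN2.
  assert (E : dsum A (S K) ppinv = Re (csum (fun k => Cmult (gco one A k) (Cpow (RtoC (- (A - 1))) k)) (S K))).
  { rewrite gco_partial by (try apply one_le_1; lra). rewrite re_ppcoef_dsum. unfold dsum.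
    apply Series_ext; intros n. apply Series_ext; intros m. unfold re_ppcoef, one. rewrite Cpow_1_l. simpl Re. ring. }
  rewrite E. clear E.
  (* The harmonic sum of [zeta_partial] lacks the last term of the one in [euler_gamma_lim]; its
     sign is favourable to an upper bound. *)
  assert (0 < / INR (S K)) by (apply Rinv_0_lt_compat, lt_0_INR; lia).
  cbn [csum] in *. simpl in *. lra.
Qed.

(** * The least contribution of a prime, and the constant [C_const] *)

Section LowerBound.

Variables (l : nat).
Hypothesis Hl : (3 <= l)%nat.

Let c := cos (PI / INR l).

Lemma c_bounds : 0 < c <= 1.
Proof.
  assert (Hl3 : 3 <= INR l) by (apply (le_INR 3) in Hl; simpl in Hl; lra).
  assert (HPI := PI_RGT_0).
  assert (Hq : 0 < PI / INR l <= PI / 3).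
  { split; [apply Rdiv_lt_0_compat; lra|]. apply Rmult_le_compat_l; [lra|]. apply Rinv_le_contravar; lra. }
  split; [apply cos_gt_0; lra|apply COS_bound].
Qed.

(** The point [exp (i (PI - PI / l))], which for odd [l] is an [l]-th root of unity nearest to
    [-1]. *)
Let z0 : C := (- c, sin (PI / INR l)).

Local Lemma z0_mod : Cmod z0 = 1.
Proof.
  assert (H : Cmod z0 ^ 2 = 1).
  { rewrite Cmod2_alt. unfold z0, c; simpl. pose proof (sin2_cos2 (PI / INR l)). unfold Rsqr in *. lra. }
  pose proof (Cmod_ge_0 z0). nra.
Qed.

(* The contribution of a prime [p = S n] on which the character takes the value [z]. *)
Let T (z : C) (n : nat) : R := Series (fun m => ppinv n m * (Re (Cpow z (S m)) + c) * exp (- logpp n m)).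

Local Lemma re_pow_bound z m : Cmod z <= 1 -> Rabs (Re (Cpow z m) + c) <= 2.
Proof.
  intros Hz. assert (H : Rabs (Re (Cpow z m)) <= 1).
  { eapply Rle_trans; [apply re_le_Cmod|]. rewrite Cmod_pow, <- (pow1 m).
    apply pow_incr. split; [apply Cmod_ge_0|auto]. }
  apply Rabs_le_between in H. pose proof c_bounds. apply Rabs_le; lra.
Qed.

Local Lemma exp_logpp_inv n m : exp (- logpp n m) = (/ INR (S n)) ^ S m.
Proof.
  replace (- logpp n m) with (-1 * logpp n m) by ring.
  replace (-1) with (- (1)) by ring. rewrite exp_logpp. f_equal. unfold pw.
  replace (- (1) * ln (INR (S n))) with (- ln (INR (S n))) by ring.
  rewrite exp_Ropp, exp_ln; auto. apply lt_0_INR; lia.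
Qed.

Local Lemma inv_half n : isp (S n) = true -> 0 < / INR (S n) <= / 2.
Proof.
  intros E. apply isp_ge_2 in E. apply (le_INR 2) in E. simpl (INR 2) in E.
  split; [apply Rinv_0_lt_compat; lra|apply Rinv_le_contravar; lra].
Qed.

Local Lemma T_term_abs z n m : Cmod z <= 1 ->
  Rabs (ppinv n m * (Re (Cpow z (S m)) + c) * exp (- logpp n m)) <= 2 * (ppinv n m * exp (- logpp n m)).
Proof.
  intros Hz. pose proof (ppinv_bounds n m). pose proof (exp_pos (- logpp n m)).
  rewrite !Rabs_mult, (Rabs_pos_eq (ppinv n m)), (Rabs_pos_eq (exp (- logpp n m))) by lra.
  pose proof (re_pow_bound z (S m) Hz).
  replace (2 * (ppinv n m * exp (- logpp n m))) with (ppinv n m * 2 * exp (- logpp n m)) by ring.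
  apply Rmult_le_compat_r; [lra|]. apply Rmult_le_compat_l; lra.
Qed.

Local Lemma ppinv_exp_ex n : ex_series (fun m => ppinv n m * exp (- logpp n m)).
Proof.
  destruct (isp (S n)) eqn:E.
  - pose proof (inv_half n E). destruct (geom_S_sum (/ INR (S n)) ltac:(lra)) as [G _].
    eapply ex_series_le_pos; [|exact G]. intros m. rewrite exp_logpp_inv. pose proof (ppinv_bounds n m).
    assert (0 <= (/ INR (S n)) ^ S m) by (apply pow_le; lra).
    split; [apply Rmult_le_pos; lra|]. nra.
  - apply (ex_series_bounded _ 0); intros m; [|induction m; cbn [rsum]; [lra|]]; unfold ppinv in *; rewrite E in *; lra.
Qed.

Local Lemma T_ex z n : Cmod z <= 1 ->
  ex_series (fun m => ppinv n m * (Re (Cpow z (S m)) + c) * exp (- logpp n m)).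
Proof.
  intros Hz. apply ex_series_Rabs.
  apply (ex_series_le_pos _ (fun m => 2 * (ppinv n m * exp (- logpp n m)))).
  - intros m; split; [apply Rabs_pos|apply T_term_abs; auto].
  - apply (ex_series_scal_l (V := R_NormedModule) 2 (fun m => ppinv n m * exp (- logpp n m))), ppinv_exp_ex.
Qed.

Local Lemma T_val z n : Cmod z <= 1 -> isp (S n) = true ->
  T z n = - ln (Cmod (1 - RtoC (/ INR (S n)) * z)) - c * ln (1 - / INR (S n)).
Proof.
  intros Hz E. pose proof (inv_half n E) as Hp. set (p := / INR (S n)) in *.
  assert (H1 : Cmod (RtoC p * z) < 1).
  { rewrite Cmod_mult, Cmod_R, Rabs_pos_eq by lra. pose proof (Cmod_ge_0 z). nra. }
  assert (H2 : Cmod (RtoC p) < 1) by (rewrite Cmod_R, Rabs_pos_eq; lra).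
  rewrite ln_series by auto.
  assert (E2 : - ln (1 - p) = Re (CSer (lgterm (RtoC p)))).
  { rewrite <- ln_series by auto. f_equal. f_equal. rewrite <- RtoC_minus, Cmod_R, Rabs_pos_eq; lra. }
  replace (Re (CSer (lgterm (RtoC p * z))) - c * ln (1 - p)) with
    (Re (CSer (lgterm (RtoC p * z))) + c * - ln (1 - p)) by ring.
  rewrite E2, !Re_CSer, <- Series_scal_l, <- Series_plus.
  - apply Series_ext. intros m. unfold ppinv. rewrite E, exp_logpp_inv. fold p. unfold lgterm.
    rewrite Cpow_mult_l, <- !RtoC_pow, !Re_scal.
    change (Re (RtoC (p ^ S m))) with (p ^ S m). ring.
  - apply summ_Re, lgterm_summ; auto.
  - apply (ex_series_scal_l (V := R_NormedModule) c (fun n => Re (lgterm p n))).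
    apply summ_Re, lgterm_summ; auto.
Qed.

(** One has to maximize [|1 - z / p|^2 = 1 - 2 Re z / p + |z|^2 / p^2], and [z0] has both the least
    real part and the largest modulus allowed. The value [z = 0] is covered. The comparison concerns
    whole Euler factors: a single [Re z^m] with [m >= 2] need not be least at [z0]. *)
Local Lemma T_min z n : Cmod z <= 1 -> - c <= Re z -> T z0 n <= T z n.
Proof.
  intros Hz Hre. destruct (isp (S n)) eqn:E.
  - rewrite !T_val by (auto; rewrite z0_mod; lra). pose proof (inv_half n E) as Hp.
    set (p := / INR (S n)) in *.
    assert (Hle : Cmod (1 - RtoC p * z) <= Cmod (1 - RtoC p * z0)).
    { rewrite <- (Rabs_pos_eq (Cmod (1 - RtoC p * z))), <- (Rabs_pos_eq (Cmod (1 - RtoC p * z0))) by apply Cmod_ge_0.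
      apply Rsqr_le_abs_0. rewrite !Rsqr_pow2, !Cmod2_alt.
      assert (Q : forall w : C, Re (1 - RtoC p * w) ^ 2 + Im (1 - RtoC p * w) ^ 2 =
        1 - 2 * p * Re w + p ^ 2 * (Re w ^ 2 + Im w ^ 2)) by (intros [u v]; simpl; ring).
      rewrite !Q, <- !Cmod2_alt, z0_mod. change (Re z0) with (- c).
      assert (Cmod z ^ 2 <= 1) by (pose proof (Cmod_ge_0 z); nra).
      assert (0 <= p ^ 2) by apply pow2_ge_0. nra. }
    assert (Hpos : 0 < Cmod (1 - RtoC p * z)).
    { apply Cmod_gt_0, Cminus_eq_contra. intros H1. apply (f_equal Cmod) in H1.
      rewrite Cmod_1, Cmod_mult, Cmod_R, Rabs_pos_eq in H1 by lra. pose proof (Cmod_ge_0 z). nra. }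
    apply ln_le in Hle; auto. lra.
  - unfold T. right. apply Series_ext. intros m. unfold ppinv. rewrite E. ring.
Qed.

(** Index [0], the first power of the prime, is set to zero because [Re z0 + c = 0] there; what
    remains is summable over the primes. *)
Let te (n m : nat) : R := match m with O => 0 | S _ => ppinv n m * exp (- logpp n m) end.

Local Lemma te_ge_0 n m : 0 <= te n m.
Proof.
  destruct m; simpl; [lra|]. apply Rmult_le_pos; [apply ppinv_bounds|apply Rlt_le, exp_pos].
Qed.

Local Lemma te_row n : ex_series (te n) /\ Series (te n) <= 2 * pw 2 (S n).
Proof.
  destruct (isp (S n)) eqn:E.
  - pose proof (inv_half n E) as Hp. set (p := / INR (S n)) in *.
    assert (Hpw : pw 2 (S n) = p ^ 2).
    { unfold pw. replace (- (2) * ln (INR (S n))) with (INR 2 * (- ln (INR (S n)))) by (simpl; ring).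
      rewrite exp_mul_nat, exp_Ropp, exp_ln; auto. apply lt_0_INR; lia. }
    rewrite Hpw.
    apply ex_series_bounded; [apply te_ge_0|].
    assert (H : forall N, rsum (te n) (S N) <= 2 * p ^ 2 * (1 - (/ 2) ^ N)).
    { induction N; [simpl; lra|]. change (rsum (te n) (S (S N))) with (rsum (te n) (S N) + te n (S N)).
      assert (te n (S N) <= p ^ 2 * (/ 2) ^ N).
      { unfold te. rewrite exp_logpp_inv. fold p.
        assert (H1 : p ^ S (S N) <= p ^ 2 * (/ 2) ^ N).
        { replace (p ^ S (S N)) with (p ^ 2 * p ^ N) by (simpl; ring).
          apply Rmult_le_compat_l; [apply pow2_ge_0|]. apply pow_incr; lra. }
        pose proof (ppinv_bounds n (S N)). assert (0 <= p ^ S (S N)) by (apply pow_le; lra). nra. }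
      simpl ((/ 2) ^ S N). lra. }
    intros [|N]; [simpl; pose proof (pow2_ge_0 p); simpl in *; lra|].
    eapply Rle_trans; [apply H|].
    assert (0 <= (/ 2) ^ N) by (apply pow_le; lra). pose proof (pow2_ge_0 p). nra.
  - assert (Z : forall m, te n m = 0) by (intros [|m]; unfold te, ppinv; rewrite ?E; ring).
    destruct (ex_series_bounded (te n) 0) as [H1 H2].
    + intros; rewrite Z; lra.
    + intros N. rewrite (rsum_ext _ (fun _ => 0)) by (intros; apply Z). rewrite rsum_const. lra.
    + split; auto. pose proof (pw_pos 2 (S n)). lra.
Qed.

Local Lemma T_z0_bound n : Rabs (T z0 n) <= 2 * Series (te n).
Proof.
  assert (Hz := z0_mod).
  unfold T. rewrite <- Series_scal_l.
  assert (Hterm : forall m, 0 <= Rabs (ppinv n m * (Re (Cpow z0 (S m)) + c) * exp (- logpp n m)) <= 2 * te n m).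
  { intros m. split; [apply Rabs_pos|]. destruct m as [|m].
    - simpl te. replace (Re (Cpow z0 1) + c) with 0.
      + rewrite Rmult_0_r, Rmult_0_l, Rabs_R0. lra.
      + rewrite Cpow_1_r. unfold z0; simpl. ring.
    - apply T_term_abs. lra. }
  assert (E2 : ex_series (fun m => 2 * te n m)).
  { apply (ex_series_scal_l (V := R_NormedModule) 2 (te n)), te_row. }
  eapply Rle_trans; [apply Series_Rabs; eapply ex_series_le_pos; [exact Hterm|exact E2]|].
  apply Series_le; auto.
Qed.

Local Lemma T_z0_ex : ex_series (T z0).
Proof.
  apply ex_series_Rabs. apply (ex_series_le_pos _ (fun n => 4 * pw 2 (S n))).
  - intros n. split; [apply Rabs_pos|]. eapply Rle_trans; [apply T_z0_bound|].
    pose proof (proj2 (te_row n)). lra.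
  - apply (ex_series_scal_l (V := R_NormedModule) 4 (fun n => pw 2 (S n))). apply pw_series; lra.
Qed.

(** As [|1 - z0 / p|^2 = 1 + 2 c / p + 1 / p^2], the factor of the constant at [p] is the
    exponential of the value of [T z0] there. This also proves that the product converges, which the
    use of [Lim_seq] in [C_const] leaves open. *)
Lemma C_const_exp : C_const l = exp (Series (T z0)).
Proof.
  assert (Hf : forall n, isp (S n) = true -> C_factor l (S n) = exp (T z0 n)).
  { intros n E. rewrite T_val by (auto; rewrite z0_mod; lra). pose proof (inv_half n E) as Hp.
    unfold C_factor. fold c. set (p := / INR (S n)) in *.
    assert (E1 : 1 + 2 * c / INR (S n) + / INR (S n) ^ 2 = Cmod (1 - RtoC p * z0) ^ 2).
    { rewrite Cmod2_alt. 
      assert (Q : forall w : C, Re (1 - RtoC p * w) ^ 2 + Im (1 - RtoC p * w) ^ 2 =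
        1 - 2 * p * Re w + p ^ 2 * (Re w ^ 2 + Im w ^ 2)) by (intros [u v]; simpl; ring).
      rewrite Q, <- Cmod2_alt, z0_mod. change (Re z0) with (- c). unfold p, Rdiv. rewrite pow_inv. ring. }
    rewrite E1.
    assert (Hpos : 0 < Cmod (1 - RtoC p * z0)).
    { apply Cmod_gt_0, Cminus_eq_contra. intros H1. apply (f_equal Cmod) in H1.
      rewrite Cmod_1, Cmod_mult, z0_mod, Cmod_R, Rabs_pos_eq in H1 by lra. lra. }
    unfold Rpower. rewrite <- exp_plus. f_equal. rewrite ln_pow by auto. simpl INR. field. }
  assert (Hz : forall n, isp (S n) = false -> T z0 n = 0).
  { intros n E. unfold T. rewrite (Series_ext _ (fun _ => 0)) by (intros; unfold ppinv; rewrite E; ring).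
    apply (f_equal Re CSer_0). }
  assert (Hprod : forall N, prod_primes (C_factor l) N = exp (rsum (T z0) N)).
  { induction N; [simpl; rewrite exp_0; auto|]. cbn [prod_primes rsum]. rewrite IHN, exp_plus. f_equal.
    destruct (isp (S N)) eqn:E.
    - rewrite <- Hf by auto. unfold isp in E. destruct (prime_dec (Z.of_nat (S N))); [auto|discriminate].
    - rewrite Hz, exp_0 by auto. unfold isp in E. destruct (prime_dec (Z.of_nat (S N))); [discriminate|auto]. }
  unfold C_const. rewrite (is_lim_seq_unique _ (exp (Series (T z0)))); [reflexivity|].
  eapply is_lim_seq_ext; [intros; symmetry; apply Hprod|].
  apply (is_lim_seq_continuous exp).
  - apply derivable_continuous_pt, derivable_pt_exp.
  - apply rsum_lim_Series, T_z0_ex.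
Qed.

Variable A : R.
Hypothesis HA : 1 < A.

(** What the higher powers of one prime lose because their weights are below [1]. *)
Let eK (K n : nat) : R := Series (fun m => te n m * (1 - poisw (A - 1) K n m)).

Local Lemma eK_term K n m : 0 <= te n m * (1 - poisw (A - 1) K n m) <= te n m.
Proof. pose proof (te_ge_0 n m). pose proof (poisw_bounds A K n m HA). split; nra. Qed.

Local Lemma eK_ex K n : ex_series (fun m => te n m * (1 - poisw (A - 1) K n m)).
Proof. eapply ex_series_le_pos; [apply eK_term|apply te_row]. Qed.

Local Lemma eK_bounds K n : 0 <= eK K n <= 2 * pw 2 (S n).
Proof.
  split; [apply Series_ge_0; [apply eK_term|apply eK_ex]|].
  eapply Rle_trans; [apply Series_le; [apply eK_term|apply te_row]|apply te_row].
Qed.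

Local Lemma eK_sum_ex K : ex_series (eK K).
Proof. eapply ex_series_le_pos; [apply eK_bounds|]. apply pw2_series; lra. Qed.

(** The weight of each fixed prime power tends to [1] with [K]; dominated convergence is applied
    along the powers of a prime, then along the primes. *)
Local Lemma eK_sum_lim : is_lim_seq (fun K => Series (eK K)) 0.
Proof.
  assert (Hz : Series (fun _ : nat => 0) = 0) by exact (f_equal Re CSer_0).
  assert (H : forall n, is_lim_seq (fun K => eK K n) 0).
  { intros n. unfold eK.
    destruct (Tannery_R (fun K m => te n m * (1 - poisw (A - 1) K n m)) (fun _ => 0) (te n)) as [_ H].
    - intros K m. pose proof (eK_term K n m). rewrite Rabs_pos_eq; lra.
    - apply te_row.
    - intros m. replace (Finite 0) with (Finite (te n m * (1 - 1))) by (f_equal; ring).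
      apply is_lim_seq_mult'; [apply is_lim_seq_const|].
      apply is_lim_seq_minus'; [apply is_lim_seq_const|]. apply pois_lim.
    - rewrite Hz in H. exact H. }
  destruct (Tannery_R eK (fun _ => 0) (fun n => 2 * pw 2 (S n))) as [_ H2].
  - intros K n. pose proof (eK_bounds K n). rewrite Rabs_pos_eq; lra.
  - apply pw2_series; lra.
  - exact H.
  - rewrite Hz in H2. exact H2.
Qed.

Local Lemma poisw_decr K n m : poisw (A - 1) K n m <= poisw (A - 1) K n 0.
Proof.
  apply pois_decr; [lra|]. split; [apply logpp_ge_0|]. unfold logpp.
  apply Rmult_le_compat_r; [apply ln_INR_ge_0|apply le_INR; lia].
Qed.

(** [T_min] compares full Euler factors, not weighted ones, so the weights of the row are first
    replaced by the weight [w0] of the prime itself. This replacement and the return from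
    [w0 * T z0] to [T z0] involve only powers with exponent at least [2], and each costs at most
    [2 * eK]. *)
Local Lemma row_lower K z n : Cmod z <= 1 -> - c <= Re z ->
  T z0 n - 4 * eK K n <= Series (fun m => ppinv n m * (Re (Cpow z (S m)) + c) * ppweight A K n m).
Proof.
  intros Hz Hre.
  set (w0 := poisw (A - 1) K n 0).
  assert (Hw0 : 0 <= w0 <= 1) by (apply poisw_bounds; auto).
  set (ET := fun m => ppinv n m * (Re (Cpow z (S m)) + c) * exp (- logpp n m)).
  assert (S1 : ex_series ET) by (apply T_ex; auto).
  assert (Sk : forall k f, ex_series f -> ex_series (fun n => k * f n)).
  { intros k f Hf. apply (ex_series_scal_l (V := R_NormedModule) k f Hf). }
  assert (H1 : w0 * T z n - 2 * eK K n <= Series (fun m => ppinv n m * (Re (Cpow z (S m)) + c) * ppweight A K n m)).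
  { unfold T, eK. fold ET. rewrite <- !Series_scal_l.
    rewrite <- Series_minus; [|apply (Sk w0 ET); auto|apply (Sk 2 (fun m => te n m * (1 - poisw (A - 1) K n m))), eK_ex].
    apply Series_mono.
    - intros m. unfold ET, ppweight. pose proof (poisw_decr K n m) as Hd. pose proof (poisw_bounds A K n m HA) as Hb.
      destruct m as [|m]; [unfold te, w0; right; ring|].
      fold w0 in Hd. set (w := poisw (A - 1) K n (S m)) in *.
      pose proof (T_term_abs z n (S m) Hz) as Ht. apply Rabs_le_between in Ht.
      change (te n (S m)) with (ppinv n (S m) * exp (- logpp n (S m))).
      set (u := ppinv n (S m) * (Re (Cpow z (S (S m))) + c) * exp (- logpp n (S m))) in *.
      set (v := ppinv n (S m) * exp (- logpp n (S m))) in *.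
      replace (ppinv n (S m) * (Re (Cpow z (S (S m))) + c) * (exp (- logpp n (S m)) * w)) with (w * u) by (unfold u; ring).
      assert (0 <= v) by lra.
      assert ((w0 - w) * u <= (w0 - w) * (2 * v)) by (apply Rmult_le_compat_l; lra).
      assert ((w0 - w) * (2 * v) <= (1 - w) * (2 * v)) by (apply Rmult_le_compat_r; lra).
      lra.
    - apply (ex_series_minus (V := R_NormedModule) (fun m => w0 * ET m) (fun m => 2 * (te n m * (1 - poisw (A - 1) K n m)))).
      + apply (Sk w0 ET); auto.
      + apply (Sk 2 (fun m => te n m * (1 - poisw (A - 1) K n m))), eK_ex.
    - apply ex_series_Rabs. apply (ex_series_le_pos _ (fun m => 2 * (ppinv n m * exp (- logpp n m)))).
      + intros m. split; [apply Rabs_pos|]. unfold ppweight. pose proof (poisw_bounds A K n m HA) as Hb.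
        replace (ppinv n m * (Re (Cpow z (S m)) + c) * (exp (- logpp n m) * poisw (A - 1) K n m)) with
          (ppinv n m * (Re (Cpow z (S m)) + c) * exp (- logpp n m) * poisw (A - 1) K n m) by ring.
        rewrite Rabs_mult, (Rabs_pos_eq (poisw _ _ _ _)) by lra.
        pose proof (T_term_abs z n m Hz). pose proof (Rabs_pos (ppinv n m * (Re (Cpow z (S m)) + c) * exp (- logpp n m))).
        nra.
      + apply (Sk 2 (fun m => ppinv n m * exp (- logpp n m))), ppinv_exp_ex. }
  pose proof (T_min z n Hz Hre) as H2.
  (* Weights decrease along the row, so [1 - w0] is the smallest of the losses. *)
  assert (H3 : (1 - w0) * Series (te n) <= eK K n).
  { unfold eK. rewrite <- Series_scal_l. apply Series_le; [|apply eK_ex].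
    intros m. pose proof (te_ge_0 n m). pose proof (poisw_decr K n m). fold w0 in H0.
    pose proof (poisw_bounds A K n m HA). split; [apply Rmult_le_pos; lra|]. nra. }
  pose proof (T_z0_bound n) as H4. apply Rabs_le_between in H4.
  assert (H5 : w0 * T z0 n <= w0 * T z n) by (apply Rmult_le_compat_l; lra).
  assert (H6 : (1 - w0) * T z0 n <= (1 - w0) * (2 * Series (te n))) by (apply Rmult_le_compat_l; lra).
  lra.
Qed.

(** [K0] is fixed before [a], which makes the estimate uniform over the characters; the loss is at
    most [4] times the sum of [eK], independent of [a]. *)
Lemma chi_dsum_lower eps : 0 < eps -> exists K0, forall K a, (K0 <= K)%nat ->
  (forall n, Cmod (a n) <= 1) -> (forall n, - c <= Re (a n)) ->
  ln (C_const l) - eps <= dsum A K (re_ppcoef a) + c * dsum A K ppinv.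
Proof.
  intros Heps. pose proof eK_sum_lim as H. apply is_lim_seq_spec in H.
  destruct (H (mkposreal (eps / 4) ltac:(lra))) as [K0 HK0].
  exists K0. intros K a HK Ha Hre. specialize (HK0 K HK). simpl in HK0.
  apply Rabs_def2 in HK0. rewrite C_const_exp, ln_exp.
  assert (Hc := c_bounds).
  assert (B1 : forall n m, Rabs (re_ppcoef a n m) <= 1 * ppinv n m) by (intros; apply re_ppcoef_bound; auto).
  assert (B2 : forall n m, Rabs (ppinv n m) <= 1 * ppinv n m).
  { intros n m. rewrite Rabs_pos_eq by apply ppinv_bounds. lra. }
  rewrite <- (dsum_plus A K (re_ppcoef a) ppinv 1 c HA B1 B2).
  assert (B3 : forall n m, Rabs (re_ppcoef a n m + c * ppinv n m) <= 2 * ppinv n m).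
  { intros n m. eapply Rle_trans; [apply Rabs_triang|]. rewrite Rabs_mult, (Rabs_pos_eq c) by lra.
    specialize (B1 n m). specialize (B2 n m). pose proof (ppinv_bounds n m). pose proof (Rabs_pos (ppinv n m)). nra. }
  destruct (dsum_ex A K (fun n m => re_ppcoef a n m + c * ppinv n m) 2 HA B3) as [E1 E2].
  assert (S4 : ex_series (fun n => 4 * eK K n)).
  { apply (ex_series_scal_l (V := R_NormedModule) 4 (eK K)), eK_sum_ex. }
  assert (G : Series (fun n => T z0 n - 4 * eK K n) <= dsum A K (fun n m => re_ppcoef a n m + c * ppinv n m)).
  { apply Series_mono; auto.
    - intros n. eapply Rle_trans; [apply (row_lower K (a (S n)) n); auto|].
      right. apply Series_ext. intros m. unfold re_ppcoef. ring.
    - apply (ex_series_minus (V := R_NormedModule) (T z0) (fun n => 4 * eK K n)); auto. apply T_z0_ex. }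
  rewrite Series_minus, Series_scal_l in G by (auto; apply T_z0_ex). lra.
Qed.

End LowerBound.

Lemma C_const_pos l : (3 <= l)%nat -> 0 < C_const l.
Proof. intros Hl. rewrite C_const_exp by auto. apply exp_pos. Qed.

(** * Choice of the truncation *)

Lemma odd_prime_odd l : prime (Z.of_nat l) -> l <> 2%nat -> Nat.odd l = true.
Proof.
  intros Hp Hl. destruct (Nat.odd l) eqn:E; auto. exfalso.
  rewrite <- Nat.negb_even in E. apply Bool.negb_false_iff, Nat.even_spec in E. destruct E as [k Hk].
  apply prime_alt in Hp. destruct Hp as [H1 H2]. apply (H2 2%Z); [lia|].
  exists (Z.of_nat k). lia.
Qed.

Lemma lnln_large X0 : exists Q : nat, forall q : nat, (Q <= q)%nat ->
  (2 <= q)%nat /\ 0 < ln (INR q) /\ X0 <= ln (ln (INR q)).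
Proof.
  destruct (nfloor_ex (exp (exp X0))) as [n Hn]; [apply Rlt_le, exp_pos|].
  exists (n + 2)%nat. intros q Hq.
  assert (HqR : INR n + 2 <= INR q).
  { apply le_INR in Hq. rewrite plus_INR in Hq. simpl in Hq. lra. }
  assert (H1 : exp X0 <= ln (INR q)).
  { rewrite <- (ln_exp (exp X0)). apply ln_le; [apply exp_pos|lra]. }
  pose proof (exp_pos X0).
  split; [lia|]. split; [lra|].
  rewrite <- (ln_exp X0) at 1. apply ln_le; auto.
Qed.

(** With [Y = ln q], the condition on [K] gives [rho^K <= Y^-(1 + kappa)]: one power of [Y] absorbs
    the size of the coefficients, and [Y^-kappa] tends to [0]. *)
Lemma truncation_error A theta kappa u : 2 <= A -> 0 < theta < 1 / 2 -> 0 < kappa -> 0 < u ->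
  exists X0, forall q K : nat, (2 <= q)%nat -> 0 < ln (INR q) -> X0 <= ln (ln (INR q)) ->
  (1 + kappa) * ln (ln (INR q)) <= INR K * ln (1 + theta / (A - 1)) ->
  2 * (ln (4 * INR q * A) + 4) * ((A - 1) / (A - 1 + theta)) ^ K / (1 - (A - 1) / (A - 1 + theta)) <= u.
Proof.
  intros HA Hth Hk Hu.
  set (B := A - 1). assert (HB : 1 <= B) by (unfold B; lra).
  set (rho := B / (B + theta)).
  assert (Hrho : 0 < rho < 1).
  { unfold rho. split; [apply Rdiv_lt_0_compat; lra|].
    apply Rmult_lt_reg_r with (B + theta); [lra|]. unfold Rdiv; rewrite Rmult_assoc, Rinv_l; lra. }
  assert (Hlam : ln (1 + theta / B) = - ln rho).
  { unfold rho. rewrite <- ln_Rinv by (apply Rdiv_lt_0_compat; lra). f_equal. field. lra. }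
  assert (H4A : 0 < ln (4 * A)) by (rewrite <- ln_1; apply ln_increasing; lra).
  (* Makes the final bound [4 / (v (1 - rho))] equal to [u]. *)
  set (v := 4 / ((1 - rho) * u)).
  assert (Hv : 0 < v) by (apply Rdiv_lt_0_compat; [lra|apply Rmult_lt_0_compat; lra]).
  exists (Rmax (ln (ln (4 * A) + 4)) (ln v / kappa)).
  intros q K Hq HY HX HK.
  pose proof (Rmax_l (ln (ln (4 * A) + 4)) (ln v / kappa)) as M1.
  pose proof (Rmax_r (ln (ln (4 * A) + 4)) (ln v / kappa)) as M2.
  set (Y := ln (INR q)) in *. set (X := ln Y) in *.
  assert (HqR : 2 <= INR q) by (apply (le_INR 2); auto).
  assert (HY2 : ln (4 * A) + 4 <= Y).
  { rewrite <- (exp_ln Y), <- (exp_ln (ln (4 * A) + 4)) by lra. apply exp_le. fold X. lra. }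
  assert (HE : ln (4 * INR q * A) = Y + ln (4 * A)).
  { unfold Y. rewrite <- ln_mult by lra. f_equal. ring. }
  rewrite HE.
  assert (Hpow : rho ^ K <= exp (- ((1 + kappa) * X))).
  { rewrite <- (exp_ln rho) by lra. rewrite <- exp_mul_nat. apply exp_le. rewrite Hlam in HK. lra. }
  assert (Hsplit : exp (- ((1 + kappa) * X)) = / Y * exp (- (kappa * X))).
  { replace (- ((1 + kappa) * X)) with (- X + - (kappa * X)) by ring.
    rewrite exp_plus, (exp_Ropp X). unfold X at 1. rewrite exp_ln by auto. auto. }
  assert (Hv2 : exp (- (kappa * X)) <= / v).
  { rewrite exp_Ropp. apply Rinv_le_contravar; auto. rewrite <- (exp_ln v) by auto. apply exp_le.
    assert (kappa * (ln v / kappa) <= kappa * X) by (apply Rmult_le_compat_l; lra).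
    replace (kappa * (ln v / kappa)) with (ln v) in H by (field; lra). lra. }
  assert (Hp1 : 2 * (Y + ln (4 * A) + 4) * rho ^ K <= 4 * Y * (/ Y * / v)).
  { apply Rmult_le_compat; [lra|apply pow_le; lra|lra|].
    eapply Rle_trans; [exact Hpow|]. rewrite Hsplit. apply Rmult_le_compat_l; auto.
    apply Rlt_le, Rinv_0_lt_compat; auto. }
  assert (Hr1 : 0 < / (1 - rho)) by (apply Rinv_0_lt_compat; lra).
  apply Rle_trans with (4 * Y * (/ Y * / v) * / (1 - rho)).
  - apply Rmult_le_compat_r; lra.
  - right. unfold v. field. lra.
Qed.

(* [B ln (1 + theta / B)] is close to [1 / 2], hence [K / B] is close to [2 ln ln q]. *)
Lemma truncation_size kappa X K (A theta : R) : 0 < kappa <= 1 -> 1 <= X ->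
  A = 4 / kappa + 1 -> theta = / (2 + kappa / 4) ->
  INR K <= (1 + kappa / 4) * X / ln (1 + theta / (A - 1)) + 1 ->
  INR K <= (A - 1) * (2 * (1 + kappa) * X).
Proof.
  intros Hk HX -> -> HK.
  replace (4 / kappa + 1 - 1) with (4 / kappa) in * by ring.
  set (B := 4 / kappa) in *. set (th := / (2 + kappa / 4)) in *.
  assert (HB : 0 < B) by (apply Rdiv_lt_0_compat; lra).
  assert (HBi : / B = kappa / 4) by (unfold B; field; lra).
  assert (Hth : 0 < th) by (apply Rinv_0_lt_compat; lra).
  assert (Hthi : / th = 2 + kappa / 4) by (unfold th; apply Rinv_inv).
  assert (Hq : 0 < th / B) by (apply Rdiv_lt_0_compat; lra).
  (* In the form [1 / ln (1 + x) <= 1 + 1 / x] with [x = th / B], this bounds the reciprocal by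
     [B (1 / th + 1 / B)], and both reciprocals are explicit in [kappa]. *)
  pose proof (ln_1p_ge (th / B) ltac:(lra)) as HL.
  assert (HL0 : 0 < th / B / (1 + th / B)) by (apply Rdiv_lt_0_compat; lra).
  assert (Hinv : / ln (1 + th / B) <= B * (/ th + / B)).
  { replace (B * (/ th + / B)) with (/ (th / B / (1 + th / B))) by (field; repeat split; lra).
    apply Rinv_le_contravar; auto. }
  rewrite Hthi, HBi in Hinv.
  assert (H0 : 0 <= (1 + kappa / 4) * X) by (apply Rmult_le_pos; lra).
  eapply Rle_trans; [exact HK|].
  assert (H1 : (1 + kappa / 4) * X / ln (1 + th / B) <= (1 + kappa / 4) * X * (B * (2 + kappa / 4 + kappa / 4))).
  { apply Rmult_le_compat_l; auto. }
  (* Rounding [K] to an integer costs [1 = B * (kappa / 4)], absorbed because [X >= 1]. *)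
  assert (H2 : 1 = B * (kappa / 4)) by (rewrite <- HBi; field; lra).
  apply Rle_trans with (B * ((1 + kappa / 4) * X * (2 + kappa / 4 + kappa / 4) + kappa / 4)); [rewrite Rmult_plus_distr_l, <- H2; lra|].
  apply Rmult_le_compat_l; [lra|].
  assert (kappa / 4 <= kappa / 4 * X) by nra.
  assert (kappa * kappa * X <= kappa * X) by nra.
  nra.
Qed.

Theorem theorem1p10 (l : nat) :
  GRH -> prime (Z.of_nat l) -> l <> 2%nat ->
  forall eps : R, 0 < eps ->
  exists Q : nat, forall (q : nat) (chi : nat -> C),
    Nat.le Q q -> is_dirichlet_char q chi -> primitive_char q chi -> char_order q chi l ->
    C_const l * (1 - eps)
      / Rpower (2 * exp euler_gamma * ln (ln (INR q))) (cos (PI / INR l))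
    <= Cmod (L1 chi) /\
    Cmod (L1 chi) <= 2 * exp euler_gamma * ln (ln (INR q)) * (1 + eps).
Proof.
  intros Hgrh Hl Hl2 eps Heps.
  assert (Hl3 : (3 <= l)%nat) by (apply prime_ge_2 in Hl; lia).
  pose proof (odd_prime_odd l Hl Hl2) as Hodd.
  pose proof (c_bounds l Hl3) as Hc. set (c := cos (PI / INR l)) in *.
  assert (Hln : 0 < ln (1 + eps)) by (rewrite <- ln_1; apply ln_increasing; lra).
  (* Error budget for [ln |L(1, chi)|]: the upper bound loses at most [3 kappa], from the Taylor
     remainder, the zeta sum and the size of [K]; the lower bound loses at most [4 kappa]. *)
  set (kappa := Rmin 1 (ln (1 + eps) / 4)).
  assert (Hk : 0 < kappa <= 1).
  { unfold kappa. split; [apply Rmin_glb_lt; lra|apply Rmin_l]. }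
  assert (Hk4 : 4 * kappa <= ln (1 + eps)).
  { pose proof (Rmin_r 1 (ln (1 + eps) / 4)). unfold kappa. lra. }
  set (A := 4 / kappa + 1). set (theta := / (2 + kappa / 4)).
  assert (HA : 2 <= A).
  { unfold A. assert (1 <= 4 / kappa); [|lra].
    apply Rmult_le_reg_r with kappa; [lra|]. unfold Rdiv. rewrite Rmult_assoc, Rinv_l; lra. }
  assert (Hth : 0 < theta < 1 / 2).
  { unfold theta. split; [apply Rinv_0_lt_compat; lra|].
    replace (1 / 2) with (/ 2) by field. apply Rinv_lt_contravar; lra. }
  set (lam := ln (1 + theta / (A - 1))).
  assert (Hlam : 0 < lam).
  { unfold lam. rewrite <- ln_1. assert (0 < theta / (A - 1)) by (apply Rdiv_lt_0_compat; lra).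
    apply ln_increasing; lra. }
  destruct (zeta_dsum_upper A kappa HA ltac:(lra)) as [K1 HK1].
  destruct (chi_dsum_lower l Hl3 A ltac:(lra) kappa ltac:(lra)) as [K2 HK2].
  destruct (truncation_error A theta (kappa / 4) kappa HA Hth ltac:(lra) ltac:(lra)) as [X1 HX1].
  (* The last entry forces [K >= K1 + K2], because [K * lam] will be at least [X]. *)
  destruct (lnln_large (Rmax (Rmax 1 X1) ((INR (K1 + K2)) * lam))) as [Q HQ].
  exists Q. intros q chi Hq Hchi _ Hord.
  destruct (HQ q Hq) as [Hq2 [HY HX]].
  assert (HXa : 1 <= ln (ln (INR q)) /\ X1 <= ln (ln (INR q)) /\ INR (K1 + K2) * lam <= ln (ln (INR q))).
  { pose proof (Rmax_l (Rmax 1 X1) (INR (K1 + K2) * lam)). pose proof (Rmax_r (Rmax 1 X1) (INR (K1 + K2) * lam)).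
    pose proof (Rmax_l 1 X1). pose proof (Rmax_r 1 X1). lra. }
  destruct HXa as [HXa [HXb HXc]]. clear HX.
  specialize (HX1 q).
  set (X := ln (ln (INR q))) in *.
  assert (Hx0 : 0 <= (1 + kappa / 4) * X / lam).
  { apply Rle_mult_inv_pos; auto. apply Rmult_le_pos; lra. }
  destruct (nfloor_ex _ Hx0) as [n Hn].
  (* One above the integer part, so that [K * lam] reaches [(1 + kappa / 4) * X]. *)
  set (K := S n).
  assert (HKr : (1 + kappa / 4) * X / lam <= INR K <= (1 + kappa / 4) * X / lam + 1) by (unfold K; rewrite S_INR; lra).
  assert (HKX : (1 + kappa / 4) * X <= INR K * lam).
  { replace ((1 + kappa / 4) * X) with ((1 + kappa / 4) * X / lam * lam) by (field; lra).
    apply Rmult_le_compat_r; lra. }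
  assert (HKn : (K1 + K2 <= K)%nat).
  { apply INR_le. apply Rmult_le_reg_r with lam; auto. nra. }
  assert (HKp : 0 < INR K) by (apply lt_0_INR; unfold K; lia).
  specialize (HX1 K Hq2 HY HXb HKX).
  specialize (HK1 K ltac:(lia)).
  pose proof (char_le_1 l q chi Hl Hl2 Hchi Hord Hq2) as Hle1.
  assert (Hre : forall n, - c <= Re (chi n)).
  { intros j. destruct (char_val l q chi Hchi Hord j) as [Z|Z].
    - rewrite Z. simpl. lra.
    - apply root_of_unity_Re; auto. }
  specialize (HK2 K chi ltac:(lia) Hle1 Hre). fold c in HK2.
  destruct (L1_approx l q chi Hl Hl2 Hchi Hord Hq2 Hgrh A HA theta Hth K ltac:(unfold K; lia)) as [HLp HLa].
  rewrite re_ppcoef_dsum in HLa.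
  assert (HLb : Rabs (ln (Cmod (L1 chi)) - dsum A K (re_ppcoef chi)) <= kappa) by lra.
  apply Rabs_le_between in HLb.
  assert (Hup : dsum A K (re_ppcoef chi) <= dsum A K ppinv).
  { apply (dsum_le A K _ _ 1); [lra| | |].
    - intros; apply re_ppcoef_bound; auto.
    - intros a b. rewrite Rabs_pos_eq by apply ppinv_bounds. lra.
    - intros a b. pose proof (re_ppcoef_bound chi a b Hle1) as H. apply Rabs_le_between in H. lra. }
  pose proof (truncation_size kappa X K A theta Hk HXa eq_refl eq_refl (proj2 HKr)) as Hsize.
  set (D := 2 * exp euler_gamma * X).
  assert (HD : 0 < D).
  { apply Rmult_lt_0_compat; [|lra]. apply Rmult_lt_0_compat; [lra|apply exp_pos]. }
  assert (HlnD : ln D = ln 2 + euler_gamma + ln X).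
  { unfold D. rewrite !ln_mult, ln_exp; try lra; try apply exp_pos.
    apply Rmult_lt_0_compat; [lra|apply exp_pos]. }
  assert (HlnK : ln (INR K) - ln (A - 1) <= ln 2 + kappa + ln X).
  { apply ln_le in Hsize; auto. rewrite ln_mult in Hsize; [|lra|].
    - rewrite !ln_mult in Hsize by lra. pose proof (ln_1p_le kappa ltac:(lra)). lra.
    - apply Rmult_lt_0_compat; [|lra]. lra. }
  assert (HS : dsum A K ppinv <= ln D + 2 * kappa) by lra.
  split.
  (* For [eps >= 1] the left side is at most [0]; otherwise [1 - eps] has a logarithm. *)
  - destruct (Rlt_dec eps 1) as [He|He].
    + pose proof (C_const_pos l Hl3) as HCp.
      rewrite <- (exp_ln (Cmod (L1 chi))) by auto.
      assert (Hr : C_const l * (1 - eps) / Rpower D c = exp (ln (C_const l) + ln (1 - eps) - c * ln D)).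
      { unfold Rpower, Rminus. rewrite !exp_plus, exp_Ropp, !exp_ln by lra. unfold Rdiv. auto. }
      rewrite Hr. apply exp_le.
      (* [(1 - eps) * (1 + eps) <= 1] lets the single budget [ln (1 + eps)] serve the lower bound
         too. *)
      assert (Hl1 : ln (1 - eps) <= - ln (1 + eps)).
      { rewrite <- ln_Rinv by lra. apply ln_le; [lra|].
        apply Rmult_le_reg_r with (1 + eps); [lra|]. rewrite Rinv_l by lra. nra. }
      assert (c * dsum A K ppinv <= c * (ln D + 2 * kappa)) by (apply Rmult_le_compat_l; lra).
      assert (c * (2 * kappa) <= 1 * (2 * kappa)) by (apply Rmult_le_compat_r; lra).
      lra.
    + apply Rle_trans with 0; [|apply Cmod_ge_0].
      pose proof (C_const_pos l Hl3) as HCp.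
      assert (0 < / Rpower D c) by (apply Rinv_0_lt_compat, exp_pos).
      unfold Rdiv. assert (C_const l * (1 - eps) <= 0) by nra. nra.
  - rewrite <- (exp_ln (Cmod (L1 chi))) by auto.
    rewrite <- (exp_ln (D * (1 + eps))) by (apply Rmult_lt_0_compat; lra).
    apply exp_le. rewrite ln_mult by lra. lra.
Qed.
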